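(* Fix $v\in\mathbb{Z}^d$ and a strictly convex potential $V:\mathbb{Z}^d\to\mathbb{R}^+\cup\{+\infty\}$ with $V(\vec0)=0$. If $\alpha^*_v(V)<\infty$, then for every $\alpha>\alpha^*_v(V)$ there exists a family of random permutations $(\zeta_{\Lambda,v},\ \Lambda\subseteq\mathbb{Z}^d)$ on a common probability space, with $\zeta_{\Lambda,v}\in S_\Lambda$, such that: (i) for every finite $\Lambda$, $\tau_v\zeta_{\Lambda,v}$ is distributed according to $G_{\Lambda|\tau_v}$; (ii) for all $x\in\mathbb{Z}^d$, $\lim_{\Lambda\nearrow\mathbb{Z}^d}\tau_v\zeta_{\Lambda,v}(x)=\tau_v\zeta_{\mathbb{Z}^d,v}(x)$ almost surely; calling $\mu_v$ the law of $\tau_v\zeta_{\mathbb{Z}^d,v}$, $G_{\Lambda|\tau_v}\to\mu_v$ weakly as $\Lambda\nearrow\mathbb{Z}^d$; (iii) $\mu_v$ is a Gibbs measure at temperature $\alpha$, ergodic (with respect to spatial translations), with mean jump $v$; (iv) $\mu_v\tau_{-v}$ is the only measure with cycle weights $w_v$ (i.e. the only Gibbs measure for the specifications $G^{(v)}_\Lambda$ defined below) supported on the set of finite-cycle permutations of $\mathbb{Z}^d$.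
   Context: $S$ is the set of bijections of $\mathbb{Z}^d$ (product topology); composition is $(\sigma\sigma')(x)=\sigma(\sigma'(x))$, $\tau_v(x)=x+v$, and for a measure $\mu$ on $S$ and $\tau\in S$, $\mu\tau$ denotes the law of $\tau\sigma$ when $\sigma\sim\mu$. For $\xi\in S$ and finite $\Lambda$, $S_{\Lambda|\xi}=\{\sigma:\sigma(x)=\xi(x),\ x\notin\Lambda\}$, $S_\Lambda=S_{\Lambda|\mathrm{I}}$ ($\mathrm{I}$ the identity; $S_{\mathbb{Z}^d}=S$). $H_\Lambda(\sigma)=\sum_{x\in\Lambda}V(\sigma(x)-x)$ and $G_{\Lambda|\xi}(\sigma)=Z^{-1}_{\Lambda|\xi}e^{-\alpha H_\Lambda(\sigma)}$ on $S_{\Lambda|\xi}$. A measure $\mu$ is Gibbs at temperature $\alpha$ if for all finite $\Lambda$ and $\mu$-a.e. $\xi$, $\mu(\cdot\mid\sigma=\xi \text{ off }\Lambda)=G_{\Lambda|\xi}$. A finite cycle of length $n\ge2$ on distinct sites $x_1,\dots,x_n$ maps $x_i\mapsto x_{i+1}$ (mod $n$) and fixes other sites; its support is $\{\gamma\}$, its length $|\gamma|$; $\Gamma$ is the set of finite cycles; a permutation is finite-cycle if all cycles in its disjoint-cycle decomposition are finite. The $v$-weight is $w_v(\gamma)=\exp\{-\alpha\sum_{x\in\{\gamma\}}(V(\gamma(x)+v-x)-V(v))\}$, $\beta_v(V,\alpha)=\sum_{\gamma\in\Gamma,\vec0\in\{\gamma\}}|\gamma|w_v(\gamma)$, and $\alpha^*_v(V)=\inf\{\alpha:\beta_v(V,\alpha)<1\}$.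 The specifications with cycle weights $w_v$ are $G^{(v)}_{\Lambda|\xi}(\sigma)\propto\exp\{-\alpha\sum_{x\in\Lambda}V_v(\sigma(x)-x)\}$ on $S_{\Lambda|\xi}$, where $V_v(y)=V(y+v)-V(v)$; for $\sigma\in S_\Lambda$ one has $G^{(v)}_\Lambda(\sigma)\propto\prod_{\gamma\in\sigma}w_v(\gamma)$. *)

(* Defs.v *)
From HB Require Import structures.
From mathcomp Require Import all_boot all_order all_algebra.
From mathcomp Require Import all_classical all_reals all_analysis.
Set Implicit Arguments. Unset Strict Implicit. Unset Printing Implicit Defensive.
Import Order.TTheory GRing.Theory Num.Theory.
Local Open Scope classical_set_scope.
Local Open Scope ring_scope.

(* int as a pointed type (needed for the product measurable space) *)
HB.instance Definition _ := isPointed.Build int 0%R.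

Notation site d := ('rV[int]_d).
Notation pfun d := ('rV[int]_d -> 'rV[int]_d).

Section Defs.
Variable R : realType.
Variable d : nat.

Local Notation site := (site d).
Local Notation pfun := (pfun d).


Definition tau (u : site) : pfun := fun x => x + u.

Definition S_cond (L : set site) (xi : pfun) : set pfun :=
  [set s | bijective s /\ forall x, ~ L x -> s x = xi x].
Definition S_of (L : set site) : set pfun := S_cond L id.
Definition Sbij : set pfun := [set s | bijective s].

Definition energy (U : site -> \bar R) (L : set site) (s : pfun) : \bar R :=
  (\sum_(x \in L) U (s x - x)%R)%E.
Definition boltz (U : site -> \bar R) (a : R) (L : set site) (s : pfun) : \bar R :=
  expeR (- (a%:E * energy U L s))%E.
Definition partfun (U : site -> \bar R) (a : R) (L : set site) (xi : pfun) : \bar R :=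
  \esum_(s in S_cond L xi) boltz U a L s.
Definition spec (U : site -> \bar R) (a : R) (L : set site) (xi : pfun) (s : pfun) : R :=
  if s \in S_cond L xi then fine (boltz U a L s) / fine (partfun U a L xi) else 0.
Definition specA (U : site -> \bar R) (a : R) (L : set site) (xi : pfun) (A : set pfun)
  : \bar R := \esum_(s in S_cond L xi `&` A) (spec U a L xi s)%:E.

Definition cyl (D : set site) : set (set pfun) :=
  [set A | exists x y, D x /\ A = [set s : pfun | s x = y]].
Definition PermSp : measurableType (sigma_display (cyl setT)) :=
  g_sigma_algebraType (cyl setT).

(* random permutation (measurable map into the product sigma-algebra) *)
Definition random_map (dO : measure_display) (O : measurableType dO)
  (X : O -> pfun) : Prop :=
  forall x y, measurable [set w | X w x = y].

(* Gibbs measure for the specification with potential U at temperature a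
   (DLR formulation of "mu(. | s = xi off Lambda) = G_{Lambda|xi} mu-a.s.") *)
Definition gibbs (U : site -> \bar R) (a : R) (mu : probability PermSp R) : Prop :=
  mu Sbij = 1%E /\
  forall L : set site, finite_set L ->
  forall A : set PermSp, measurable A ->
  forall B : set PermSp, <<s cyl (~` L) >> B ->
    mu (A `&` B) = (\int[mu]_(xi in B) specA U a L xi A)%E.

Definition shiftp (u : site) (s : pfun) : pfun := fun x => s (x - u) + u.

Definition ergodic (mu : probability PermSp R) : Prop :=
  (forall u (A : set PermSp), measurable A -> mu (shiftp u @^-1` A) = mu A) /\
  (forall A : set PermSp, measurable A -> (forall u, shiftp u @^-1` A = A) ->
     mu A = 0%E \/ mu A = 1%E).

Definition mean_jump (mu : probability PermSp R) (v : site) : Prop :=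
  forall i : 'I_d,
    mu.-integrable setT (fun s : PermSp => ((((s 0 - 0) ord0 i)%:~R : R)%:E)) /\
    (\int[mu]_s ((((s 0 - 0) ord0 i)%:~R : R)%:E) = (((v ord0 i)%:~R : R)%:E))%E.

Definition cont_on_S (f : pfun -> R) : Prop :=
  forall s, Sbij s -> forall e : R, 0 < e -> exists F : set site, finite_set F /\
    forall s', Sbij s' -> (forall x, F x -> s' x = s x) -> `|f s' - f s| < e.
Definition weak_conv (U : site -> \bar R) (a : R) (xi : pfun)
  (mu : probability PermSp R) : Prop :=
  forall f : pfun -> R, (exists M : R, forall s, Sbij s -> `|f s| <= M) -> cont_on_S f ->
  forall e : R, 0 < e -> exists L0 : set site, finite_set L0 /\
    forall L : set site, finite_set L -> L0 `<=` L ->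
      `| (\sum_(s \in S_cond L xi) spec U a L xi s * f s)
          - fine (\int[mu]_(s in (Sbij : set PermSp)) (f s)%:E)%E | < e.

Definition finite_cycle (s : pfun) : Prop :=
  bijective s /\ forall x, exists n : nat, (0 < n)%N /\ iter n s x = x.

Definition Gamma : set pfun :=
  [set g | exists c : seq site, [/\ uniq c, (2 <= size c)%N & g = path.next c]].
Definition supp (g : pfun) : set site := [set x | g x != x].
Definition cyc_len (g : pfun) : nat := (\sum_(x \in supp g) 1)%N.

Definition Vv (V : site -> \bar R) (v : site) : site -> \bar R :=
  fun y => (V (y + v)%R - V v)%E.
Definition wv (V : site -> \bar R) (v : site) (a : R) (g : pfun) : \bar R :=
  expeR (- (a%:E * \sum_(x \in supp g) (V (g x + v - x)%R - V v)))%E.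
Definition beta (V : site -> \bar R) (v : site) (a : R) : \bar R :=
  \esum_(g in Gamma `&` [set g | g 0 != 0]) ((cyc_len g)%:R%:E * wv V v a g)%E.
Definition alpha_star (V : site -> \bar R) (v : site) : \bar R :=
  ereal_inf [set a%:E | a in [set a : R | (beta V v a < 1)%E]].

Definition strictly_convex (V : site -> \bar R) : Prop :=
  exists W : 'rV[R]_d -> \bar R,
    (forall z : site, V z = W (map_mx (fun k : int => (k%:~R : R)) z)) /\
    forall (x y : 'rV[R]_d) (t : R), x != y -> 0 < t < 1 ->
      W x \is a fin_num -> W y \is a fin_num ->
      (W (t *: x + (1 - t) *: y)%R < t%:E * W x + (1 - t)%:E * W y)%E.

End Defs.

(* Main.v *)
(* Write p y = exp (- alpha (V (y + v) - V v)): the finite-volume laws give a permutation s the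
   weight prod_x p (s x - x), a product over the cycles of s. The probability that all sites of
   a set A are fixed obeys a recursion, by summing over the cycle through one more site. When
   beta < 1 this recursion is a contraction, so its solution in infinite volume is unique, is
   the limit of the finite-volume ones, is translation invariant and is mixing. A law carried
   by finite-cycle permutations is determined by these probabilities together with its cycle
   weights; hence uniqueness and ergodicity.

   The coupling reads the cycles through the successive sites as the digits of one uniform
   variable in [0, 1[, through nested intervals whose lengths are the probabilities of the
   initial words of cycles. These lengths converge, so each digit is eventually constant off
   the countable set of endpoints.

   For the mean jump, the permutation seen from the image of the origin has the same law, and
   the jumps along a finite cycle add up to 0. Integrability needs |s 0| <= C (E + 1), E being
   the energy of the cycle through 0: by convexity at midpoints, closed lists of steps can be
   halved, up to a bounded error, together with their energy, until only the finitely many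
   cycles of bounded energy are left; and alpha exceeds some temperature where beta < 1 still
   holds, which leaves room for the factor E + 1. *)
From HB Require Import structures.
From mathcomp Require Import all_boot all_order all_algebra.
From mathcomp Require Import all_classical all_reals all_analysis measurable_realfun.
From mathcomp Require Import lra zify.
Require Import Defs.
Set Implicit Arguments. Unset Strict Implicit. Unset Printing Implicit Defensive.
Import Order.TTheory GRing.Theory Num.Theory.
Import numFieldNormedType.Exports.
Local Open Scope classical_set_scope.
Local Open Scope ring_scope.

(** * Permutations and their cycles *)

Section Perm.
Variable d : nat.
Local Notation T := (site d).
Implicit Types (A B L : set T) (s : pfun d) (x y : T) (o : seq T).

(** The length factor in [beta] pays for the expansion over cycles: the probability that all sites
    of a cycle are fixed is a product of one conditional probability per site, each known up to the
    same error e, so a cycle of length n costs n e. Volumes and fixed sets play the same part, since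
    fixing the sites of [A] in [D] amounts to working in [D] minus [A]. Two situations are thus
    compared through their free sites near a point ([agree]), and this single comparison gives the
    limit, uniqueness and mixing. The tree of words branches infinitely, so mass could escape in the
    limit; it cannot, because in every volume the probability of a cycle is at most its weight.
    [cycle_law] is the link with the Gibbs property: a finite stable set splits a finite-cycle
    permutation, the DLR equation for a stable set gives the cycle weights, and conversely the cycle
    weights give the DLR equation for every finite set, tested on larger stable sets. All of this is
    done for the potential [Vv V v]; left composition with [tau v] carries it to [V]. *)

Lemma S_of_id L : S_of L (id : pfun d).
Proof. by split=> //; exists id. Qed.

Lemma S_of_bij L s : S_of L s -> bijective s.
Proof. by case. Qed.

Lemma S_of_fix L s x : S_of L s -> ~ L x -> s x = x.
Proof. by case=> _; apply. Qed.

Lemma S_of_stable L s x : S_of L s -> L x -> L (s x).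
Proof.
move=> Ss Lx; apply: contrapT => nL.
have := S_of_fix Ss nL => /(bij_inj (S_of_bij Ss)) E; by apply: nL; rewrite E.
Qed.

Lemma S_of_sub A B s : A `<=` B -> S_of A s -> S_of B s.
Proof. by move=> AB [bs fs]; split=> // x nB; apply: fs => /AB. Qed.

Lemma S_of_comp L s (t : pfun d) : S_of L s -> S_of L t -> S_of L (s \o t).
Proof.
move=> Ss St; split; first exact: bij_comp (S_of_bij Ss) (S_of_bij St).
by move=> x nL /=; rewrite (S_of_fix St nL) (S_of_fix Ss nL).
Qed.

Lemma S_cond_comp L xi s (t : pfun d) : S_cond L xi s -> S_of L t -> S_cond L xi (s \o t).
Proof.
move=> [bs Ss] St; split; first exact: bij_comp bs (S_of_bij St).
by move=> x nL /=; rewrite (S_of_fix St nL) Ss.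
Qed.

(** A coset of the group [S_of L]. It is empty for some [xi], hence the base point [s]. *)
Lemma S_condE L xi s : S_cond L xi s ->
  S_cond L xi = (fun t => s \o t) @` S_of L.
Proof.
move=> [[s' sK s'K] Ss]; apply/seteqP; split=> [t [bt St]|t [u Su <-]].
  exists (s' \o t); last by apply/funext => x /=; rewrite s'K.
  split; first by apply: bij_comp bt; exists s.
  by move=> x nL /=; rewrite St// -Ss// sK.
by apply: S_cond_comp => //; split=> //; exists s'.
Qed.

Lemma finite_S_of L : finite_set L -> finite_set (S_of L : set (pfun d)).
Proof.
move=> /finite_seqP[l ->].
(* A permutation in [S_of L] is recovered from the indices of the images of the sites in [l]. The
   spare index makes the codomain nonempty, for [inord]. *)
pose dec (f : {ffun 'I_(size l) -> 'I_(size l).+1}) : pfun d :=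
  fun x => if insub (index x l) is Some i then nth 0 l (f i) else x.
apply: (@sub_finite_set _ _ (dec @` setT)); last first.
  by apply: finite_image; exact: finite_finset.
move=> s Ss; exists [ffun i : 'I_(size l) => inord (index (s (nth 0 l i)) l)] => //.
apply/funext => x; rewrite /dec; case: insubP => [i|].
  rewrite index_mem => xl xi; rewrite ffunE [nat_of_ord i]xi nth_index// inordK.
    by rewrite nth_index//; apply: (@S_of_stable [set` l]).
  by rewrite ltnS index_size.
by rewrite index_mem => xl; rewrite (S_of_fix Ss)//= => /(negP xl).
Qed.

Lemma finite_S_cond L xi : finite_set L -> finite_set (S_cond L xi : set (pfun d)).
Proof.
move=> fL; have [->|/set0P[s Ss]] := eqVneq (S_cond L xi) set0.
  exact: finite_set0.
by rewrite (S_condE Ss); apply: finite_image; exact: finite_S_of.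
Qed.

(** A cycle through [x] is listed from [x], which makes the list unique; [[:: x]] stands for a fixed
    point. *)
Definition Cyc x : set (seq T) := [set o | uniq o /\ exists t, o = x :: t].

Definition follows o : set (pfun d) := [set s | forall y, y \in o -> s y = next o y].

Lemma Cyc_head x o : Cyc x o -> x \in o.
Proof. by move=> [_ [t ->]]; rewrite mem_head. Qed.

Lemma follows_mem o s y : follows o s -> y \in o -> s y \in o.
Proof. by move=> fo yo; rewrite fo// mem_next. Qed.

Lemma follows_iter x (t : seq T) s : follows (x :: t) s -> uniq (x :: t) ->
  x :: t = traject s x (size t).+1 /\ iter (size t).+1 s x = x.
Proof.
move=> fo u.
have : fcycle s (x :: t).
  have := cycle_next u; rewrite /= => /pathP h; apply/(pathP x) => i hi.
  have := h x i hi => /eqP <-; apply/eqP; apply: fo.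
  rewrite size_rcons ltnS in hi.
  by rewrite -[x :: rcons t x]/(rcons (x :: t) x) nth_rcons /= ltnS hi mem_nth.
rewrite /= => /fpathE E.
have E2 : x :: t = traject s x (size t).+1.
  move: E; rewrite size_rcons => /(congr1 (take (size t))).
  by rewrite -cats1 take_size_cat// take_traject// => e; rewrite trajectS -e.
split=> //.
have := congr1 (last x) E; rewrite last_rcons size_rcons last_traject => e.
exact: esym.
Qed.

(** Both lists are initial pieces of the orbit of [x]. Were one shorter, the orbit would be back at
    [x] right after it, inside the longer list. *)
Lemma cyc_uniq x o o' s : Cyc x o -> Cyc x o' -> follows o s -> follows o' s ->
  o = o'.
Proof.
wlog le : o o' / (size o <= size o')%N.
  move=> H Co Co' fo fo'; case: (leqP (size o) (size o')) => h; first exact: H.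
  by apply/esym/H => //; exact: ltnW.
move=> [u [t E]] [u' [t' E']] fo fo'; subst.
have [e1 i1] := follows_iter fo u; have [e2 i2] := follows_iter fo' u'.
rewrite /= ltnS leq_eqVlt in le; case/orP: le => [/eqP e|lt].
  by rewrite e1 e2 e.
exfalso; move: u'; rewrite e2 => u'.
have : nth x (traject s x (size t').+1) (size t).+1 = nth x (traject s x (size t').+1) 0.
  by rewrite !nth_traject.
move/eqP; rewrite nth_uniq ?size_traject//.
Qed.

(** The orbit of [x] up to its least period; minimality excludes repetitions. *)
Lemma cyc_exists s x : finite_cycle s -> exists o, Cyc x o /\ follows o s.
Proof.
move=> [bs fs].
have exP : exists n, (0 < n)%N && (iter n s x == x).
  by have [n [n0 nx]] := fs x; exists n; rewrite n0 nx eqxx.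
case: (ex_minnP exP) => n /andP[n0 /eqP nx] mn.
have u : uniq (traject s x n).
  case: n n0 nx mn => // n _ nx mn; rewrite looping_uniq; apply/negP => /trajectP[i lt].
  have injs k : injective (iter k s).
    by elim: k => // k IH a b /= /(bij_inj bs) /IH.
  rewrite -(subnKC (ltnW lt)) iterD => /injs /esym e.
  have := mn (n - i)%N; rewrite -e eqxx subn_gt0 lt => /(_ isT).
  by rewrite leqNgt ltnS leq_subr.
exists (traject s x n); split.
  by split=> //; case: n {nx mn u} n0 => // n _; exists (traject s (s x) n).
move=> y yo; apply/esym/eqP; rewrite eq_sym.
suff c : fcycle s (traject s x n) by exact: (next_cycle c yo).
case: n n0 nx {mn u yo} => // n _ nx /=.
rewrite (_ : rcons _ _ = traject s (s x) n.+1); first exact: fpath_traject.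
by rewrite trajectSr -iterSr nx.
Qed.

Definition cyc s x : seq T := xget [::] [set o | Cyc x o /\ follows o s].

Lemma cycP s x : finite_cycle s -> Cyc x (cyc s x) /\ follows (cyc s x) s.
Proof.
move=> /(cyc_exists x) [ o [Co fo]]; rewrite /cyc.
case: xgetP => [y _ h|h]; first exact: h.
by case: (h o).
Qed.

Lemma cycE s x o : finite_cycle s -> Cyc x o -> (cyc s x = o) <-> follows o s.
Proof.
move=> fs Co; have [C f] := cycP x fs; split=> [<-//|fo]; exact: (cyc_uniq C Co f fo).
Qed.

Lemma next_out o y : y \notin o -> next o y = y.
Proof. by move=> yo; rewrite next_nth (negPf yo). Qed.

Lemma next_S_of o : uniq o -> S_of [set` o] (next o).
Proof.
move=> u; split; last by move=> x /negP; exact: next_out.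
by exists (prev o); [exact: prev_next|exact: next_prev].
Qed.

(** Pigeonhole: more iterates of [x] than sites in [l], so two coincide, and injectivity cancels the
    common part. *)
Lemma S_of_finite_cycle L s : finite_set L -> S_of L s -> finite_cycle s.
Proof.
move=> fL Ss; split; first exact: S_of_bij Ss.
move=> x; have [Lx|nL] := pselect (L x); last by exists 1%N; rewrite /= (S_of_fix Ss).
have /finite_seqP [l Ll] := fL.
have orb k : iter k s x \in l.
  have : L (iter k s x) by elim: k => //= k; exact: (S_of_stable Ss).
  by rewrite Ll.
pose f (k : 'I_(size l).+1) : 'I_(size l) := Ordinal (etrans (index_mem (iter k s x) l) (orb k)).
have : ~~ injectiveb f.
  apply/negP => /injectiveP /leq_card; by rewrite !card_ord ltnn.
case/injectivePn => i [j ij] /(congr1 val) /= /(congr1 (nth 0 l)).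
rewrite !nth_index//.
have injs k : injective (iter k s).
  by elim: k => // k IH a b /= /(bij_inj (S_of_bij Ss)) /IH.
wlog lt : i j ij / (i < j)%N.
  move=> H; have : (i < j)%N || (j < i)%N by rewrite -neq_ltn.
  by case/orP => lt e; [apply: (H i j)|apply: (H j i)]; rewrite // eq_sym.
rewrite -(subnKC (ltnW lt)) iterD => /injs e; exists (j - i)%N.
by rewrite subn_gt0.
Qed.

End Perm.

(** * Cycle weights in finite volume *)

Lemma esum_fiber (R : realType) (T1 T2 : choiceType) (A : set T1) (O : set T2)
    (lab : T1 -> T2) (a : T1 -> \bar R) :
  (forall s, A s -> O (lab s)) -> (forall s, A s -> (0 <= a s)%E) ->
  (\esum_(s in A) a s = \esum_(o in O) \esum_(s in A `&` [set s | lab s = o]) a s)%E.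
Proof.
move=> AO a0; rewrite esum_esum; last by move=> o s _ [As _]; exact: a0.
apply/esym; rewrite (reindex_esum A _ (fun s => (lab s, s)))//; split.
- by move=> s As; split=> //=; exact: AO.
- by move=> s1 s2 _ _ [].
- by move=> [q s] /= [Oq [As <-]]; exists s.
Qed.

Lemma esum_mulr (R : realType) (T1 : choiceType) (A : set T1) (c : R) (a : T1 -> \bar R) :
  (0 <= c) -> (forall s, (0 <= a s)%E) ->
  (\esum_(s in A) (c%:E * a s) = c%:E * \esum_(s in A) a s)%E.
Proof.
move=> c0 a0; have [->|cn0] := eqVneq c 0.
  by rewrite mul0e esum1// => s As; rewrite mul0e.
have c1 : (0 < c)%R by rewrite lt_neqAle eq_sym cn0.
(* One inequality is enough: the other is the same one for [c^-1]. *)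
have le (k : R) (f : T1 -> \bar R) : (0 < k)%R -> (forall s, (0 <= f s)%E) ->
    (\esum_(s in A) (k%:E * f s) <= k%:E * \esum_(s in A) f s)%E.
  move=> k0 f0; apply: ge_ereal_sup => _ [X [finX XA] <-].
  rewrite fsbig_finite//= -ge0_sume_distrr//.
  rewrite lee_pmul2l// ?lte_fin//; apply: esum_ge; exists X => //.
  by rewrite fsbig_finite.
apply/eqP; rewrite eq_le le//=.
rewrite [X in (_ * X <= _)%E](_ : _ = \esum_(s in A) (c^-1%:E * (c%:E * a s)))%E; last first.
  by apply: eq_esum => s _; rewrite muleA -EFinM mulVf// mul1e.
have cV : 0 < c^-1 by rewrite invr_gt0.
rewrite -[leRHS]mul1e -(@divff _ c)// EFinM -muleA lee_pmul2l ?lte_fin//.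
by apply: le => // s; rewrite mule_ge0// lee_fin.
Qed.

Section Weights.
Variables (R : realType) (d : nat) (p : site d -> R).
Hypothesis p_ge0 : forall y, 0 <= p y.
Hypothesis p0 : p 0 = 1.
Local Notation T := (site d).
Implicit Types (A B L : set T) (s : pfun d) (x y : T) (o : seq T).

Definition weight A s : R := \big[*%R/1]_(x \in A) p (s x - x).
Definition cyc_weight o : R := weight [set` o] (next o).
Local Notation W := weight.
Local Notation w := cyc_weight.

Lemma W_ge0 A s : 0 <= W A s.
Proof.
by rewrite /weight; elim/big_ind: _ => //; exact: mulr_ge0.
Qed.

Lemma eq_W A s t : (forall x, A x -> s x = t x) -> W A s = W A t.
Proof. by move=> st; apply: eq_fsbigr => x /[1!inE] Ax; rewrite st. Qed.

Lemma W_setU A B s : finite_set A -> finite_set B -> A `&` B = set0 ->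
  W (A `|` B) s = W A s * W B s.
Proof. by move=> fA fB AB; rewrite /weight fsbigU0// => x; rewrite AB. Qed.

Lemma W_fixed A s : (forall x, A x -> s x = x) -> W A s = 1.
Proof. by move=> fs; apply: fsbig1 => x Ax; rewrite fs// subrr. Qed.

Lemma W_sub A L s : finite_set L -> A `<=` L -> (forall x, L x -> ~ A x -> s x = x) ->
  W L s = W A s.
Proof.
move=> fL AL fs; rewrite -(setDUK AL) W_setU ?setDIK//.
- by rewrite [X in _ * X]W_fixed ?mulr1// => x [Lx nA]; exact: fs.
- exact: sub_finite_set fL.
- exact: finite_setD.
Qed.

Lemma W_comp A L s t : finite_set L -> A `<=` L -> S_of A s -> S_of (L `\` A) t ->
  W L (s \o t) = W A s * W (L `\` A) t.
Proof.
move=> fL AL Ss St; rewrite -{1}(setDUK AL) W_setU ?setDIK//.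
- congr (_ * _); apply: eq_W => x /= Ax.
    by rewrite (S_of_fix St)// => -[].
  by rewrite (S_of_fix Ss)//; have [] := S_of_stable St Ax.
- exact: sub_finite_set fL.
- exact: finite_setD.
Qed.

Definition partZ L : R := fine (\esum_(s in S_of L) (W L s)%:E)%E.

Lemma esum_W_fin L (B : set (pfun d)) : finite_set L -> B `<=` S_of L ->
  (\esum_(s in B) (W L s)%:E)%E \is a fin_num.
Proof.
move=> fL BS; rewrite esum_fset; last 2 first.
- by apply: sub_finite_set (finite_S_of fL).
- by move=> i _; rewrite lee_fin W_ge0.
by rewrite fsumEFin//; apply: sub_finite_set (finite_S_of fL).
Qed.

Lemma partZE L : finite_set L -> (\esum_(s in S_of L) (W L s)%:E = (partZ L)%:E)%E.
Proof. by move=> fL; rewrite /partZ fineK// esum_W_fin. Qed.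

Lemma partZ_ge1 L : finite_set L -> 1 <= partZ L.
Proof.
move=> fL; rewrite -lee_fin -partZE//; apply: esum_ge.
exists [set id]; first by split; [exact: finite_set1|move=> _ ->; exact: S_of_id].
by rewrite fsbig_set1 W_fixed.
Qed.

Lemma partZ_gt0 L : finite_set L -> 0 < partZ L.
Proof. by move=> /partZ_ge1; exact: lt_le_trans. Qed.

(** The permutations in question are [s] composed with a permutation of [L] minus [A], and the two
    weights multiply. *)
Lemma esum_agree L A s : finite_set L -> A `<=` L -> S_of A s ->
  (\esum_(t in S_of L `&` [set t | forall x, A x -> t x = s x]) (W L t)%:E =
   (W A s * partZ (L `\` A))%:E)%E.
Proof.
move=> fL AL Ss.
have fLA : finite_set (L `\` A) by exact: finite_setD.
rewrite EFinM -partZE// -esum_mulr ?W_ge0//; last by move=> t; rewrite lee_fin W_ge0.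
rewrite (reindex_esum (S_of (L `\` A)) _ (fun t => s \o t)); last first.
  have [s' sK s'K] := S_of_bij Ss.
  split.
  - move=> t St; split.
      by apply: S_of_comp; [exact: S_of_sub Ss|apply: S_of_sub St => x []].
    by move=> x Ax /=; rewrite (S_of_fix St)// => -[].
  - move=> t u _ _ tu; apply/funext => x; apply: (can_inj sK).
    by move/(congr1 (fun f => f x)) : tu.
  - move=> t [St ts]; exists (s' \o t); last by apply/funext => x /=; rewrite s'K.
    split; first by apply: bij_comp (S_of_bij St); exists s.
    move=> x nLA /=; have [Ax|nA] := pselect (A x); first by rewrite ts.
    rewrite (S_of_fix St); last by move=> Lx; apply: nLA.
    by rewrite -[in LHS](S_of_fix Ss nA) sK.
by apply: eq_esum => t St; rewrite -EFinM (W_comp fL AL).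
Qed.

(** The probability, in the volume [L], that the sites of [A] are fixed. The value 0 when [A] leaves
    [L], where the identity off [L] would suggest otherwise, removes from the sums the cycles that
    leave [L]. *)
Definition r L A : R := if `[< A `<=` L >] then partZ (L `\` A) / partZ L else 0.

Lemma r_in L A : A `<=` L -> r L A = partZ (L `\` A) / partZ L.
Proof. by move=> AL; rewrite /r asboolT. Qed.

Lemma r_out L A : ~ A `<=` L -> r L A = 0.
Proof. by move=> AL; rewrite /r asboolF. Qed.

Lemma r_ge0 L A : finite_set L -> 0 <= r L A.
Proof.
move=> fL; rewrite /r; case: ifP => // _.
by rewrite divr_ge0 ?ltW ?partZ_gt0//; exact: finite_setD.
Qed.

Lemma r_set0 L : finite_set L -> r L set0 = 1.
Proof. by move=> fL; rewrite r_in// setD0 divff// gt_eqF// partZ_gt0. Qed.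

(** Chain rule: once [A] is fixed, what remains is the same model in [L] minus [A]. *)
Lemma r_setU L A B : finite_set L -> A `&` B = set0 -> A `<=` L ->
  r L (A `|` B) = r L A * r (L `\` A) B.
Proof.
move=> fL AB AL; have fLA : finite_set (L `\` A) by exact: finite_setD.
have [BL|nBL] := pselect (B `<=` L).
  rewrite !r_in//; first last.
  - by rewrite subUset.
  - move=> x Bx; split; first exact: BL.
    by move=> Ax; rewrite -[False]/(set0 x) -AB.
  rewrite setDDl [RHS]mulrC -mulrA; congr (_ * _).
  by rewrite mulrA mulVf ?mul1r// gt_eqF// partZ_gt0.
rewrite [X in _ * X]r_out ?mulr0 ?r_out//; first by rewrite subUset => -[].
by move=> BLA; apply: nBL => x /BLA [].
Qed.

Lemma follows_sub L x o s : Cyc x o -> follows o s -> S_of L s -> L x -> [set` o] `<=` L.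
Proof.
move=> [u [t E]] fo Ss Lx; subst o => y /=.
have [-> _] := follows_iter fo u.
by move=> /trajectP [k _ ->]; elim: k => //= k; exact: (S_of_stable Ss).
Qed.

Lemma esum_follows L x o : finite_set L -> L x -> Cyc x o ->
  (\esum_(s in S_of L `&` [set s | cyc s x = o]) (W L s)%:E = (partZ L * (w o * r L [set` o]))%:E)%E.
Proof.
move=> fL Lx Co.
have -> : S_of L `&` [set s | cyc s x = o] = S_of L `&` follows o.
  by apply/seteqP; split=> s [Ss /(cycE (S_of_finite_cycle fL Ss) Co) h].
have [oL|noL] := pselect ([set` o] `<=` L).
  rewrite (esum_agree fL oL); last by apply: next_S_of; case: Co.
  by rewrite r_in// mulrCA [partZ L * _]mulrC mulrVK// unitfE gt_eqF// partZ_gt0.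
rewrite r_out// !mulr0 (_ : _ `&` _ = set0) ?esum_set0//.
by rewrite -subset0 => s [Ss fo]; apply: noL; exact: follows_sub fo Ss Lx.
Qed.

(** Total probability, according to the cycle through [x]. *)
Lemma esum_cyc L x : finite_set L -> L x ->
  (\esum_(o in Cyc x) (w o * r L [set` o])%:E = 1)%E.
Proof.
move=> fL Lx; have Z0 := partZ_gt0 fL.
have w0 := W_ge0; have r0 := r_ge0 _ fL.
have E : ((partZ L)%:E * (\esum_(o in Cyc x) (w o * r L [set` o])%:E) = (partZ L)%:E)%E.
  rewrite -esum_mulr ?ltW//; last first.
    by move=> o; rewrite lee_fin mulr_ge0// w0.
  rewrite -[RHS]partZE// (@esum_fiber _ _ _ _ (Cyc x) (fun s => cyc s x)).
  - by apply: eq_esum => o Co; rewrite esum_follows.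
  - by move=> s Ss; have [] := cycP x (S_of_finite_cycle fL Ss).
  - by move=> s _; rewrite lee_fin.
rewrite -[LHS]mul1e -(@mulVf _ (partZ L)) ?gt_eqF// EFinM -muleA E -EFinM.
by rewrite mulVf ?gt_eqF.
Qed.

Definition avoiding A : set (seq T) := [set o | [set` o] `&` A = set0].

(* [Rf A] stands for the probability that all points of [A] are fixed, in a random
   permutation of the points of [D] with cycle weights [w]. *)
Definition fixpt_system (D : set T) (Rf : set T -> R) : Prop :=
  [/\ Rf set0 = 1, forall A, 0 <= Rf A, forall A, ~ A `<=` D -> Rf A = 0 &
    forall A x, finite_set A -> A `<=` D -> D x -> ~ A x ->
      (\esum_(o in Cyc x `&` avoiding A) (w o * Rf (A `|` [set` o]))%:E = (Rf A)%:E)%E].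

(** The recursion is the total probability 1 in the volume [L] minus [A], multiplied by [r L A];
    cycles that meet [A] contribute 0 there. *)
Lemma r_system L : finite_set L -> fixpt_system L (r L).
Proof.
move=> fL; split; [exact: r_set0|by move=> A; exact: r_ge0|by move=> A; exact: r_out|].
move=> A x fA AL Lx nAx; have fLA : finite_set (L `\` A) by exact: finite_setD.
have r0 := r_ge0 _ fLA.
rewrite -[RHS]mule1 -[in RHS](@esum_cyc (L `\` A) x)// -esum_mulr ?r_ge0//; last first.
  by move=> o; rewrite lee_fin mulr_ge0// W_ge0.
rewrite esum_mkcondr; apply: eq_esum => o Co; case: ifPn => [|].
  rewrite inE => oA; rewrite -EFinM r_setU ?[A `&` _]setIC// mulrCA//.
rewrite notin_setE => oA; rewrite [r (L `\` A) _]r_out ?mulr0 ?mule0// => oLA.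
apply: oA; rewrite /avoiding /= -subset0 => y [/oLA [_ nAy] Ay]; exact: nAy.
Qed.

End Weights.

(** * Contraction for fixed-point probabilities *)

Lemma setm_cons (T1 : choiceType) (x : T1) (l : seq T1) : [set` x :: l] = x |` [set` l].
Proof.
apply/seteqP; split=> z /=; rewrite inE; first by move=> /orP[/eqP ->|zl]; [left|right].
by move=> [->|->]; rewrite ?eqxx ?orbT.
Qed.

Lemma esum_tail (R : realType) (T1 : choiceType) (A : set T1) (a : T1 -> \bar R) (e : R) :
  (forall s, (0 <= a s)%E) -> (\esum_(s in A) a s)%E \is a fin_num -> 0 < e ->
  exists F, [/\ finite_set F, F `<=` A & (\esum_(s in A `\` F) a s <= e%:E)%E].
Proof.
move=> a0 fin e0.
have [_ [F [fF FA] <-] lt] := ub_ereal_sup_adherent e0 fin.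
exists F; split=> //.
move: fin lt; rewrite -/(esum A a) (esumID F)// (_ : A `&` F = F); last first.
  by apply/seteqP; split=> [x []//|x Fx]; split=> //; exact: FA.
rewrite -setDE esum_fset//.
set u := (\sum_(i \in F) a i)%E; set v := (\esum_(s in A `\` F) a s)%E.
have u0 : (0 <= u)%E by rewrite /u fsbig_finite//= sume_ge0.
have v0 : (0 <= v)%E by exact: esum_ge0.
case: u u0 => [u| |]//; case: v v0 => [v| |]//= v0 u0 _.
by rewrite -!EFinD !lte_fin lee_fin => ?; lra.
Qed.

Lemma dist_mul (R : realType) (a a' c c' e h : R) : `|a - a'| <= e -> `|c - c'| <= h ->
  0 <= c -> c <= 1 -> 0 <= a' -> a' <= 1 -> `|a * c - a' * c'| <= e + h.
Proof.
move=> h1 h2 c0 c1 a0 a1.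
have -> : a * c - a' * c' = (a - a') * c + a' * (c - c').
  by rewrite mulrBl mulrBr addrA subrK.
apply: le_trans (ler_normD _ _) _; rewrite !normrM; apply: lerD.
  by apply: le_trans h1; rewrite ler_piMr// ger0_norm.
by apply: le_trans h2; rewrite ler_piMl// ger0_norm.
Qed.

Section Contraction.
Variables (R : realType) (d : nat) (p : site d -> R).
Hypothesis p_ge0 : forall y, 0 <= p y.
Hypothesis p0 : p 0 = 1.
Local Notation T := (site d).
Local Notation w := (cyc_weight p).
Local Notation system := (fixpt_system p).
Implicit Types (A B D : set T) (x y : T) (o l : seq T) (Rf : set T -> R).

Lemma w_ge0 o : 0 <= w o.
Proof. exact: W_ge0. Qed.

Definition tr (u : T) o : seq T := [seq y + u | y <- o].

Lemma trK u : cancel (tr u) (tr (- u)).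
Proof. by move=> o; rewrite /tr -map_comp map_id_in// => y _ /=; rewrite addrK. Qed.

Lemma trNK u : cancel (tr (- u)) (tr u).
Proof. by move=> o; rewrite /tr -map_comp map_id_in// => y _ /=; rewrite subrK. Qed.

Lemma mem_tr u o y : (y \in tr u o) = (y - u \in o).
Proof.
apply/mapP/idP => [[z zo ->]|yo]; first by rewrite addrK.
by exists (y - u) => //; rewrite subrK.
Qed.

Lemma tr_next u o y : uniq o -> next (tr u o) (y + u) = next o y + u.
Proof. by move=> uo; rewrite (@next_map _ _ (fun z => z + u))//; exact: addIr. Qed.

Lemma tr_set u o : [set` tr u o] = (fun y => y + u) @` [set` o].
Proof.
apply/seteqP; split=> [y /=|_ [y /= yo <-]]; last by rewrite /= mem_tr addrK.
by rewrite mem_tr => yo; exists (y - u) => //; rewrite subrK.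
Qed.

Lemma w_tr u o : uniq o -> w (tr u o) = w o.
Proof.
move=> uo; rewrite /cyc_weight /weight tr_set fsbig_image; last by move=> y z _ _; exact: addIr.
by apply: eq_fsbigr => y _; rewrite tr_next// opprD addrACA subrr addr0.
Qed.

Lemma Cyc_tr u x o : Cyc x o -> Cyc (x + u) (tr u o).
Proof.
move=> [uo [t ot]]; subst o; split; last by exists (tr u t).
by rewrite /tr map_inj_uniq//; exact: addIr.
Qed.

Lemma Cyc_bij (P : set nat) x :
  set_bij (Cyc 0 `&` [set o | P (size o)]) (Cyc x `&` [set o | P (size o)]) (tr x).
Proof.
split.
- by move=> o [Co /= so]; split; [have := Cyc_tr x Co; rewrite add0r|rewrite /= size_map].
- by move=> a b _ _; exact: (can_inj (@trK x)).
- move=> o [Co /= so]; exists (tr (- x) o); last exact: trNK.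
  by split; [have := Cyc_tr (- x) Co; rewrite subrr|rewrite /= size_map].
Qed.

Lemma Cyc_uniq x o : Cyc x o -> uniq o.
Proof. by case. Qed.

Definition Cyc2 : set (seq T) := Cyc 0 `&` [set o | (2 <= size o)%N].

Lemma Cyc1 x : Cyc x `&` ~` [set o | (2 <= size o)%N] = [set [:: x]].
Proof.
apply/seteqP; split=> [q [[uq [t ->]] /=]|_ ->]; first by case: t.
by split=> //=; split=> //; exists [::].
Qed.

Lemma w1 x : w [:: x] = 1.
Proof. by apply: W_fixed => // y /= /[!inE] /eqP ->; rewrite /= eqxx. Qed.

Variable b : R.
Hypothesis b_lt1 : b < 1.
Hypothesis Hb : (\esum_(o in Cyc2) ((size o)%:R * w o)%:E <= b%:E)%E.

Lemma Cyc2_size o : Cyc2 o -> 1 <= (size o)%:R :> R.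
Proof. by move=> [_ /= so]; rewrite ler1n; apply: leq_trans so. Qed.

Lemma sum_w_le : (\esum_(o in Cyc2) (w o)%:E <= b%:E)%E.
Proof.
apply: le_trans Hb; apply: le_esum => o /Cyc2_size so.
by rewrite lee_fin ler_peMl// w_ge0.
Qed.

Lemma b_ge0 : 0 <= b.
Proof.
by rewrite -lee_fin; apply: le_trans sum_w_le; apply: esum_ge0 => o _; rewrite lee_fin w_ge0.
Qed.

(** Cycles through [x] are indexed by their translates through the origin, so that the sums at
    different sites run over the same set [Cyc2]. *)
Definition term Rf A x o : R :=
  if `[< avoiding A (tr x o) >] then Rf (A `|` [set` tr x o]) else 0.

Section OneSystem.
Variables (D : set T) (Rf : set T -> R).
Hypothesis SR : system D Rf.

Let Rf_ge0 A : 0 <= Rf A. Proof. by case: SR. Qed.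

Lemma term_ge0 A x o : 0 <= term Rf A x o.
Proof. by rewrite /term; case: ifP. Qed.

(** The recursion with the trivial cycle [[:: x]], of weight 1, set apart. *)
Lemma system_rec A x : finite_set A -> A `<=` D -> D x -> ~ A x ->
  ((Rf A)%:E = (Rf (A `|` [set x]))%:E + \esum_(o in Cyc2) (w o * term Rf A x o)%:E)%E.
Proof.
case: SR => _ _ _ H fA AD Dx nAx.
rewrite -(H A x)// esum_mkcondr (esumID [set o | (2 <= size o)%N]); last first.
  by move=> o _; case: ifP => // _; rewrite lee_fin mulr_ge0// w_ge0.
rewrite Cyc1 esum_set1; last first.
  by case: ifP => // _; rewrite lee_fin mulr_ge0// w_ge0.
rewrite addeC; congr (_ + _)%E.
  rewrite ifT; last first.
    by rewrite inE /avoiding /= -subset0 => y /= [] /[1!inE] /eqP ->.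
  by rewrite w1 mul1r; congr (Rf (_ `|` _))%:E; apply/seteqP; split=> y /=; rewrite inE => /eqP.
rewrite (reindex_esum _ _ _ _ (Cyc_bij (fun n => (2 <= n)%N) x)).
apply: eq_esum => o [Co _]; rewrite /term; case: asboolP => h.
  by rewrite ifT ?inE// w_tr//; case: Co.
by rewrite ifF ?mulr0//; apply/negP; rewrite inE.
Qed.

Lemma system_add1 A x : finite_set A -> A `<=` D -> ~ A x ->
  Rf (A `|` [set x]) <= Rf A.
Proof.
move=> fA AD nAx; have [Dx|nDx] := pselect (D x).
  rewrite -lee_fin (system_rec fA AD Dx nAx) leeDl// esum_ge0// => o _.
  by rewrite lee_fin mulr_ge0 ?w_ge0 ?term_ge0.
by case: (SR) => _ _ -> // h; apply: nDx; apply: h; right.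
Qed.

Lemma system_mono A l : finite_set A -> Rf (A `|` [set` l]) <= Rf A.
Proof.
elim: l A => [|y l IH] A fA; first by rewrite set_nil setU0.
rewrite setm_cons setUA; apply: le_trans (IH _ _) _; first by rewrite finite_setU; split.
have [AD|nAD] := pselect (A `<=` D); last first.
  by case: (SR) => _ _ -> // h; apply: nAD => z Az; apply: h; left.
have [Ay|nAy] := pselect (A y); last exact: system_add1.
by rewrite (_ : _ `|` _ = A)//; apply/setUidPl => _ ->.
Qed.

Lemma term_le A x o : finite_set A -> Cyc2 o -> term Rf A x o <= Rf (A `|` [set x]).
Proof.
move=> fA [[uo [t ->]] _]; rewrite /term; case: ifP => // _.
by rewrite /tr /= add0r setm_cons setUA; apply: system_mono; rewrite finite_setU; split.
Qed.

(** By monotonicity each nontrivial cycle contributes at most its weight times the trivial term, and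
    the weights add up to at most [b]. This keeps [Rf] positive and allows conditioning. *)
Lemma system_lower A x : finite_set A -> A `<=` D -> D x -> ~ A x ->
  Rf A <= (1 + b) * Rf (A `|` [set x]).
Proof.
move=> fA AD Dx nAx; rewrite -lee_fin (system_rec fA AD Dx nAx) mulrDl mul1r EFinD leeD2l//.
rewrite mulrC EFinM; apply: le_trans (_ : \esum_(o in Cyc2) ((Rf (A `|` [set x]))%:E * (w o)%:E) <= _)%E.
  by apply: le_esum => o Co; rewrite lee_fin mulrC ler_wpM2r ?w_ge0 ?term_le.
rewrite esum_mulr//; last by move=> o; rewrite lee_fin w_ge0.
by rewrite lee_wpmul2l ?lee_fin// sum_w_le.
Qed.

Lemma system_gt0 A : finite_set A -> A `<=` D -> 0 < Rf A.
Proof.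
move=> /finite_seqP [l ->]; elim: l => [|y l IH] lD.
  by rewrite set_nil; case: SR => ->.
have e : [set` y :: l] = [set` l] `|` [set y].
  by rewrite setm_cons setUC.
have lD' : [set` l] `<=` D by move=> z zl; apply: lD; rewrite e; left.
rewrite e; have [yl|nyl] := boolP (y \in l).
  rewrite (_ : _ `|` _ = [set` l]); first exact: IH.
  by apply/setUidPl => _ ->.
have := @system_lower [set` l] y (finite_seq _) lD'.
have /[swap] /[apply] : D y by apply: lD; rewrite e; right.
move=> /(_ (negP nyl)) h; have := lt_le_trans (IH lD') h.
by rewrite pmulr_rgt0//; have := b_ge0; lra.
Qed.

End OneSystem.

Definition cprob Rf A l : R := Rf (A `|` [set` l]) / Rf A.
(** The divisor is the term of the trivial cycle. For a cycle that avoids [A] this is the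
    conditional probability that its other sites are fixed, given that [A] and [x] are. *)
Definition qt Rf A x o : R := term Rf A x o / Rf (A `|` [set x]).

Lemma finU1 A x : finite_set A -> finite_set (A `|` [set x]).
Proof. by move=> fA; rewrite finite_setU; split=> //; exact: finite_set1. Qed.

Lemma subU1 A D x : A `<=` D -> D x -> A `|` [set x] `<=` D.
Proof. by move=> AD Dx y [/AD//|->]. Qed.
Hint Resolve finU1 subU1 : core.

Section OneSystem2.
Variables (D : set T) (Rf : set T -> R).
Hypothesis SR : system D Rf.

Let Rf_ge0 A : 0 <= Rf A. Proof. by case: SR. Qed.

Lemma cprob_ge0 A l : 0 <= cprob Rf A l.
Proof. by rewrite divr_ge0. Qed.

Lemma cprob_le1 A l : finite_set A -> A `<=` D -> cprob Rf A l <= 1.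
Proof.
move=> fA AD; rewrite ler_pdivrMr ?mul1r; last exact: (system_gt0 SR).
exact: (system_mono SR).
Qed.

Lemma cprob_nil A : finite_set A -> A `<=` D -> cprob Rf A [::] = 1.
Proof.
move=> fA AD; rewrite /cprob set_nil setU0 divff// gt_eqF//; exact: (system_gt0 SR).
Qed.

Lemma cprob_cons A y l : finite_set A -> A `<=` D -> D y ->
  cprob Rf A (y :: l) = cprob Rf A [:: y] * cprob Rf (A `|` [set y]) l.
Proof.
move=> fA AD Dy; rewrite /cprob setm_cons setUA [[set` [:: y]]]setm_cons set_nil setU0.
have g0 : Rf (A `|` [set y]) != 0 by rewrite gt_eqF//; apply: (system_gt0 SR); auto.
by rewrite [RHS]mulrC [RHS]mulrA divfK.
Qed.

Lemma qt_ge0 A x o : 0 <= qt Rf A x o.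
Proof. by rewrite divr_ge0// (term_ge0 SR). Qed.

Lemma qt_le1 A x o : finite_set A -> A `<=` D -> D x -> Cyc2 o -> qt Rf A x o <= 1.
Proof.
move=> fA AD Dx Co; rewrite ler_pdivrMr ?mul1r; first exact: (term_le SR).
by apply: (system_gt0 SR); auto.
Qed.

Lemma qt_cprob A x t : avoiding A (tr x (0 :: t)) ->
  qt Rf A x (0 :: t) = cprob Rf (A `|` [set x]) (tr x t).
Proof.
by move=> av; rewrite /qt /term asboolT// /cprob /tr /= add0r setm_cons setUA.
Qed.

Definition sumq A x : R := fine (\esum_(o in Cyc2) (w o * qt Rf A x o)%:E)%E.

Lemma sumq_ge0 A x : 0 <= sumq A x.
Proof. by apply: fine_ge0; apply: esum_ge0 => o _; rewrite lee_fin mulr_ge0 ?w_ge0 ?qt_ge0. Qed.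

Lemma sumqE A x : finite_set A -> A `<=` D -> D x ->
  (\esum_(o in Cyc2) (w o * qt Rf A x o)%:E = (sumq A x)%:E)%E.
Proof.
move=> fA AD Dx; rewrite fineK// ge0_fin_numE; last first.
  by apply: esum_ge0 => o _; rewrite lee_fin mulr_ge0 ?w_ge0 ?qt_ge0.
apply: le_lt_trans (ltry b); apply: le_trans sum_w_le; apply: le_esum => o Co.
by rewrite lee_fin ler_piMr ?w_ge0 ?qt_le1.
Qed.

(** The recursion divided by its trivial term. As 1 / (1 + s) is 1-Lipschitz on s >= 0, closeness
    passes from [sumq] to [cprob]. *)
Lemma cprob1E A x : finite_set A -> A `<=` D -> D x -> ~ A x ->
  cprob Rf A [:: x] = (1 + sumq A x)^-1.
Proof.
move=> fA AD Dx nAx; have g0 : 0 < Rf (A `|` [set x]) by apply: (system_gt0 SR); auto.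
have g1 := system_gt0 SR fA AD.
rewrite /cprob setm_cons set_nil setU0; apply: (@mulIf _ (Rf A)); first by rewrite gt_eqF.
rewrite divfK ?gt_eqF//; apply: (@mulfI _ (1 + sumq A x)).
  by rewrite gt_eqF// ltr_wpDr// sumq_ge0.
rewrite mulVKf ?gt_eqF//; last by rewrite ltr_wpDr// sumq_ge0.
apply/EFin_inj; rewrite (system_rec SR fA AD Dx nAx) mulrDl mul1r EFinD EFinM -sumqE// muleC.
rewrite -esum_mulr ?ltW//; last by move=> o; rewrite lee_fin mulr_ge0 ?w_ge0 ?qt_ge0.
congr (_ + _)%E; apply: eq_esum => o Co.
by rewrite -EFinM /qt mulrCA [_ * (_ / _)]mulrC divfK// gt_eqF.
Qed.

End OneSystem2.

Lemma and_not_or (P Q P' Q' E : Prop) : (P /\ ~ Q <-> P' /\ ~ Q') ->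
  (P /\ ~ (Q \/ E)) <-> (P' /\ ~ (Q' \/ E)).
Proof. tauto. Qed.

(** Only the free sites are compared, those of the domain that are not yet fixed, within the
    translate of [B] at [x]: a fixed site and an absent one have the same effect. *)
Definition agree (B : set T) D A D' A' x :=
  forall y, B (y - x) -> (D y /\ ~ A y) <-> (D' y /\ ~ A' y).

Lemma agree_sym B D A D' A' x : agree B D A D' A' x -> agree B D' A' D A x.
Proof. by move=> h y /h; tauto. Qed.

Section TwoSystems.
Variables (D D' : set T) (Rf Rf' : set T -> R).
Hypotheses (SR : system D Rf) (SR' : system D' Rf').

(** Uniform in [A], [A'] and [x], because along a cycle the sites already treated join the fixed
    sets. *)
Definition close B (e : R) := forall A A' x, finite_set A -> A `<=` D -> D x -> ~ A x ->
  finite_set A' -> A' `<=` D' -> D' x -> ~ A' x -> agree B D A D' A' x ->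
  `| cprob Rf A [:: x] - cprob Rf' A' [:: x] | <= e.

(** Chain rule with one conditional probability per site; all factors lie in [0, 1], so the errors
    add up. *)
Lemma close_seq B e l A A' : close B e -> uniq l ->
  finite_set A -> A `<=` D -> (forall x, x \in l -> D x /\ ~ A x) ->
  finite_set A' -> A' `<=` D' -> (forall x, x \in l -> D' x /\ ~ A' x) ->
  (forall x, x \in l -> agree B D A D' A' x) ->
  `| cprob Rf A l - cprob Rf' A' l | <= (size l)%:R * e.
Proof.
move=> cl; elim: l A A' => [|y l IH] A A' /=.
  by move=> _ fA AD _ fA' AD' _ _; rewrite (cprob_nil SR)// (cprob_nil SR')// subrr normr0 mul0r.
move=> /andP[yl ul] fA AD lA fA' AD' lA' ag.
have [Dy nAy] := lA y (mem_head _ _); have [Dy' nAy'] := lA' y (mem_head _ _).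
have mem z : z \in l -> z \in y :: l by move=> zl; rewrite inE zl orbT.
have neq z : z \in l -> z <> y by move=> zl e0; move: yl; rewrite -e0 zl.
rewrite (cprob_cons SR)// (cprob_cons SR')//.
have h1 := cl A A' y fA AD Dy nAy fA' AD' Dy' nAy' (ag y (mem_head _ _)).
have h2 : `| cprob Rf (A `|` [set y]) l - cprob Rf' (A' `|` [set y]) l | <= (size l)%:R * e.
  apply: IH; auto.
  - by move=> z zl; have [? ?] := lA z (mem z zl); split=> // -[|] //=; exact: neq.
  - by move=> z zl; have [? ?] := lA' z (mem z zl); split=> // -[|] //=; exact: neq.
  - by move=> z zl u Bu; apply: and_not_or; exact: (ag z (mem z zl)).
rewrite -natr1 mulrDl mul1r [X in _ <= X]addrC; apply: dist_mul => //.
- exact: (cprob_ge0 SR).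
- by apply: (cprob_le1 SR); auto.
- exact: (cprob_ge0 SR').
- by apply: (cprob_le1 SR'); auto.
Qed.

Lemma qt_close B B' e F A A' x o : close B e -> 0 <= e -> F `<=` Cyc2 -> F o ->
  (forall q y, F q -> y \in q -> B' y) ->
  (forall q y z, F q -> y \in q -> B z -> B' (y + z)) ->
  finite_set A -> A `<=` D -> D x -> ~ A x ->
  finite_set A' -> A' `<=` D' -> D' x -> ~ A' x -> agree B' D A D' A' x ->
  qt Rf A x o <= qt Rf' A' x o + (size o)%:R * e.
Proof.
move=> cl e0 FC Fo B1 B2 fA AD Dx nAx fA' AD' Dx' nAx' ag.
have z0 : 0 <= qt Rf' A' x o + (size o)%:R * e by rewrite addr_ge0 ?(qt_ge0 SR')// mulr_ge0.
have [av|nav] := pselect (avoiding A (tr x o)); last by rewrite /qt /term asboolF// mul0r.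
have [sub|nsub] := pselect ([set` tr x o] `<=` D); last first.
  rewrite /qt /term asboolT//; case: (SR) => _ _ -> //; first by rewrite mul0r.
  by move=> h; apply: nsub => y yo; apply: h; right.
have in1 y : y \in tr x o -> D y /\ ~ A y.
  move=> yo; split; first exact: sub.
  by move=> Ay; rewrite -[False]/(set0 y) -av.
have in2 y : y \in tr x o -> D' y /\ ~ A' y.
  by move=> yo; apply/ag; [apply: (B1 _ _ Fo); rewrite -mem_tr|exact: in1].
have av' : avoiding A' (tr x o).
  by rewrite /avoiding /= -subset0 => y [/in2 [_ nA'] A'y]; exact: nA'.
have [[uo [t E]] _] := FC _ Fo; subst o.
have ut : uniq (tr x (0 :: t)) by rewrite map_inj_uniq//; exact: addIr.
have memt y : y \in tr x t -> y \in tr x (0 :: t).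
  by move=> yt; rewrite /tr /= inE yt orbT.
have neq y : y \in tr x t -> y <> x.
  by move=> yt yx; move: ut; rewrite /tr /= add0r; move: yt; rewrite yx => ->.
rewrite qt_cprob// qt_cprob// -lerBlDl; apply: le_trans (ler_norm _) _.
apply: (@le_trans _ _ ((size (tr x t))%:R * e)); last first.
  by rewrite ler_wpM2r// ler_nat size_map /=.
apply: (close_seq cl); auto.
- by move: ut; rewrite /tr /= => /andP[].
- by move=> y yt; have [? ?] := in1 _ (memt _ yt); split=> // -[|] //=; exact: neq.
- by move=> y yt; have [? ?] := in2 _ (memt _ yt); split=> // -[|] //=; exact: neq.
- move=> y yt z Bz; have := ag z.
  have -> : z - x = (y - x) + (z - y) by rewrite [RHS]addrC addrA subrK.
  by move=> h; apply: and_not_or; apply: h; apply: (B2 _ _ _ Fo) Bz; rewrite -mem_tr; auto.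
Qed.

(** Cycles in [F] cost [e] per site, at most [b * e] altogether by the length factor in [Hb]; the
    others are bounded by their weights, [h] in all. *)
Lemma sumq_close B B' e h F A A' x : close B e -> 0 <= e -> finite_set F -> F `<=` Cyc2 ->
  (\esum_(o in Cyc2 `\` F) (w o)%:E <= h%:E)%E ->
  (forall q y, F q -> y \in q -> B' y) ->
  (forall q y z, F q -> y \in q -> B z -> B' (y + z)) ->
  finite_set A -> A `<=` D -> D x -> ~ A x ->
  finite_set A' -> A' `<=` D' -> D' x -> ~ A' x -> agree B' D A D' A' x ->
  sumq Rf A x <= sumq Rf' A' x + (b * e + h).
Proof.
move=> cl e0 fF FC Fh B1 B2 fA AD Dx nAx fA' AD' Dx' nAx' ag.
rewrite -lee_fin EFinD -(sumqE SR)// -(sumqE SR')//.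
pose g o : \bar R := if o \in ~` F then (w o)%:E else 0%E.
apply: (@le_trans _ _ (\esum_(o in Cyc2) ((w o * qt Rf' A' x o)%:E + (e%:E * ((size o)%:R * w o)%:E + g o)))%E).
  apply: le_esum => o Co; rewrite /g; case: ifPn => oF.
    rewrite -!EFinM -!EFinD lee_fin; apply: (@le_trans _ _ (w o)).
      by rewrite ler_piMr ?w_ge0// (qt_le1 SR).
    have u1 : 0 <= w o * qt Rf' A' x o by rewrite mulr_ge0 ?w_ge0 ?(qt_ge0 SR').
    have u2 : 0 <= e * ((size o)%:R * w o) by rewrite !mulr_ge0 ?w_ge0.
    lra.
  rewrite adde0 -EFinM -EFinD lee_fin.
  have Fo : F o by move: oF; rewrite notin_setE => /contrapT.
  have := qt_close cl e0 FC Fo B1 B2 fA AD Dx nAx fA' AD' Dx' nAx' ag.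
  move=> /(ler_wpM2l (w_ge0 o)); rewrite mulrDr => /le_trans; apply.
  by rewrite lerD2l mulrCA mulrA [_ * e]mulrC mulrA.
have g0 o : (0 <= g o)%E by rewrite /g; case: ifP => // _; rewrite lee_fin w_ge0.
have s0 o : (0 <= ((size o)%:R * w o)%:E)%E by rewrite lee_fin mulr_ge0 ?w_ge0.
rewrite esumD; last 2 first.
- by move=> o _; rewrite lee_fin mulr_ge0 ?w_ge0 ?(qt_ge0 SR').
- by move=> o _; rewrite adde_ge0// mule_ge0.
rewrite leeD2l// esumD//; last by move=> o _; rewrite mule_ge0.
rewrite EFinD leeD//; first by rewrite esum_mulr// mulrC EFinM lee_wpmul2l.
by rewrite /g -esum_mkcondr.
Qed.

End TwoSystems.

(* Expanding the cycle through a site costs a factor [b < 1] per unit of weight, so agreement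
   of the environments on a larger set improves closeness geometrically. *)
Lemma close_step D D' Rf Rf' B B' e h F : system D Rf -> system D' Rf' ->
  close D D' Rf Rf' B e -> close D' D Rf' Rf B e ->
  0 <= e -> finite_set F -> F `<=` Cyc2 ->
  (\esum_(o in Cyc2 `\` F) (w o)%:E <= h%:E)%E ->
  (forall q y, F q -> y \in q -> B' y) ->
  (forall q y z, F q -> y \in q -> B z -> B' (y + z)) ->
  close D D' Rf Rf' B' (b * e + h).
Proof.
move=> SR SR' cl cl' e0 fF FC Fh B1 B2 A A' x fA AD Dx nAx fA' AD' Dx' nAx' ag.
have h1 := sumq_close SR SR' cl e0 fF FC Fh B1 B2 fA AD Dx nAx fA' AD' Dx' nAx' ag.
have h2 := sumq_close SR' SR cl' e0 fF FC Fh B1 B2 fA' AD' Dx' nAx' fA AD Dx nAx (agree_sym ag).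
rewrite (cprob1E SR)// (cprob1E SR')//.
have s0 := sumq_ge0 SR A x; have s0' := sumq_ge0 SR' A' x.
set s := sumq Rf A x in h1 h2 s0 *; set s' := sumq Rf' A' x in h1 h2 s0' *.
have n0 : 1 + s != 0 by rewrite gt_eqF// ltr_wpDr.
have n0' : 1 + s' != 0 by rewrite gt_eqF// ltr_wpDr.
have -> : (1 + s)^-1 - (1 + s')^-1 = (s' - s) * ((1 + s)^-1 * (1 + s')^-1).
  have -> : s' - s = (1 + s') - (1 + s) by lra.
  by rewrite mulrBl mulrCA divff// mulr1 mulrA divff// mul1r.
rewrite normrM; apply: (@le_trans _ _ `|s' - s|); last by rewrite ler_norml; lra.
rewrite ler_piMr// ger0_norm; last by rewrite mulr_ge0// invr_ge0; lra.
by rewrite mulr_ile1 ?invr_ge0 ?invf_le1 ?ltr_wpDr//; lra.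
Qed.

(** The same [B] serves for all pairs of systems; this uniformity makes the finite-volume
    probabilities a Cauchy family. *)
Lemma decay (e : R) : 0 < e -> exists B : set T, finite_set B /\
  forall D D' Rf Rf', system D Rf -> system D' Rf' -> close D D' Rf Rf' B e.
Proof.
move=> e0; have b0 := b_ge0.
(* With this [h], [e / 2] is the fixed point of t -> b t + h, so n steps starting from the error 1 +
   e / 2 leave b ^ n + e / 2. *)
pose h := e * (1 - b) / 2.
have h0 : 0 < h by rewrite /h divr_gt0// mulr_gt0// subr_gt0.
have fin : (\esum_(o in Cyc2) (w o)%:E)%E \is a fin_num.
  rewrite ge0_fin_numE; first exact: le_lt_trans sum_w_le (ltry _).
  by apply: esum_ge0 => o _; rewrite lee_fin w_ge0.
have [F [fF FC Fh]] := esum_tail (fun o => w_ge0 o : (0 <= (w o)%:E)%E) fin h0.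
have fU : finite_set (\bigcup_(q in F) [set` q]).
  by apply: bigcup_finite => // q _; exact: finite_seq.
have step n : exists B : set T, finite_set B /\
    forall D D' Rf Rf', system D Rf -> system D' Rf' -> close D D' Rf Rf' B (b ^+ n + e / 2).
  elim: n => [|n [B [fB IH]]].
    (* No agreement is asked at the start: two probabilities differ by at most 1. *)
    exists set0; split=> // D D' Rf Rf' SR SR' A A' x fA AD Dx nAx fA' AD' Dx' nAx' _.
    rewrite expr0; have := cprob_ge0 SR A [:: x]; have := cprob_ge0 SR' A' [:: x].
    have := cprob_le1 SR [:: x] fA AD; have := cprob_le1 SR' [:: x] fA' AD'.
    by rewrite ler_norml; lra.
  (* The sites of the cycles in [F], with a copy of [B] around each of them. *)
  exists ((\bigcup_(q in F) [set` q]) `|`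
     (fun yz => yz.1 + yz.2) @` ((\bigcup_(q in F) [set` q]) `*` B)).
  split; first by rewrite finite_setU; split=> //; apply: finite_image; exact: finite_setX.
  move=> D D' Rf Rf' SR SR'.
  have := @close_step D D' Rf Rf' B _ (b ^+ n + e / 2) h F SR SR' (IH _ _ _ _ SR SR') (IH _ _ _ _ SR' SR).
  have -> : b ^+ n.+1 + e / 2 = b * (b ^+ n + e / 2) + h.
    by rewrite exprS /h; lra.
  apply=> //; first by rewrite addr_ge0 ?exprn_ge0// divr_ge0// ltW.
    by move=> q y Fq yq; left; exists q.
  by move=> q y z Fq yq Bz; right; exists (y, z) => //; split=> //; exists q.
have [n bn] : exists n, b ^+ n <= e / 2.
  have cv : (b ^+ n @[n --> \oo] --> (0:R))%classic.
    by apply: cvg_expr; rewrite ger0_norm.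
  have e20 : 0 < e / 2 by rewrite divr_gt0.
  move/cvgrPdist_le : cv => /(_ _ e20) [n _ H].
  exists n; have := H n (leqnn n); rewrite sub0r normrN ger0_norm//; exact: exprn_ge0.
have [B [fB H]] := step n; exists B; split=> // D D' Rf Rf' SR SR' A A' x *.
by apply: le_trans (H _ _ _ _ SR SR' A A' x _ _ _ _ _ _ _ _ _) _ => //; lra.
Qed.

End Contraction.

(** * Limits along finite volumes *)

Section Net.
Variable T : choiceType.

Definition fin_net : set_system (set T) :=
  [set P | exists F, finite_set F /\ forall L, finite_set L -> F `<=` L -> P L].

Global Instance fin_net_filter : ProperFilter fin_net.
Proof.
apply: Build_ProperFilter; first by move=> [F [fF /(_ F fF (fun _ => id))]].
split; first by exists set0; split=> //; exact: finite_set0.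
  move=> P Q [F [fF FP]] [G [fG GQ]]; exists (F `|` G); split.
    by rewrite finite_setU.
  by move=> L fL FGL; split; [apply: FP|apply: GQ] => // x Fx; apply: FGL; [left|right].
by move=> P Q PQ [F [fF FP]]; exists F; split=> // L fL FL; apply: PQ; exact: FP.
Qed.

Lemma near_fin_net F : finite_set F -> \forall L \near fin_net, finite_set L /\ F `<=` L.
Proof. by move=> fF; exists F. Qed.

(** For dimension 0, where the whole space is itself a finite volume and must carry the limit
    law. *)
Lemma cvg_fin_setT (V : topologicalType) (f : set T -> V) (l : V) : hausdorff_space V ->
  finite_set [set: T] -> f L @[L --> fin_net] --> l -> f setT = l.
Proof.
move=> hV fT fl; apply: (cvg_unique hV _ fl).
move=> N /nbhs_singleton Nf; exists setT; split=> // L _ TL.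
by have -> : L = setT by apply/seteqP; split.
Qed.

End Net.

Section Limit.
Variables (R : realType) (d : nat) (p : site d -> R).
Hypothesis p_ge0 : forall y, 0 <= p y.
Hypothesis p0 : p 0 = 1.
Local Notation T := (site d).
Local Notation w := (cyc_weight p).
Local Notation system := (fixpt_system p).
Implicit Types (A B D : set T) (x y : T) (o l : seq T) (Rf : set T -> R).
Variable b : R.
Hypothesis b_lt1 : b < 1.
Hypothesis Hb : (\esum_(o in Cyc2 (d:=d)) ((size o)%:R * w o)%:E <= b%:E)%E.

Lemma decay_seq n (e : R) : 0 < e -> exists B : set T, finite_set B /\
  forall D D' Rf Rf' A A' l, system D Rf -> system D' Rf' -> uniq l -> (size l <= n)%N ->
  finite_set A -> A `<=` D -> (forall x, x \in l -> D x /\ ~ A x) ->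
  finite_set A' -> A' `<=` D' -> (forall x, x \in l -> D' x /\ ~ A' x) ->
  (forall x, x \in l -> agree B D A D' A' x) ->
  `| cprob Rf A l - cprob Rf' A' l | <= e.
Proof.
move=> e0; have n0 : 0 < n.+1%:R :> R by rewrite ltr0n.
have [B [fB H]] := decay p_ge0 p0 b_lt1 Hb (divr_gt0 e0 n0).
exists B; split=> // D D' Rf Rf' A A' l SR SR' ul sl fA AD lA fA' AD' lA' ag.
have := close_seq p_ge0 p0 Hb SR SR' (H _ _ _ _ SR SR') ul fA AD lA fA' AD' lA' ag.
move=> /le_trans; apply; rewrite mulrCA ler_piMr ?(ltW e0)//.
by rewrite ler_pdivrMr// mul1r ler_nat; apply: leq_trans sl _.
Qed.

Lemma cprob_set0 D Rf l : system D Rf -> cprob Rf set0 l = Rf [set` l].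
Proof. by move=> [h _ _ _]; rewrite /cprob set0U h divr1. Qed.

(** With nothing fixed in the whole space, the two environments agree everywhere, so the difference
    is below every [e]. *)
Lemma system_unique Rf Rf' A : system setT Rf -> system setT Rf' -> finite_set A ->
  Rf A = Rf' A.
Proof.
move=> SR SR' /finite_seqP [l0 ->]; pose l := undup l0.
have -> : [set` l0] = [set` l] by apply/seteqP; split=> x /=; rewrite mem_undup.
rewrite -(cprob_set0 _ SR) -(cprob_set0 _ SR').
apply/eqP; rewrite -subr_eq0 -normr_le0; apply/ler_addgt0Pl => e e0; rewrite addr0.
have [B [fB H]] := decay_seq (size l) e0.
apply: (H _ _ _ _ _ _ _ SR SR') => //; first exact: undup_uniq.
- by move=> x _; split=> // -[].
- by move=> x _; split=> // -[].
Qed.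

(** All volumes containing [F] have the same free sites near those of [l]. *)
Lemma r_cauchy A : finite_set A -> exists l : R, r p L A @[L --> @fin_net T] --> l.
Proof.
move=> /finite_seqP [l0 ->]; pose l := undup l0.
have -> : [set` l0] = [set` l] by apply/seteqP; split=> x /=; rewrite mem_undup.
exists (lim (r p L [set` l] @[L --> @fin_net T])); apply: cauchy_cvg.
apply: cauchy_exP => e e0.
have [B [fB H]] := decay_seq (size l) (divr_gt0 e0 (ltr0Sn _ 1)).
pose F := [set` l] `|` (fun z => z.1 + z.2) @` ([set` l] `*` B).
have fF : finite_set F.
  rewrite finite_setU; split; first exact: finite_seq.
  by apply: finite_image; apply: finite_setX => //; exact: finite_seq.
exists (r p F [set` l]); exists F; split=> // L fL FL; rewrite /ball /=.
have SF := r_system p_ge0 p0 fF; have SL := r_system p_ge0 p0 fL.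
rewrite -(cprob_set0 _ SF) -(cprob_set0 _ SL).
apply: (@le_lt_trans _ _ (e / 2)); last by rewrite ltr_pdivrMr// ltr_pMr// ltr1n.
apply: (H _ _ _ _ _ _ _ SF SL); rewrite ?undup_uniq//.
- by move=> x xl; split=> //; left.
- by move=> x xl; split=> //; apply: FL; left.
- move=> x xl y By; have Fy : F y.
    by right; exists (x, y - x); [|rewrite /= addrC subrK].
  by split=> _; split=> //; exact: FL.
Qed.

Definition rlim A : R := lim (r p L A @[L --> @fin_net T]).

Lemma r_cvg A : finite_set A -> r p L A @[L --> @fin_net T] --> rlim A.
Proof. by move=> /r_cauchy [l h]; apply: cvgP; exact: h. Qed.

(** Conditioning on [A] is compared with conditioning on nothing: near the translate of [l] the
    environments agree unless it comes close to [A], which excludes finitely many [u]. *)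
Lemma system_mixing Rf (A l : seq T) (e : R) : system setT Rf -> uniq l -> 0 < e ->
  exists B : set T, finite_set B /\ forall u, ~ B u ->
  `| Rf ([set` A] `|` [set` tr u l]) - Rf [set` A] * Rf [set` tr u l] | <= e.
Proof.
move=> SR ul e0; have [B [fB H]] := decay_seq (size l) e0.
exists ((fun z => z.1 - z.2) @` ([set` A] `*` [set` l]) `|`
  (fun z => z.1.1 - z.1.2 - z.2) @` ([set` A] `*` [set` l] `*` B)).
have fA := finite_seq A; have fl := finite_seq l.
split.
  by rewrite finite_setU; split; apply: finite_image; do ?apply: finite_setX.
move=> u nu; have gA : 0 < Rf [set` A] by apply: (system_gt0 p_ge0 p0 Hb SR).
have dis x : x \in tr u l -> ~ [set` A] x.
  move=> xu xA; apply: nu; left; exists (x, x - u); last by rewrite /= opprB addrC subrK.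
  by split=> //=; rewrite -mem_tr.
have := H _ _ _ _ [set` A] set0 (tr u l) SR SR.
rewrite (cprob_set0 _ SR) /cprob size_map map_inj_uniq//; last exact: addIr.
move=> /(_ ul (leqnn _) fA (@subsetT _ _)).
have -> : Rf ([set` A] `|` [set` tr u l]) - Rf [set` A] * Rf [set` tr u l] =
  Rf [set` A] * (Rf ([set` A] `|` [set` tr u l]) / Rf [set` A] - Rf [set` tr u l]).
  by rewrite mulrBr mulrCA divff ?mulr1// gt_eqF.
move=> h; rewrite normrM (ger0_norm (ltW gA)) -[X in _ <= X]mul1r.
apply: ler_pM => //; first exact: ltW.
  by have := system_mono p_ge0 p0 SR A (@finite_set0 T); rewrite set0U; case: (SR) => ->.
apply: h => //.
- by move=> x xl; split=> //; exact: dis.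
- by move=> x _; split=> // -[].
- move=> x xl y By; split=> -[_ _]; split=> // yA.
  apply: nu; right; exists ((y, x - u), y - x); last first.
    by rewrite /= !opprB -addrA subrKA addrC subrK.
  by split=> //; split=> //=; rewrite -mem_tr.
Qed.

End Limit.

(** * Coupling by nested intervals *)

Lemma cvg_sumr (R : realType) (I J : Type) (F : set_system I) (FF : Filter F) (r : seq J)
    (f : J -> I -> R) (l : J -> R) : (forall j, f j i @[i --> F] --> l j) ->
  \sum_(j <- r) f j i @[i --> F] --> \sum_(j <- r) l j.
Proof. by move=> h; apply: cvg_big => //; exact: add_continuous. Qed.

Section Tree.
Variables (R : realType) (g : seq nat -> R).
Implicit Types (c : seq nat) (k : nat).

(** The law of a random infinite word of natural numbers, given by the probabilities of its initial
    words. *)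
Definition tree_law := [/\ g [::] = 1, forall c, 0 <= g c &
  forall c, series (fun k => g (rcons c k)) @ \oo --> g c].

(* The word [c] gets the interval [[lo c, lo c + g c[], tiled in order by the intervals of
   its children; nearby laws on words then give nearby intervals, for one and the same
   uniform random variable. *)
Definition lo c : R := \sum_(i < size c) \sum_(j < nth 0%N c i) g (rcons (take i c) j).

Definition In c (w : R) : Prop := lo c <= w < lo c + g c.

Lemma lo_rcons c k : lo (rcons c k) = lo c + \sum_(j < k) g (rcons c j).
Proof.
rewrite /lo size_rcons big_ord_recr /= nth_rcons ltnn eqxx -cats1 take_size_cat//.
congr (_ + _); apply: eq_bigr => i _.
by rewrite nth_cat ltn_ord takel_cat// ltnW.
Qed.

Hypothesis H : tree_law.

Let g_ge0 c : 0 <= g c. Proof. by case: H. Qed.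

Let S c k : R := \sum_(j < k) g (rcons c j).

Lemma S_incr c k m : (k <= m)%N -> S c k <= S c m.
Proof.
move=> km; rewrite /S -(subnKC km) big_split_ord /= lerDl; exact: sumr_ge0.
Qed.

Lemma S_cvg c : S c k @[k --> \oo] --> g c.
Proof.
case: H => _ _ /(_ c); apply: cvg_trans; apply: near_eq_cvg; near=> n.
by rewrite /series /= /S big_mkord.
Unshelve. all: by end_near. Qed.

Lemma S_le c k : S c k <= g c.
Proof.
have <- := cvg_lim (@Rhausdorff _) (@S_cvg c).
apply: limr_ge; first by apply/cvg_ex; exists (g c); exact: (@S_cvg c).
by near=> n; apply: S_incr; near: n; exact: nbhs_infty_ge.
Unshelve. all: by end_near. Qed.

Lemma In_parent c k w : In (rcons c k) w -> In c w.
Proof.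
rewrite /In lo_rcons -/(S c k) => /andP[h1 h2].
have s0 : 0 <= S c k by exact: sumr_ge0.
have := S_le c k.+1; rewrite /S big_ord_recr /= -/(S c k) => s1.
by apply/andP; split; lra.
Qed.

(** The partial sums of the children tend to [g c], so they pass [w]; the first one to do so gives
    the child. *)
Lemma In_child c w : In c w -> exists k, In (rcons c k) w.
Proof.
move=> /andP[h1 h2].
have ex : exists k, w < lo c + S c k.
  have : \forall k \near \oo, w - lo c < S c k.
    by apply: (cvgr_gt (g c)); [exact: (@S_cvg c)|lra].
  by move=> [k _ /(_ k (leqnn k)) h]; exists k; lra.
case: (ex_minnP ex) => -[|k] wk mink.
  by move: wk; rewrite /S big_ord0; lra.
exists k; rewrite /In lo_rcons -/(S c k); apply/andP; split.
  rewrite leNgt; apply/negP => /mink; by rewrite ltnn.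
by move: wk; rewrite /S big_ord_recr /= addrA.
Qed.

Lemma In_child_uniq c w k k' : In (rcons c k) w -> In (rcons c k') w -> k = k'.
Proof.
wlog kk' : k k' / (k < k')%N.
  move=> h i i'; case: (ltngtP k k') => // lt; first exact: h.
  by apply/esym; exact: h.
rewrite /In !lo_rcons => /andP[_ h1] /andP[h2 _].
have := S_incr c kk'; rewrite {1}/S big_ord_recr /= -/(S c k) -/(S c k') => h3.
by exfalso; rewrite /S in h3; move: h1 h2 h3; set u := \sum_(j < k) _; set v := \sum_(j < k') _; lra.
Qed.

Definition digit_next c w : nat := xget 0%N [set k | In (rcons c k) w].
Definition wd (w : R) (n : nat) : seq nat := iter n (fun c => rcons c (digit_next c w)) [::].
Definition digit (w : R) (i : nat) : nat := digit_next (wd w i) w.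

Lemma size_wd w n : size (wd w n) = n.
Proof. by elim: n => //= n IH; rewrite size_rcons IH. Qed.

Lemma nth_wd w n i : (i < n)%N -> nth 0%N (wd w n) i = digit w i.
Proof.
elim: n => // n IH; rewrite ltnS leq_eqVlt => /orP[/eqP ->|lt].
  by rewrite /= nth_rcons size_wd ltnn eqxx.
by rewrite /= nth_rcons size_wd lt IH.
Qed.

Lemma In_nil w : In [::] w = (0 <= w < 1) :> Prop.
Proof. by rewrite /In /lo big_ord0 add0r; case: H => ->. Qed.

Lemma In_wd w n : 0 <= w < 1 -> In (wd w n) w.
Proof.
move=> w01; elim: n => [|n IH]; first by rewrite In_nil.
rewrite /= /digit_next; case: xgetP => [k -> //|].
by have [k hk] := In_child IH => /(_ k).
Qed.

Lemma InP c w : 0 <= w < 1 -> In c w <-> c = wd w (size c).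
Proof.
move=> w01; split; last by move=> ->; exact: In_wd.
elim/last_ind: c => // c k IH hk; rewrite size_rcons /=.
rewrite -IH; last exact: In_parent hk.
congr rcons; rewrite /digit_next; case: xgetP => [k' _ hk'|/(_ k)//].
exact: In_child_uniq hk hk'.
Qed.

Lemma In_01 c w : In c w -> 0 <= w < 1.
Proof. by elim/last_ind: c => [|c k IH /In_parent/IH//]; rewrite In_nil. Qed.

Lemma In_gt0 c w : In c w -> 0 < g c.
Proof. by move=> /andP[h1 h2]; lra. Qed.

End Tree.

Section TreeLimit.
Variables (R : realType) (I : Type) (F : set_system I) (FF : ProperFilter F).
Variables (g_ : I -> seq nat -> R) (g : seq nat -> R).
Hypothesis cvg_g : forall c, g_ i c @[i --> F] --> g c.

Lemma cvg_lo c : lo (g_ i) c @[i --> F] --> lo g c.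
Proof.
rewrite /lo; apply: cvg_sumr => i; apply: cvg_sumr => j; exact: cvg_g.
Qed.

(** The left endpoint is excluded because the approximating intervals may begin to the right of
    it. *)
Lemma near_In c (w : R) : lo g c < w < lo g c + g c -> \forall i \near F, In (g_ i) c w.
Proof.
move=> /andP[h1 h2].
have lo_lt : \forall i \near F, lo (g_ i) c < w by apply: (cvgr_lt (lo g c)) => //; exact: cvg_lo.
have hi_gt : \forall i \near F, w < lo (g_ i) c + g_ i c.
  by apply: (cvgr_gt (lo g c + g c)) => //; apply: cvgD; [exact: cvg_lo|exact: cvg_g].
near=> i; apply/andP; split; first by apply: ltW; near: i.
by near: i.
Unshelve. all: by end_near. Qed.

(** Mass could move to children of ever larger index along the filter; the bound [h], uniform in
    [i], prevents this. *)
Lemma tree_law_lim (h : nat -> nat -> R) :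
  (forall i, tree_law (g_ i)) ->
  (forall n, h n @ \oo --> (0 : R)) ->
  (forall i c k, g_ i c - \sum_(j < k) g_ i (rcons c j) <= h (size c) k) ->
  tree_law g.
Proof.
move=> Hi h0 hle.
have ge0 c : 0 <= g c.
  have <- := cvg_lim (@Rhausdorff _) (@cvg_g c).
  apply: limr_ge; first by apply/cvg_ex; exists (g c); exact: (@cvg_g c).
  by apply: nearW => i; case: (Hi i).
have cS (c : seq nat) (k : nat) : \sum_(j < k) g_ i (rcons c j) @[i --> F] --> \sum_(j < k) g (rcons c j).
  by apply: cvg_sumr => j; exact: cvg_g.
split=> //.
  apply/esym; apply: (cvg_unique (@Rhausdorff _) _ (@cvg_g [::])).
  by apply: cvg_near_cst; apply: nearW => i; case: (Hi i).
move=> c; apply/cvgrPdist_le => e e0.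
move: (h0 (size c)) => /cvgrPdist_le/(_ e e0); apply: filterS => k.
rewrite sub0r normrN => hk.
have le1 : g c - \sum_(j < k) g (rcons c j) <= h (size c) k.
  have cv : (g_ i c - \sum_(j < k) g_ i (rcons c j)) @[i --> F] -->
      g c - \sum_(j < k) g (rcons c j).
    by apply: cvgB; [exact: cvg_g|exact: cS].
  have <- := cvg_lim (@Rhausdorff _) cv.
  apply: limr_le; first by apply/cvg_ex; eexists; exact: cv.
  by apply: nearW => i; exact: hle.
have le2 : 0 <= g c - \sum_(j < k) g (rcons c j).
  have cv : (g_ i c - \sum_(j < k) g_ i (rcons c j)) @[i --> F] -->
      g c - \sum_(j < k) g (rcons c j).
    by apply: cvgB; [exact: cvg_g|exact: cS].
  have <- := cvg_lim (@Rhausdorff _) cv.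
  apply: limr_ge; first by apply/cvg_ex; eexists; exact: cv.
  by apply: nearW => i /=; rewrite subr_ge0; exact: (S_le (Hi i)).
rewrite /series /= big_mkord ger0_norm//.
by apply: le_trans le1 _; apply: le_trans hk; exact: ler_norm.
Qed.

End TreeLimit.

Section UnitInterval.
Variable R : realType.

(** The uniform law, kept on the whole line to avoid a subtype; what lies off [0, 1[ is null. *)
Definition unitP : set (measurableTypeR R) -> \bar R :=
  mrestr (@lebesgue_measure R) (@measurable_itv R `[0, 1[).

HB.instance Definition _ := Measure.on unitP.

Lemma unitP_setT : unitP setT = 1%E.
Proof.
rewrite /unitP /mrestr setTI.
by rewrite lebesgue_measure_itv /= lte_fin ltr01 oppr0 adde0.
Qed.

HB.instance Definition _ := Measure_isProbability.Build _ _ _ unitP unitP_setT.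

Lemma unitP_out (A : set (measurableTypeR R)) : (forall w : R, A w -> ~ (0 <= w < 1)) ->
  unitP A = 0%E.
Proof.
move=> h; rewrite /unitP /mrestr (_ : A `&` _ = set0) ?measure0//.
by rewrite -subset0 => x [Ax]; rewrite /= in_itv /= => xI; apply: (h x Ax).
Qed.

Lemma unitP_countable (A : set (measurableTypeR R)) : countable A -> unitP A = 0%E.
Proof.
move=> cA; rewrite /unitP /mrestr; apply: countable_lebesgue_measure0.
by apply: sub_countable cA; apply: subset_card_le => x [].
Qed.

Lemma measurable_In (g : seq nat -> R) c :
  measurable ([set w | In g c w] : set (measurableTypeR R)).
Proof.
rewrite (_ : [set w | _] = [set` `[lo g c, lo g c + g c[]); first exact: measurable_itv.
by apply/seteqP; split=> w; rewrite /= in_itv.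
Qed.

Lemma unitP_In (g : seq nat -> R) c : tree_law g ->
  unitP [set w | In g c w] = (g c)%:E.
Proof.
move=> H; rewrite /unitP /mrestr.
rewrite (_ : _ `&` _ = [set` `[lo g c, lo g c + g c[]); last first.
  apply/seteqP; split=> w; rewrite /= !in_itv /=; first by case.
  by move=> h; split=> //; exact: (In_01 H h).
rewrite lebesgue_measure_itv /= lte_fin ltrDl.
case: ifPn => [_|]; first by rewrite -EFinB addrC addKr.
by case: H => _ /(_ c) h _; rewrite -leNgt => h'; congr (_%:E); apply/le_anti/andP; split.
Qed.

End UnitInterval.

Lemma esum_subset (R : realType) (T1 : choiceType) (A B : set T1) (a : T1 -> \bar R) :
  A `<=` B -> (forall i, (0 <= a i)%E) -> (\esum_(i in A) a i <= \esum_(i in B) a i)%E.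
Proof.
move=> AB a0; rewrite (_ : A = B `&` A); last by apply/esym/setIidPr.
by rewrite esum_mkcondr; apply: le_esum => i _; case: ifP.
Qed.

(** * Stable sets and cylinders *)

Section Restr.
Variable d : nat.
Local Notation T := (site d).
Implicit Types (A : set T) (s : pfun d) (x y : T).

Definition inv_on A s := forall x, A x -> A (s x).

Definition restr A s : pfun d := fun x => if `[< A x >] then s x else x.

Lemma restr_in A s x : A x -> restr A s x = s x.
Proof. by move=> Ax; rewrite /restr asboolT. Qed.

Lemma restr_out A s x : ~ A x -> restr A s x = x.
Proof. by move=> Ax; rewrite /restr asboolF. Qed.

(** The forward orbit of [s x] comes back to [x], so forward stability implies backward
    stability. *)
Lemma inv_on_inv A s x : finite_cycle s -> inv_on A s -> A (s x) -> A x.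
Proof.
move=> [_ fc] inv; have [[|n] [//= _ nx]] := fc x.
by rewrite -[in X in _ -> X]nx -iterS iterSr => As; elim: n {nx} => //= n; exact: inv.
Qed.

Lemma restr_S_of A s : finite_cycle s -> inv_on A s -> S_of A (restr A s).
Proof.
move=> fc inv; split; last by move=> x; exact: restr_out.
have [[t sK tK] _] := fc.
have tinv : inv_on A t.
  by move=> x Ax; apply: (inv_on_inv fc inv); rewrite tK.
exists (restr A t) => x; have [Ax|nAx] := pselect (A x).
- by rewrite (restr_in s Ax) restr_in ?sK//; exact: inv.
- by rewrite !restr_out// restr_out.
- by rewrite (restr_in t Ax) restr_in ?tK//; exact: tinv.
- by rewrite !restr_out// restr_out.
Qed.

Definition Cy A s : set (pfun d) := [set t | forall x, A x -> t x = s x].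

Lemma Cy_restr A s : Cy A (restr A s) = Cy A s.
Proof. by apply/seteqP; split=> t h x Ax; rewrite h// restr_in. Qed.

End Restr.

Section SeriesEFin.
Variable R : realType.

Lemma nneseries_series (u : nat -> R) (l : R) : (forall k, 0 <= u k) ->
  (\sum_(k <oo) (u k)%:E = l%:E)%E -> series u @ \oo --> l.
Proof.
move=> u0 ul; have cv : cvgn (fun n => (\sum_(0 <= k < n) (u k)%:E)%E).
  by apply: is_cvg_nneseries => n _ _; rewrite lee_fin.
have : (\sum_(0 <= k < n) (u k)%:E)%E @[n --> \oo] --> l%:E by rewrite -ul.
move/fine_cvg; apply: cvg_trans; apply: near_eq_cvg; near=> n.
by rewrite /= sumEFin.
Unshelve. all: by end_near. Qed.

End SeriesEFin.

(** * Random words of cycles *)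

Section Words.
Variables (R : realType) (d : nat) (p : site d -> R).
Hypothesis p_ge0 : forall y, 0 <= p y.
Hypothesis p0 : p 0 = 1.
Local Notation T := (site d).
Local Notation w := (cyc_weight p).
Local Notation W := (weight p).
Local Notation partZ := (partZ p).
Local Notation r := (r p).
Local Notation system := (fixpt_system p).
Implicit Types (A B D L : set T) (x y : T) (o l : seq T) (s : pfun d) (c : seq nat).
Variable b : R.
Hypothesis b_lt1 : b < 1.
Hypothesis Hb : (\esum_(o in Cyc2 (d:=d)) ((size o)%:R * w o)%:E <= b%:E)%E.

Lemma esum_Cy L A s : finite_set L -> A `<=` L -> finite_cycle s -> inv_on A s ->
  (\esum_(t in S_of L `&` Cy A s) (W L t)%:E = (W A s * partZ (L `\` A))%:E)%E.
Proof.
move=> fL AL fc inv; rewrite -Cy_restr.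
rewrite (esum_agree p_ge0 fL AL (restr_S_of fc inv)).
by congr ((_ * _)%:E); apply: eq_W => x Ax; rewrite restr_in.
Qed.

Lemma partZ_ge0 L : finite_set L -> 0 <= partZ L.
Proof. by move=> /(partZ_gt0 p_ge0 p0)/ltW. Qed.

Lemma r_le1 L A : finite_set L -> finite_set A -> r L A <= 1.
Proof.
move=> fL /finite_seqP [l ->]; have SL := r_system p_ge0 p0 fL.
by have := system_mono p_ge0 p0 SL l (finite_set0 T); rewrite set0U; case: (SL) => ->.
Qed.

(** A bound by the weight alone, uniform in the volume. For [x] outside [L] the only cycle is
    [[:: x]], of weight 1. *)
Lemma esum_cyc_le L x o : finite_set L -> Cyc x o ->
  (\esum_(s in S_of L `&` [set s | cyc s x = o]) (W L s)%:E <= (partZ L * w o)%:E)%E.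
Proof.
move=> fL Co; have [Lx|nLx] := pselect (L x).
  rewrite esum_follows// lee_fin ler_wpM2l ?partZ_ge0//.
  by rewrite ler_piMr ?W_ge0// r_le1//; exact: finite_seq.
have [->|nox] := eqVneq o [:: x].
  rewrite w1// mulr1 -partZE//; apply: esum_subset => [s []//|s].
  by rewrite lee_fin W_ge0.
rewrite (_ : _ `&` _ = set0) ?esum_set0 ?lee_fin ?mulr_ge0 ?W_ge0 ?partZ_ge0//.
rewrite -subset0 => s [Ss /= cs]; move/eqP: nox; apply; rewrite -cs.
apply/(cycE (S_of_finite_cycle fL Ss)); first by split=> //; exists [::].
by move=> y; rewrite inE => /eqP ->; rewrite /= eqxx (S_of_fix Ss).
Qed.

(** Numbers that code no site are sent to 0, so a site may be read several times. *)
Definition xs (i : nat) : T := odflt 0 (unpickle i).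

Lemma xsK x : xs (pickle x) = x.
Proof. by rewrite /xs pickleK. Qed.

(** Letter i codes the entire cycle through [xs i], listed from [xs i]; a finite word therefore
    prescribes a permutation on a finite stable set. *)
Definition word c : set (pfun d) :=
  [set s | finite_cycle s /\ forall i, (i < size c)%N -> pickle (cyc s (xs i)) = nth 0%N c i].

Lemma word_rcons c k : word (rcons c k) = word c `&` [set s | pickle (cyc s (xs (size c))) = k].
Proof.
apply/seteqP; split=> [s [fs h]|s [[fs h] /= hk]].
  rewrite size_rcons in h.
  split; last by rewrite /= h// nth_rcons ltnn eqxx.
  by split=> // i lt; rewrite h ?ltnS ?(ltnW lt)// nth_rcons lt.
split=> // i; rewrite size_rcons ltnS leq_eqVlt => /orP[/eqP ->|lt].
  by rewrite nth_rcons ltnn eqxx.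
by rewrite nth_rcons lt h.
Qed.

Definition word_prob L c : R := fine (\esum_(s in S_of L `&` word c) (W L s)%:E)%E / partZ L.

Lemma gLE L c : finite_set L ->
  (\esum_(s in S_of L `&` word c) (W L s)%:E = (partZ L * word_prob L c)%:E)%E.
Proof.
move=> fL; rewrite /word_prob mulrCA divff ?mulr1 ?gt_eqF ?partZ_gt0// fineK// esum_W_fin//.
Qed.

Let W0 L s : (0 <= (W L s)%:E)%E. Proof. by rewrite lee_fin W_ge0. Qed.

Lemma gL_ge0 L c : finite_set L -> 0 <= word_prob L c.
Proof.
move=> fL; rewrite divr_ge0 ?partZ_ge0//; apply: fine_ge0; apply: esum_ge0 => s _; exact: W0.
Qed.

Lemma gL_rcons L c : finite_set L ->
  (\sum_(k <oo) (word_prob L (rcons c k))%:E = (word_prob L c)%:E)%E.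
Proof.
move=> fL; have Z0 := partZ_gt0 p_ge0 p0 fL.
have g0 k : (0 <= (word_prob L (rcons c k))%:E)%E by rewrite lee_fin gL_ge0.
rewrite nneseries_esumT//.
have E : ((partZ L)%:E * (\esum_(k in [set: nat]) (word_prob L (rcons c k))%:E) = (partZ L)%:E * (word_prob L c)%:E)%E.
  rewrite -esum_mulr ?partZ_ge0// -[RHS]EFinM -gLE//.
  rewrite (@esum_fiber _ _ _ _ setT (fun s => pickle (cyc s (xs (size c))))) //.
  by apply: eq_esum => k _; rewrite -EFinM -gLE// word_rcons setIA.
rewrite -[LHS]mul1e -[RHS]mul1e -(@mulVf _ (partZ L)) ?gt_eqF// EFinM -!muleA.
by rewrite E.
Qed.

Lemma gL_nil L : finite_set L -> word_prob L [::] = 1.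
Proof.
move=> fL; rewrite /word_prob (_ : _ `&` _ = S_of L) ?partZE//= ?divff ?gt_eqF ?partZ_gt0//.
by apply/seteqP; split=> [s []//|s Ss]; split=> //; split=> //; exact: S_of_finite_cycle Ss.
Qed.

Lemma gL_tree L : finite_set L -> tree_law (word_prob L).
Proof.
move=> fL; split; [exact: gL_nil|by move=> c; exact: gL_ge0|].
by move=> c; apply: nneseries_series; [by move=> k; exact: gL_ge0|exact: gL_rcons].
Qed.

(** The weight of the cycles coded by [k] or more: the uniform bound for the escape of mass at
    letter [n]. *)
Definition wtail (n k : nat) : R :=
  fine (\esum_(o in Cyc (xs n) `&` [set o | (k <= pickle o)%N]) (w o)%:E)%E.

Let w0 o : (0 <= (w o)%:E)%E. Proof. by rewrite lee_fin W_ge0. Qed.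

Lemma sum_Cyc x : (\esum_(o in Cyc x) (w o)%:E <= (1 + b)%:E)%E.
Proof.
rewrite (esumID [set o | (2 <= size o)%N])// addeC Cyc1 esum_set1// w1// EFinD leeD2l//.
rewrite (reindex_esum _ _ _ _ (Cyc_bij (fun n => (2 <= n)%N) x)).
apply: le_trans (sum_w_le p_ge0 Hb); apply: le_esum => o [[uo _] _].
by rewrite w_tr.
Qed.

Lemma esum_w_fin_num x P : (\esum_(o in Cyc x `&` P) (w o)%:E)%E \is a fin_num.
Proof.
rewrite ge0_fin_numE; last by apply: esum_ge0.
apply: le_lt_trans (ltry (1 + b)); apply: le_trans (sum_Cyc x).
by rewrite esum_mkcondr; apply: le_esum => o _; case: ifP.
Qed.

Lemma wtailE n k :
  (\esum_(o in Cyc (xs n) `&` [set o | (k <= pickle o)%N]) (w o)%:E = (wtail n k)%:E)%E.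
Proof. by rewrite fineK// esum_w_fin_num. Qed.

Lemma wtail_cvg n : wtail n @ \oo --> (0 : R).
Proof.
apply/cvgrPdist_le => e e0.
have fin : (\esum_(o in Cyc (xs n)) (w o)%:E)%E \is a fin_num.
  by rewrite -[Cyc _]setIT esum_w_fin_num.
have [F [fF FC Fe]] := esum_tail w0 fin e0.
have [K HK] : exists K, forall o, F o -> (pickle o < K)%N.
  have /finite_seqP [l ->] := fF; exists (\max_(o <- l) pickle o).+1 => o /= ol.
  by rewrite ltnS; apply: leq_bigmax_seq.
exists K => // k /= Kk; rewrite sub0r normrN ger0_norm; last first.
  by apply: fine_ge0; apply: esum_ge0.
rewrite -lee_fin -wtailE; apply: le_trans Fe; apply: esum_subset => // o [Co /= ko].
split=> // Fo; have := HK _ Fo.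
by move=> /leq_trans/(_ Kk); rewrite ltnNge ko.
Qed.

(** What the first [k] children miss is the event that the next cycle has a code of at least [k],
    and each such cycle has probability at most its weight. *)
Lemma gL_tail L c k : finite_set L ->
  word_prob L c - \sum_(j < k) word_prob L (rcons c j) <= wtail (size c) k.
Proof.
move=> fL; have Z0 := partZ_gt0 p_ge0 p0 fL; rewrite lerBlDr -(ler_pM2l Z0) mulrDr.
rewrite -lee_fin EFinD -gLE// EFinM -wtailE mulr_sumr -sumEFin.
set x := xs (size c).
under eq_bigr do rewrite -gLE// word_rcons setIA.
rewrite (esumID [set s | (k <= pickle (cyc s x))%N])//; apply: leeD.
  rewrite -esum_mulr ?partZ_ge0//.
  apply: (@le_trans _ _ (\esum_(s in S_of L `&` [set s | (k <= pickle (cyc s x))%N]) (W L s)%:E)%E).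
    by apply: esum_subset => // s [[]].
  rewrite (@esum_fiber _ _ _ _ (Cyc x `&` [set o | (k <= pickle o)%N]) (fun s => cyc s x)) //.
    apply: le_esum => o [Co _]; rewrite -EFinM; apply: le_trans (esum_cyc_le fL Co).
    by apply: esum_subset => // s [[]].
  by move=> s [Ss ks]; split=> //; have [] := cycP x (S_of_finite_cycle fL Ss).
rewrite (@esum_fiber _ _ _ _ `I_k (fun s => pickle (cyc s x))) //; last first.
  by move=> s [_ /= /negP]; rewrite -ltnNge.
rewrite esum_fset//; last by move=> i _; exact: esum_ge0.
rewrite -(@fsbig_ord _ _ _ _ (fun i => \esum_(s in _ `&` [set s | pickle (cyc s x) = i]) (W L s)%:E)%E).
apply: lee_sum => i _; apply: esum_subset => // s [[[Ss ws] _] si].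
by split.
Qed.

Lemma cyc_inj_word c s s' i : word c s -> word c s' -> (i < size c)%N ->
  cyc s (xs i) = cyc s' (xs i).
Proof.
by move=> [_ h] [_ h'] ic; apply: (pcan_inj pickleK); rewrite h// h'.
Qed.

Definition word_dom c s : set T := \bigcup_(i in `I_(size c)) [set` cyc s (xs i)].

Lemma word_dom_finite c s : finite_set (word_dom c s).
Proof. by apply: bigcup_finite => // i _; exact: finite_seq. Qed.

Lemma word_dom_inv_on c s : finite_cycle s -> inv_on (word_dom c s) s.
Proof.
move=> fs x [i ic xi]; exists i => //; have [_ fo] := cycP (xs i) fs.
exact: follows_mem fo xi.
Qed.

(** Turns events about words into cylinders over stable sets, whose probabilities are given by
    [r]. *)
Lemma word_Cy c s t : finite_cycle t -> word c s -> word c t <-> Cy (word_dom c s) s t.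
Proof.
move=> ft ws; have [fs hs] := ws; split=> [wt x [i /= ic xi]|h].
  have [_ fo] := cycP (xs i) fs; have [_ fo'] := cycP (xs i) ft.
  by rewrite fo// fo' -(cyc_inj_word ws wt ic).
split=> // i ic; rewrite -hs//; congr pickle.
have [Co fo] := cycP (xs i) fs.
by apply/(cycE ft Co) => y yo; rewrite -fo// h//; exists i.
Qed.

Lemma word_S_of L c s : finite_set L -> word c s ->
  S_of L `&` word c = S_of L `&` Cy (word_dom c s) s.
Proof.
move=> fL ws; apply/seteqP; split=> t [St wt]; split=> //;
  exact/(word_Cy (S_of_finite_cycle fL St) ws).
Qed.

Lemma gL_word L c s : finite_set L -> word c s -> word_dom c s `<=` L ->
  word_prob L c = W (word_dom c s) s * r L (word_dom c s).
Proof.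
move=> fL ws dL; have [fs _] := ws.
rewrite /word_prob (word_S_of fL ws) (esum_Cy fL dL fs (word_dom_inv_on fs))/=.
by rewrite r_in// mulrA.
Qed.

Definition word_lim c : R := lim (word_prob L c @[L --> @fin_net T]).

Lemma gL_cvg c : word_prob L c @[L --> @fin_net T] --> word_lim c.
Proof.
suff [l h] : exists l : R, word_prob L c @[L --> @fin_net T] --> l by apply: cvgP; exact: h.
have [[s ws]|no] := pselect (exists s, word c s).
  exists (W (word_dom c s) s * rlim p (word_dom c s)).
  have := r_cvg p_ge0 p0 b_lt1 Hb (word_dom_finite c s).
  move=> /(cvgMr (a := W (word_dom c s) s)).
  apply: cvg_trans; apply: near_eq_cvg.
  have := near_fin_net (word_dom_finite c s); apply: filterS => L [fL dL].
  by rewrite (gL_word fL ws dL).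
exists 0; apply: cvg_near_cst; apply: nearW => L.
rewrite /word_prob (_ : _ `&` _ = set0) ?esum_set0 ?mul0r//.
by rewrite -subset0 => s [_ ws]; apply: no; exists s.
Qed.

(** Every infinite [L] gets the limit law; among them only [setT] is of interest. *)
Definition word_law L : seq nat -> R := if `[< finite_set L >] then word_prob L else word_lim.

Lemma word_law_fin L : finite_set L -> word_law L = word_prob L.
Proof. by move=> fL; rewrite /word_law asboolT. Qed.

Lemma word_law_setT c : word_law setT c = word_lim c.
Proof.
rewrite /word_law; case: asboolP => // fT.
by apply: (@cvg_fin_setT _ _ (fun L => word_prob L c) _ (@Rhausdorff _) fT); exact: (@gL_cvg c).
Qed.

Lemma word_law_cvg c : word_law L c @[L --> @fin_net T] --> word_lim c.
Proof.
apply: cvg_trans (@gL_cvg c); apply: near_eq_cvg.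
by have := near_fin_net (finite_set0 T); apply: filterS => L [fL _]; rewrite word_law_fin.
Qed.

Lemma word_lim_tree : tree_law word_lim.
Proof.
(* [tree_law_lim] asks for a tree law at every index, so infinite sets receive the law of the empty
   volume. *)
pose g' L := if `[< finite_set L >] then word_prob L else word_prob set0.
have g'E L : exists2 L', finite_set L' & g' L = word_prob L'.
  rewrite /g'; case: asboolP => fL; [by exists L|by exists set0; [exact: finite_set0|]].
apply: (@tree_law_lim _ _ (@fin_net T) _ g' word_lim _ wtail) => //.
- move=> c; apply: cvg_trans (@gL_cvg c); apply: near_eq_cvg.
  by have := near_fin_net (finite_set0 T); apply: filterS => L [fL _]; rewrite /g' asboolT.
- by move=> L; have [L' fL' ->] := g'E L; exact: gL_tree.
- exact: wtail_cvg.
- by move=> L c k; have [L' fL' ->] := g'E L; exact: gL_tail.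
Qed.

Lemma word_law_tree L : tree_law (word_law L).
Proof. by rewrite /word_law; case: asboolP => [/gL_tree//|_]; exact: word_lim_tree. Qed.

End Words.

(** * From words back to permutations *)

Section Decode.
Variable d : nat.
Local Notation T := (site d).
Implicit Types (L : set T) (x y : T) (s : pfun d) (X : nat -> nat).

Definition dec X : pfun d :=
  fun x => next (odflt [::] (unpickle (X (pickle x)) : option (seq T))) x.

Lemma inj_surj_bijective s : injective s -> (forall y, exists x, s x = y) -> bijective s.
Proof.
move=> injs surj; pose t y := xget 0 [set x | s x = y].
have tK y : s (t y) = y by rewrite /t; case: xgetP => [//|h]; have [x /h] := surj y.
by exists t => // x; apply: injs; rewrite tK.
Qed.

(** The permutation may change with [n]; each property that involves finitely many letters still
    passes to [dec X]. *)
Definition coherent L X :=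
  forall n, exists s, S_of L s /\ word (mkseq X n) s.

Lemma coherent_seq L X (l : seq nat) : coherent L X -> exists s,
  [/\ S_of L s, finite_cycle s & forall i, i \in l -> X i = pickle (cyc s (xs d i))].
Proof.
move=> /(_ (\max_(i <- l) i).+1) [s [Ss [fs h]]]; exists s; split=> // i il.
have lt : (i < (\max_(i <- l) i).+1)%N by rewrite ltnS; apply: leq_bigmax_seq.
by rewrite h ?size_mkseq// nth_mkseq.
Qed.

Lemma dec_agree X s x : X (pickle x) = pickle (cyc s x) -> finite_cycle s -> dec X x = s x.
Proof.
move=> e fs; have [Co fo] := cycP x fs.
by rewrite /dec e pickleK /= fo//; exact: Cyc_head Co.
Qed.

(** The cycle coded at [x] is also the one coded at its other sites, since one permutation reads all
    their letters at once. *)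
Lemma dec_cyc L X x : coherent L X -> exists o,
  [/\ Cyc x o, follows o (dec X) & X (pickle x) = pickle o].
Proof.
move=> cX; have [s0 [_ fs0 /(_ (pickle x)) h0]] := coherent_seq [:: pickle x] cX.
have {}h0 : X (pickle x) = pickle (cyc s0 x) by rewrite h0 ?mem_head// xsK.
have [Co fo] := cycP x fs0; exists (cyc s0 x); split=> //.
have [s [_ fs h]] := coherent_seq [seq pickle y | y <- cyc s0 x] cX.
have {}h y : y \in cyc s0 x -> X (pickle y) = pickle (cyc s y).
  by move=> yo; rewrite h ?xsK//; apply: map_f.
have e : cyc s x = cyc s0 x.
  by apply: (pcan_inj pickleK); rewrite -h// ?h0//; exact: Cyc_head Co.
have [_ fo'] := cycP x fs; rewrite e in fo'.
by move=> y yo; rewrite (dec_agree (h y yo) fs) fo'.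
Qed.

Lemma dec_finite_cycle L X : coherent L X -> finite_cycle (dec X).
Proof.
move=> cX; split.
  apply: inj_surj_bijective => [x y|y].
    have [s [_ fs h]] := coherent_seq [:: pickle x; pickle y] cX.
    rewrite (dec_agree _ fs); last by rewrite h ?xsK// !inE eqxx.
    rewrite (dec_agree _ fs); last by rewrite h ?xsK// !inE eqxx orbT.
    by apply: bij_inj; case: fs.
  have [q [Co fo _]] := dec_cyc y cX; exists (prev q y).
  by rewrite fo ?mem_prev ?(Cyc_head Co)// next_prev//; case: Co.
move=> x; have [q [[uq [t E]] fo _]] := dec_cyc x cX; subst q.
by exists (size t).+1; split=> //; have [] := follows_iter fo uq.
Qed.

Lemma dec_S_of L X : coherent L X -> S_of L (dec X).
Proof.
move=> cX; split; first by case: (dec_finite_cycle cX).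
move=> x nLx; have [s [Ss fs h]] := coherent_seq [:: pickle x] cX.
by rewrite (dec_agree _ fs) ?(S_of_fix Ss)// h ?xsK// inE.
Qed.

Lemma dec_word L X i : coherent L X -> pickle (cyc (dec X) (xs d i)) = X i.
Proof.
move=> cX; have fX := dec_finite_cycle cX.
(* The number [i] may differ from the code of the site [xs d i], so both letters are read. *)
have [s [_ fs h]] := coherent_seq [:: i; pickle (xs d i)] cX.
have -> : X i = X (pickle (xs d i)).
  have h1 := h _ (mem_head _ _).
  have m2 : pickle (xs d i) \in [:: i; pickle (xs d i)] by rewrite !inE eqxx orbT.
  have h2 := h _ m2.
  by rewrite h1 h2 xsK.
have [q [Co fo ->]] := dec_cyc (xs d i) cX.
by congr pickle; apply/(cycE fX Co).
Qed.

Lemma word_agree (c : seq nat) s s' x : word c s -> word c s' -> (pickle x < size c)%N ->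
  s x = s' x.
Proof.
move=> [fs h] [fs' h'] xc.
have e : cyc s x = cyc s' x.
  apply: (pcan_inj pickleK); have h1 := h _ xc; have h2 := h' _ xc.
  by rewrite xsK in h1; rewrite xsK in h2; rewrite h1 h2.
have [Co fo] := cycP x fs; have [Co' fo'] := cycP x fs'.
rewrite fo; last exact: Cyc_head Co.
by rewrite fo' ?e//; exact: Cyc_head Co'.
Qed.

End Decode.

(** * The coupled random permutations *)

Section Coupling.
Variables (R : realType) (d : nat) (p : site d -> R).
Hypothesis p_ge0 : forall y, 0 <= p y.
Hypothesis p0 : p 0 = 1.
Local Notation T := (site d).
Local Notation w := (cyc_weight p).
Local Notation W := (weight p).
Local Notation partZ := (partZ p).
Local Notation r := (r p).
Local Notation word_law := (word_law p).
Implicit Types (A B D L : set T) (x y : T) (o l : seq T) (s : pfun d) (c : seq nat).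
Variable b : R.
Hypothesis b_lt1 : b < 1.
Hypothesis Hb : (\esum_(o in Cyc2 (d:=d)) ((size o)%:R * w o)%:E <= b%:E)%E.

Let word_law_tree L : tree_law (word_law L) := word_law_tree p_ge0 p0 b_lt1 Hb L.

Definition good L := finite_set L \/ L = setT.

(** A word that no permutation of [L] reads has probability 0 in every finite volume inside [L],
    hence also in the limit. *)
Lemma word_law_gt0_word L c : good L -> 0 < word_law L c -> exists s, S_of L s /\ word c s.
Proof.
move=> gL c0; apply: contrapT => no; move: c0; suff -> : word_law L c = 0 by rewrite ltxx.
have e0 L' : L' `<=` L -> word_prob p L' c = 0.
  move=> LL'; rewrite /word_prob (_ : _ `&` _ = set0) ?esum_set0 ?mul0r//.
  by rewrite -subset0 => s [Ss ws]; apply: no; exists s; split=> //; exact: S_of_sub Ss.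
case: gL => [fL|LT]; first by rewrite word_law_fin// e0.
rewrite LT.
rewrite (word_law_setT p_ge0 p0 b_lt1 Hb); apply: (cvg_unique (@Rhausdorff _) (@gL_cvg _ _ _ p_ge0 p0 _ b_lt1 Hb c)).
by apply: cvg_near_cst; apply: nearW => L'; apply: e0; rewrite LT.
Qed.

(** The default value [id] belongs to [S_of L] for every [L]. *)
Definition zeta L (u : R) : pfun d :=
  if `[< good L /\ 0 <= u < 1 >] then dec (digit (word_law L) u) else id.

Lemma zetaE L u : good L -> 0 <= u < 1 -> zeta L u = dec (digit (word_law L) u).
Proof. by move=> gL u01; rewrite /zeta asboolT. Qed.

Lemma wd_mkseq (g : seq nat -> R) u n : wd g u n = mkseq (digit g u) n.
Proof.
apply: (@eq_from_nth _ 0%N); rewrite ?size_mkseq size_wd// => i lt.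
by rewrite nth_mkseq// nth_wd.
Qed.

Lemma zeta_coherent L u : good L -> 0 <= u < 1 -> coherent L (digit (word_law L) u).
Proof.
move=> gL u01 n; rewrite -wd_mkseq; apply: word_law_gt0_word => //.
exact: In_gt0 (In_wd (word_law_tree L) n u01).
Qed.

Lemma zeta_S_of L u : S_of L (zeta L u).
Proof.
rewrite /zeta; case: asboolP => [[gL u01]|_]; last exact: S_of_id.
exact: dec_S_of (zeta_coherent gL u01).
Qed.

Lemma zeta_finite_cycle L u : finite_cycle (zeta L u).
Proof.
rewrite /zeta; case: asboolP => [[gL u01]|_].
  exact: dec_finite_cycle (zeta_coherent gL u01).
exact: S_of_finite_cycle (finite_set0 _) (S_of_id set0).
Qed.

Lemma zeta_word L c u : good L -> 0 <= u < 1 -> word c (zeta L u) <-> In (word_law L) c u.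
Proof.
move=> gL u01; have cX := zeta_coherent gL u01.
rewrite (InP (word_law_tree L) c u01) zetaE// wd_mkseq; split.
  move=> [_ h]; apply: (@eq_from_nth _ 0%N); rewrite ?size_mkseq// => i lt.
  by rewrite nth_mkseq// -h// (dec_word _ cX).
move=> ->; split; first exact: dec_finite_cycle cX.
by move=> i; rewrite size_mkseq => lt; rewrite nth_mkseq// (dec_word _ cX).
Qed.

Lemma unitP_zeta_word L c (E : set (measurableTypeR R)) : good L -> measurable E ->
  (forall u, 0 <= u < 1 -> E u <-> word c (zeta L u)) ->
  unitP E = (word_law L c)%:E.
Proof.
move=> gL mE h; rewrite -(unitP_In c (word_law_tree L)) /unitP /mrestr; congr lebesgue_measure.
apply/seteqP; split=> u [Eu uI]; split=> //; move: (uI); rewrite /= in_itv /= => u01.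
  by apply/(zeta_word c gL u01)/h.
by apply/h => //; apply/zeta_word.
Qed.

(** The image of [x] depends on the single letter [pickle x], so the event is, inside [0, 1[, a
    countable union of intervals of words of length [(pickle x).+1]. *)
Lemma zeta_measurable L : random_map (zeta L : measurableTypeR R -> pfun d).
Proof.
move=> x y; have [gL|ngL] := pselect (good L); last first.
  rewrite (_ : [set u | _] = [set u | x = y]); last first.
    by apply/seteqP; split=> u /=; rewrite /zeta asboolF// => -[].
  have [->|xy] := eqVneq x y; first by rewrite (_ : [set u | _] = setT)//; apply/seteqP; split.
  rewrite (_ : [set u | _] = set0)//; rewrite -subset0 => u /= e; by move: xy; rewrite e eqxx.
pose I01 := [set` `[(0:R), 1[].
pose F c : set (measurableTypeR R) :=
  if (size c == (pickle x).+1) && (next (odflt [::] (unpickle (last 0%N c) : option (seq T))) x == y)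
  then [set u | In (word_law L) c u] else set0.
have mF c : measurable (F c).
  by rewrite /F; case: ifP => // _; exact: measurable_In.
rewrite (_ : [set u | _] = (\bigcup_(c in [set: seq nat]) F c) `|` (~` I01 `&` [set u | x = y])).
  apply: measurableU; first by apply: countable_bigcupT_measurable => //; exact: countableP.
  apply: measurableI; first by apply: measurableC; exact: measurable_itv.
  have [->|xy] := eqVneq x y; first by rewrite (_ : [set u | _] = setT)//; apply/seteqP; split.
  by rewrite (_ : [set u | _] = set0)//; rewrite -subset0 => u /= e; move: xy; rewrite e eqxx.
have I01E u : I01 u <-> 0 <= u < 1 by rewrite /I01 /= in_itv.
have lastwd u : last 0%N (wd (word_law L) u (pickle x).+1) = digit (word_law L) u (pickle x).
  by rewrite /= last_rcons.
apply/seteqP; split=> u /=.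
  have [u01|nu01] := pselect (0 <= u < 1); last first.
    by rewrite /zeta asboolF => [|[]//] xy; right; split=> // /I01E.
  rewrite zetaE// => dxy; left; exists (wd (word_law L) u (pickle x).+1) => //.
  rewrite /F size_wd eqxx lastwd /= [X in if X then _ else _](_ : _ = true); last by apply/eqP.
  exact: (In_wd (word_law_tree L) (pickle x).+1 u01).
move=> [[c _]|[nI e]]; last by rewrite /zeta asboolF// => -[_ /I01E].
rewrite /F; case: ifP => // /andP[/eqP sc /eqP nc] Ic.
have u01 := In_01 (word_law_tree L) Ic.
move: Ic => /(InP (word_law_tree L) c u01); rewrite sc => cE.
by rewrite zetaE// /dec -lastwd -cE.
Qed.

Lemma zeta_cvg x : {ae (@unitP R), forall u, exists L0 : set T, finite_set L0 /\
  forall L, finite_set L -> L0 `<=` L -> zeta L u x = zeta setT u x}.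
Proof.
(* Left endpoints suffice, the intervals being open on the right. *)
pose N : set (measurableTypeR R) := (fun c => lo (word_law setT) c) @` [set: seq nat].
have cN : countable N.
  by apply: (@sub_countable _ _ _ [set: seq nat]); [exact: card_image_le|exact: countableP].
have mN : measurable N by apply: countable_measurable => // t; exact: measurable_set1.
have mC : measurable (~` [set` `[(0:R), 1[] : set (measurableTypeR R)).
  by apply: measurableC; exact: measurable_itv.
exists (N `|` ~` [set` `[(0:R), 1[]); split; first exact: measurableU.
  apply/eqP; rewrite -measure_le0; apply: le_trans (measureU2 _ _ _) _ => //.
  rewrite (_ : (_ + _)%E = 0%E)//; rewrite -[RHS](adde0 0%E); congr (_ + _)%E.
    exact: (@unitP_countable R N cN).
  apply: unitP_out => u /= /[swap] u01; apply.
  by rewrite in_itv.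
move=> u /=; apply: contra_notP => /not_orP [nN /contrapT]; rewrite in_itv /= => u01.
have gT : good setT by right.
pose n := (pickle x).+1; pose c := wd (word_law setT) u n.
have Ic : In (word_law setT) c u by exact: In_wd.
have lt : lo (word_lim p) c < u < lo (word_lim p) c + word_lim p c.
  have E : lo (word_lim p) c = lo (word_law setT) c.
    by rewrite /lo; apply: eq_bigr => i _; apply: eq_bigr => j _; rewrite (word_law_setT p_ge0 p0 b_lt1 Hb).
  rewrite E -(word_law_setT p_ge0 p0 b_lt1 Hb); case/andP: Ic => h1 ->; rewrite andbT lt_neqAle h1 andbT.
  by apply/eqP => e; apply: nN; exists c.
have := near_In (@fin_net_filter T) (@word_law_cvg _ _ _ p_ge0 p0 _ b_lt1 Hb) lt.
move=> [F [fF FH]]; exists F; split; first exact: fF.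
move=> L fL FL.
have gL : good L by left.
apply: (@word_agree _ c).
- by apply/(zeta_word c gL u01); exact: (FH L fL FL).
- exact/(zeta_word c gT u01).
- by rewrite size_wd.
Qed.

Lemma measurable_eq_fun (X : measurableTypeR R -> pfun d) s : random_map X ->
  measurable [set u | X u = s].
Proof.
move=> mX; rewrite (_ : [set u | _] = ~` (\bigcup_(x in [set: T]) ~` [set u | X u x = s x])).
  apply: measurableC; apply: countable_bigcupT_measurable; first exact: countableP.
  by move=> x; apply: measurableC; exact: mX.
rewrite setC_bigcup; apply/seteqP; split=> u /= => [e x _|h]; first by rewrite setCK /= e.
by apply/funext => x; have := h x I; rewrite setCK.
Qed.

Lemma zeta_law L s : finite_set L -> S_of L s ->
  unitP [set u : measurableTypeR R | zeta L u = s] = (W L s / partZ L)%:E.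
Proof.
move=> fL Ss; have fs := S_of_finite_cycle fL Ss.
have gL : good L by left.
(* A word of this length reads every site of [L] and so determines the permutation. *)
pose n := (\max_(x <- finmap.enum_fset (fset_set L)) pickle x).+1.
pose c := mkseq (fun i => pickle (cyc s (xs d i))) n.
have wcs : word c s by split=> // i; rewrite size_mkseq => lt; rewrite nth_mkseq.
have wE t : S_of L t -> word c t -> t = s.
  move=> St wt; apply/funext => x; have [Lx|nLx] := pselect (L x); last first.
    by rewrite (S_of_fix St)// (S_of_fix Ss).
  have ft := S_of_finite_cycle fL St.
  apply/((word_Cy ft wcs).1 wt); exists (pickle x); last first.
    by rewrite /= xsK; have [Co _] := cycP x fs; exact: Cyc_head Co.
  suff : (pickle x < size c)%N by [].
  rewrite size_mkseq ltnS; apply: leq_bigmax_seq => //.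
  by rewrite in_fset_set// inE.
rewrite (@unitP_zeta_word L c)//.
- rewrite word_law_fin//; congr (_%:E); rewrite /word_prob.
  rewrite (_ : _ `&` _ = [set s]); last by apply/seteqP; split=> [t [St wt]|_ ->]; [exact: wE|].
  by rewrite esum_set1// lee_fin W_ge0.
- by apply: measurable_eq_fun; exact: zeta_measurable.
- move=> u u01; split=> [->//|wz]; apply: wE => //; exact: zeta_S_of.
Qed.

End Coupling.

(** * Measurability and uniqueness of laws *)

Section CountableOps.
Context {dO : measure_display} {O : measurableType dO}.

Lemma measurable_exists (I : countType) (P : I -> set O) :
  (forall i, measurable (P i)) -> measurable [set u | exists i, P i u].
Proof.
move=> mP; rewrite (_ : [set u | _] = \bigcup_(i in [set: I]) P i).
  by apply: countable_bigcupT_measurable => //; exact: countableP.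
by apply/seteqP; split=> [u [i Pi]|u [i _ Pi]]; exists i.
Qed.

Lemma measurable_forall (I : countType) (P : I -> set O) :
  (forall i, measurable (P i)) -> measurable [set u | forall i, P i u].
Proof.
move=> mP; rewrite (_ : [set u | _] = ~` [set u | exists i, (~` P i) u]).
  by apply: measurableC; apply: measurable_exists => i; exact: measurableC.
apply/seteqP; split=> [u h [i]|u h i]; first by apply; exact: h.
by apply: contrapT => nP; apply: h; exists i.
Qed.

Lemma measurable_prop (P : Prop) : measurable [set _ : O | P].
Proof.
have [h|h] := pselect P.
  by rewrite (_ : [set _ | _] = setT)//; apply/seteqP; split.
by rewrite (_ : [set _ | _] = set0)//; apply/seteqP; split.
Qed.

End CountableOps.

Section PermMeasurable.
Variable d : nat.
Local Notation T := (site d).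
Local Notation PS := (PermSp d).
Implicit Types (A L : set T) (x y : T) (s : pfun d).

Lemma measurable_coord x y : measurable [set s : PS | s x = y].
Proof. by apply: sub_sigma_algebra; exists x, y. Qed.

Lemma perm_measurable (dO : measure_display) (O : measurableType dO) (X : O -> PS) :
  random_map (X : O -> pfun d) -> measurable_fun setT X.
Proof.
move=> h; apply: (@measurability _ _ O PS setT X (cyl setT)) => // _ [_ [x [y [_ ->]]] <-].
by rewrite setTI; exact: h.
Qed.

Lemma measurable_iter n x y : measurable [set s : PS | iter n s x = y].
Proof.
elim: n y => [|n IH] y; first exact: (measurable_prop (x = y)).
rewrite (_ : [set s | _] = [set s | exists z : T, ([set s | iter n s x = z] `&` [set s | s z = y]) s]).
  by apply: measurable_exists => z; apply: measurableI => //; exact: measurable_coord.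
by apply/seteqP; split=> s /= => [<-|[z [<-]]//]; exists (iter n s x).
Qed.

Lemma measurable_eq2 x y : measurable [set s : PS | s x = s y].
Proof.
rewrite (_ : [set s | _] = [set s | exists z : T, ([set s | s x = z] `&` [set s | s y = z]) s]).
  by apply: measurable_exists => z; apply: measurableI; exact: measurable_coord.
by apply/seteqP; split=> s /= => [e|[z [-> ->]]//]; exists (s x); split.
Qed.

Lemma measurable_Sbij : measurable (@Sbij d : set PS).
Proof.
rewrite (_ : @Sbij d = [set s | forall xy : T * T, (~` [set s | s xy.1 = s xy.2] `|` [set _ | xy.1 = xy.2]) s]
  `&` [set s | forall y : T, exists x : T, s x = y]).
  apply: measurableI; apply: measurable_forall => i.
    apply: measurableU; last exact: measurable_prop.
    by apply: measurableC; exact: measurable_eq2.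
  by apply: measurable_exists => x; exact: measurable_coord.
apply/seteqP; split=> s /=.
  move=> bs; split=> [[x y] /=|y].
    by have [e|] := pselect (s x = s y); [right; exact: (bij_inj bs)|left].
  by have [t sK tK] := bs; exists (t y).
move=> [h1 h2]; apply: inj_surj_bijective => // x y e.
by case: (h1 (x, y)).
Qed.

Lemma measurable_finite_cycle : measurable (@finite_cycle d : set PS).
Proof.
rewrite (_ : @finite_cycle d = @Sbij d `&` [set s | forall x : T, exists n : nat,
   ([set _ | is_true (0 < n)%N] `&` [set s | iter n s x = x]) s])//.
apply: measurableI; first exact: measurable_Sbij.
apply: measurable_forall => x; apply: measurable_exists => n.
by apply: measurableI; [exact: measurable_prop|exact: measurable_iter].
Qed.

Lemma measurable_Cy A s : measurable (Cy A s : set PS).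
Proof.
rewrite (_ : Cy A s = [set t | forall x : T, ([set _ | ~ A x] `|` [set t : PS | t x = s x]) t]).
  apply: measurable_forall => x; apply: measurableU; first exact: measurable_prop.
  exact: measurable_coord.
apply/seteqP; split=> t h x; first by have [Ax|] := pselect (A x); [right; exact: h|left].
by move=> Ax; case: (h x).
Qed.

(** Only stable sets [A] occur, because cycle weights determine the probabilities of their
    cylinders; [A] contains [L] so that the sites of [L] can be resampled inside it. *)
Definition elem L : set (set PS) := [set B | exists A s,
  [/\ finite_set A, L `<=` A, finite_cycle s, inv_on A s & B = Cy A s `&` @finite_cycle d]].

(** Elementary events contain finite-cycle permutations only. The measurable sets without any such
    permutation, null for the laws considered, are added to generate the whole sigma-algebra. *)
Definition gen L : set (set PS) :=
  [set B | elem L B \/ (measurable B /\ B `&` @finite_cycle d = set0)].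

Lemma Cy_eq A s t : Cy A s t -> Cy A s = Cy A t.
Proof. by move=> st; apply/seteqP; split=> u h x Ax; rewrite h// st. Qed.

Lemma inv_on_Cy A s t : Cy A s t -> inv_on A s -> inv_on A t.
Proof. by move=> st inv x Ax; rewrite st//; exact: inv. Qed.

(** At a common point [t] both cylinders are cylinders of [t], and a union of stable sets is stable.
    Without a common finite-cycle permutation, the intersection is of the second kind. *)
Lemma gen_setI L : setI_closed (gen L).
Proof.
move=> B C GB GC.
have mB (D : set PS) : gen L D -> measurable D.
  move=> [[A [s [_ _ _ _ ->]]]|[]//]; apply: measurableI; first exact: measurable_Cy.
  exact: measurable_finite_cycle.
have [e|ne] := pselect (B `&` C `&` @finite_cycle d = set0).
  by right; split=> //; apply: measurableI; exact: mB.
left; case: GB => [|[_ B0]]; last first.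
  by exfalso; apply: ne; rewrite setIAC B0 set0I.
case: GC => [|[_ C0]]; last first.
  by exfalso; apply: ne; rewrite -setIA C0 setI0.
move=> [A' [s' [fA' LA' fs' inv' CE]]] [A [s [fA LA fs inv BE]]].
have /set0P [t [[Bt Ct] ft]] : B `&` C `&` @finite_cycle d != set0 by apply/eqP.
rewrite BE in Bt *; rewrite CE in Ct *; case: Bt => Bt _; case: Ct => Ct _.
exists (A `|` A'), t; split=> //.
- by rewrite finite_setU.
- by move=> x /LA ?; left.
- by move=> x [Ax|Ax]; [left; exact: (inv_on_Cy Bt inv)|right; exact: (inv_on_Cy Ct inv')].
- rewrite setIACA setIid (Cy_eq Bt) (Cy_eq Ct); congr (_ `&` _).
  apply/seteqP; split=> u; first by move=> [h h'] x [/h|/h'].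
  by move=> h; split=> x Ax; apply: h; [left|right].
Qed.

Lemma elem_measurable L B : elem L B -> measurable B.
Proof.
move=> [A [s [_ _ _ _ ->]]]; apply: measurableI; first exact: measurable_Cy.
exact: measurable_finite_cycle.
Qed.

Lemma gen_measurable L B : gen L B -> measurable B.
Proof. by move=> [/elem_measurable|[]]. Qed.

(* Indexing the elementary events by pairs of lists makes the family countable. *)
Definition piece L (P : pfun d -> Prop) (ab : seq T * seq T) : set PS :=
  if `[< exists s, [/\ finite_cycle s, inv_on [set` ab.1] s, L `<=` [set` ab.1],
           map s ab.1 = ab.2 & P s] >]
  then @finite_cycle d `&` [set s | map s ab.1 = ab.2] else set0.

Lemma map_Cy (a : seq T) s : [set t | map t a = map s a] = Cy [set` a] s.
Proof. by apply/seteqP; split=> t /=; [move=> /eq_in_map|move=> h; apply/eq_in_map]. Qed.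

Lemma gen_piece L P ab : gen L (piece L P ab).
Proof.
rewrite /piece; case: asboolP => [[s [fs inv La sb _]]|_].
  left; exists [set` ab.1], s; split=> //.
  by rewrite setIC -sb map_Cy.
by right; rewrite set0I; split.
Qed.

Lemma inv_hull s A : finite_set A -> finite_cycle s ->
  exists a : seq T, A `<=` [set` a] /\ inv_on [set` a] s.
Proof.
move=> /finite_seqP [l ->] fs; exists (flatten [seq cyc s x | x <- l]); split.
  move=> x /= xl; apply/flatten_mapP; exists x => //.
  by have [Co _] := cycP x fs; exact: Cyc_head Co.
move=> x /= /flatten_mapP [y yl xy]; apply/flatten_mapP; exists y => //.
by have [_ fo] := cycP y fs; exact: follows_mem fo xy.
Qed.

(** Each finite-cycle permutation is stable on a finite set around [L] and [x], and its values there
    decide the event. *)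
Lemma piece_cover L x y : finite_set L ->
  @finite_cycle d `&` [set s | s x = y] =
  \bigcup_(ab in [set: seq T * seq T]) piece (L `|` [set x]) (fun s => s x = y) ab.
Proof.
move=> fL; apply/seteqP; split=> [s [fs /= sxy]|s [[a b'] _]].
  have fLx : finite_set (L `|` [set x]) by rewrite finite_setU; split=> //; exact: finite_set1.
  have [a [La inv]] := inv_hull fLx fs.
  by exists (a, map s a) => //; rewrite /piece asboolT//; exists s; split.
rewrite /piece; case: asboolP => // -[t [ft inv La tb Pt]] /= [fs sb]; split=> //=.
have : (Cy [set` a] t) s by rewrite -map_Cy /= sb tb.
by move=> ->//; apply: La; right.
Qed.

Lemma genE L : finite_set L -> (@measurable _ PS) = <<s gen L >>.
Proof.
move=> fL; apply/seteqP; split; last first.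
  apply: smallest_sub; first exact: sigma_algebra_measurable.
  exact: gen_measurable.
apply: smallest_sub; first exact: smallest_sigma_algebra.
move=> _ [x [y [_ ->]]].
have -> : [set s : pfun d | s x = y] =
    (@finite_cycle d `&` [set s | s x = y]) `|` ([set s | s x = y] `\` @finite_cycle d).
  apply/seteqP; split=> s /=; last by move=> [[]|[]].
  by move=> e; have [fs|] := pselect (finite_cycle s); [left|right].
apply: (@measurableU _ (g_sigma_algebraType (gen L))).
  rewrite (piece_cover x y fL).
  apply: (@countable_bigcupT_measurable _ (g_sigma_algebraType (gen L))); first exact: countableP.
  move=> ab; apply: sub_gen_smallest.
  have [e|m] := gen_piece (L `|` [set x]) (fun s => s x = y) ab; last by right.
  left; case: e => A [s [fA LA fs inv ->]]; exists A, s; split=> //.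
  by move=> z Lz; apply: LA; left.
apply: sub_gen_smallest; right; split.
  by apply: measurableD; [exact: measurable_coord|exact: measurable_finite_cycle].
by rewrite -subset0 => s [[_ h] h'].
Qed.

Lemma gen_ind L (P : set (set PS)) : finite_set L ->
  (forall B : set PS, measurable B -> B `&` @finite_cycle d = set0 -> P B) ->
  P setT -> elem L `<=` P ->
  (forall B : set PS, measurable B -> P B -> P (~` B)) ->
  (forall F : (set PS)^nat, (forall n, measurable (F n)) -> trivIset setT F ->
     (forall n, P (F n)) -> P (\bigcup_k F k)) ->
  forall B : set PS, measurable B -> P B.
Proof.
move=> fL P0 PT Pe PC PU B; rewrite (genE fL).
apply: (dynkin_induction (genE fL) (@gen_setI L)) => //.
by move=> C [/Pe//|[mC C0]]; exact: P0.
Qed.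

Lemma perm_measure_unique (R : realType) L (m1 m2 : measure PS R) : finite_set L ->
  m1 (~` @finite_cycle d) = 0%E -> m2 (~` @finite_cycle d) = 0%E -> (m1 setT < +oo)%E ->
  (forall B, elem L B -> m1 B = m2 B) -> forall B, measurable B -> m1 B = m2 B.
Proof.
move=> fL m10 m20 m1T m12.
have mN := measurableC measurable_finite_cycle.
have null (m : measure PS R) (B : set PS) : m (~` @finite_cycle d) = 0%E -> measurable B ->
    B `&` @finite_cycle d = set0 -> m B = 0%E.
  move=> m0 mB B0; apply: (subset_measure0 mB mN _ m0).
  by move=> s Bs fs; rewrite -[False]/(set0 s) -B0.
(* A countable cover by sets of [gen L], as uniqueness of measures requires: the pieces, and the
   complement of the finite-cycle permutations. *)
pose g n : set PS := if n is k.+1 then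
  (if unpickle k is Some ab then piece L (fun=> True) ab else set0) else ~` @finite_cycle d.
have gen0 : gen L set0 by right; rewrite set0I; split.
apply: (measure_unique (gen L) g (genE fL) (@gen_setI L)).
- case=> [|k] /=; first by right; split=> //; rewrite setICl.
  by case: unpickle => // ab; exact: gen_piece.
- apply/seteqP; split=> // s _; have [fs|nfs] := pselect (finite_cycle s); last by exists 0%N.
  have [a [La inv]] := inv_hull fL fs.
  exists (pickle (a, map s a)).+1 => //=; rewrite pickleK /piece asboolT//.
  by exists s; split.
- by move=> B [/m12//|[mB B0]]; rewrite (null m1 B m10 mB B0) (null m2 B m20 mB B0).
- move=> k; apply: le_lt_trans m1T; apply: le_measure; rewrite ?inE//.
  case: k => [|k] //=; case: unpickle => // ab; apply: gen_measurable; exact: gen_piece.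
Qed.

End PermMeasurable.

(** * The infinite-volume law *)

Lemma law_exists (R : realType) (dO d' : measure_display) (O : measurableType dO)
    (T : measurableType d') (P : probability O R) (X : O -> T) : measurable_fun setT X ->
  exists mu : probability T R, forall A, mu A = P (X @^-1` A).
Proof.
move=> mX; pose X' : {mfun O >-> T} := HB.pack X (isMeasurableFun.Build _ _ _ _ X mX).
by exists (distribution P X').
Qed.

Lemma cvg_fine_dist (R : realType) (u : nat -> \bar R) (l : \bar R) (e : R) :
  u @ \oo --> l -> l \is a fin_num -> 0 < e -> exists n, `|fine l - fine (u n)| < e.
Proof.
move=> ul fl e0; rewrite -(fineK fl) in ul.
have /cvgrPdist_lt/(_ e e0) [n _ /(_ n (leqnn n))] : fine (u n) @[n --> \oo] --> fine l.
  exact: fine_cvg ul.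
by exists n.
Qed.

Section ContinuousFunctions.
Variables (R : realType) (d : nat).
Local Notation T := (site d).
Local Notation PS := (PermSp d).
Implicit Types (f : pfun d -> R).

Lemma measurable_map (l m : seq T) : measurable [set s : PS | map s l = m].
Proof.
have [[s0 <-]|no] := pselect (exists s0 : pfun d, map s0 l = m).
  by rewrite map_Cy; exact: measurable_Cy.
rewrite (_ : [set s | _] = set0); first exact: measurable0.
by rewrite -subset0 => s sl; apply: no; exists s.
Qed.

(** By continuity each set f > a is, within the bijections, a union of cylinders over finite lists,
    of which there are countably many. *)
Lemma cont_measurable f : cont_on_S f -> measurable_fun (@Sbij d : set PS) (f : PS -> R).
Proof.
move=> cf; apply: (@measurability _ _ PS R (@Sbij d) f (@RGenOInfty.G R)).
  exact: RGenOInfty.measurableE.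
move=> _ [_ [a ->] <-].
pose Q (ab : seq T * seq T) := forall s, Sbij s -> map s ab.1 = ab.2 -> a < f s.
rewrite (_ : _ `&` _ = @Sbij d `&` [set s | exists ab : seq T * seq T,
    ([set _ | Q ab] `&` [set s : PS | map s ab.1 = ab.2]) s]); last first.
  apply/seteqP; split=> s [bs /=]; rewrite in_itv /= andbT; last first.
    by move=> [ab [/(_ s bs) Qab /Qab]].
  move=> afs; split=> //; have e0 : 0 < f s - a by rewrite subr_gt0.
  have [F [/finite_seqP [l ->] h]] := cf s bs _ e0.
  exists (l, map s l); split=> //= t bt /eq_in_map tl.
  have := h t bt tl; rewrite ltr_norml => /andP[+ _]; rewrite opprB; lra.
apply: measurableI; first exact: measurable_Sbij.
apply: measurable_exists => -[l m]; apply: measurableI; first exact: measurable_prop.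
exact: measurable_map.
Qed.

End ContinuousFunctions.

Section WeakLimit.
Variables (R : realType) (d : nat) (p : site d -> R).
Hypothesis p_ge0 : forall y, 0 <= p y.
Hypothesis p0 : p 0 = 1.
Local Notation T := (site d).
Local Notation PS := (PermSp d).
Local Notation w := (cyc_weight p).
Local Notation W := (weight p).
Local Notation partZ := (partZ p).
Local Notation zeta := (zeta p).
Local Notation O := (measurableTypeR R).
Implicit Types (A B D L : set T) (x y : T) (o l : seq T) (s : pfun d) (c : seq nat).
Variable b : R.
Hypothesis b_lt1 : b < 1.
Hypothesis Hb : (\esum_(o in Cyc2 (d:=d)) ((size o)%:R * w o)%:E <= b%:E)%E.

Let zS L u : S_of L (zeta L u) := zeta_S_of p_ge0 p0 b_lt1 Hb L u.
Let zFC L u : finite_cycle (zeta L u) := zeta_finite_cycle p_ge0 p0 b_lt1 Hb L u.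

Lemma zeta_mfun L : measurable_fun setT (zeta L : O -> PS).
Proof. exact: perm_measurable (zeta_measurable p_ge0 p0 b_lt1 Hb L). Qed.

Lemma zeta_comp_mfun (f : pfun d -> R) L : cont_on_S f ->
  measurable_fun setT (f \o (zeta L : O -> PS)).
Proof.
move=> cf; apply: (measurable_comp _ _ (cont_measurable cf) (zeta_mfun L)).
- exact: measurable_Sbij.
- by move=> _ [u _ <-]; case: (zFC L u).
Qed.

Lemma expect_fin (f : pfun d -> R) L : finite_set L ->
  (\int[@unitP R]_u (f (zeta L u))%:E = (\sum_(s \in S_of L) W L s / partZ L * f s)%:E)%E.
Proof.
move=> fL; have fS := finite_S_of (d:=d) fL.
have mz s : measurable [set u : O | zeta L u = s].
  by apply: measurable_eq_fun; exact: (zeta_measurable p_ge0 p0 b_lt1 Hb L).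
have E u : (f (zeta L u))%:E =
    (\sum_(s <- finmap.enum_fset (fset_set (S_of L))) (f s)%:E * (\1_[set u : O | zeta L u = s] u)%:E)%E.
  rewrite (bigD1_seq (zeta L u))/=; last 2 first.
  - by rewrite in_fset_set// inE.
  - exact: finmap.fset_uniq.
  rewrite big1 ?adde0 => [|s sz]; first by rewrite indicE mem_set// mule1.
  rewrite indicE memNset ?mule0//= => e; by move: sz; rewrite e eqxx.
under eq_integral do rewrite E.
have int s : (@unitP R).-integrable setT (fun u : O => (f s)%:E * (\1_[set u : O | zeta L u = s] u)%:E)%E.
  by apply: integrableZl => //; exact: integrable_indic.
rewrite integral_sum// fsbig_finite//= -sumEFin big_seq [RHS]big_seq.
apply: eq_bigr => s; rewrite in_fset_set// inE => Ss.
rewrite integralZl//; last exact: integrable_indic.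
rewrite integral_indic// setIT mulrC EFinM; congr (_ * _)%E.
exact: (zeta_law p_ge0 p0 b_lt1 Hb fL Ss).
Qed.

Lemma ae_zeta : {ae (@unitP R), forall u, forall x, exists L0 : set T, finite_set L0 /\
  forall L, finite_set L -> L0 `<=` L -> zeta L u x = zeta setT u x}.
Proof.
have h n := zeta_cvg p_ge0 p0 b_lt1 Hb (xs d n).
have := ae_foralln h; apply: filterS => u hu x.
by have := hu (pickle x); rewrite xsK.
Qed.

Definition box n : set T := [set x | (pickle x < n)%N].

Lemma finite_box n : finite_set (box n).
Proof.
apply: (@sub_finite_set _ _ ((xs d) @` `I_n)); last by apply: finite_image; exact: finite_II.
by move=> x xn; exists (pickle x) => //; rewrite xsK.
Qed.

Lemma sub_box F : finite_set F -> exists N, forall n, (N <= n)%N -> F `<=` box n.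
Proof.
move=> /finite_seqP [l ->]; exists (\max_(x <- l) pickle x).+1 => n Nn x /= xl.
by apply: leq_trans Nn; rewrite ltnS; apply: leq_bigmax_seq.
Qed.

Lemma expect_cvg_seq (f : pfun d -> R) (M e : R) (Ls : nat -> set T) : cont_on_S f ->
  (forall s, Sbij s -> `|f s| <= M) -> (forall n, finite_set (Ls n) /\ box n `<=` Ls n) ->
  0 < e -> exists n,
  `|\sum_(s \in S_of (Ls n)) W (Ls n) s / partZ (Ls n) * f s -
    fine (\int[@unitP R]_u (f (zeta setT u))%:E)%E| < e.
Proof.
move=> cf bf LsP e0.
have bz L u : `|f (zeta L u)| <= M by apply: bf; case: (zFC L u).
have cvgf : {ae (@unitP R), forall u : O, [set: O] u ->
    (EFin \o (fun n => f (zeta (Ls n) u))) @ \oo --> (f (zeta setT u))%:E}.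
  apply: (@filterS _ _ (ae_filter_ringOfSetsType (@unitP R)) _ _ _ ae_zeta) => u hu _.
  apply: cvg_EFin; first exact: nearW.
  apply/cvgrPdist_lt => h h0; have [bs _] := zFC setT u.
  have [F [fF FH]] := cf _ bs h h0.
  have [U [fU UH]] : exists U, finite_set U /\ forall x, F x -> forall L, finite_set L ->
      U `<=` L -> zeta L u x = zeta setT u x.
    have [L0 L0P] := choice hu.
    exists (\bigcup_(x in F) L0 x); split; first by apply: bigcup_finite => // x _; case: (L0P x).
    move=> x Fx L fL UL; have [_ H] := L0P x; apply: H => // y Ly; apply: UL; by exists x.
  have [N NP] := sub_box fU; exists N => // n /= Nn.
  have [fL bL] := LsP n; rewrite distrC; apply: FH; first by case: (zFC (Ls n) u).
  by move=> x Fx; apply: UH => // y /(NP n Nn)/bL.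
have mf n : measurable_fun setT (fun u : O => (f (zeta (Ls n) u))%:E).
  by apply/measurable_EFinP; exact: zeta_comp_mfun.
have mf' : measurable_fun setT (fun u : O => (f (zeta setT u))%:E).
  by apply/measurable_EFinP; exact: zeta_comp_mfun.
have iM : (@unitP R).-integrable setT (EFin \o cst M).
  exact: finite_measure_integrable_cst.
have dom : {ae (@unitP R), forall u : O, forall n : nat, setT u ->
    (`|(f (zeta (Ls n) u))%:E| <= (EFin \o cst M) u)%E}.
  by apply: aeW => u n _; rewrite abse_EFin lee_fin.
pose J n := (\int[@unitP R]_u (f (zeta (Ls n) u))%:E)%E.
pose I := (\int[@unitP R]_u (f (zeta setT u))%:E)%E.
have [int _ cv0] := dominated_convergence measurableT mf mf' cvgf iM dom.
have cvJ : J @ \oo --> I by exact: cv0.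
have If : I \is a fin_num by exact: (integrable_fin_num measurableT int).
have [n hn] := cvg_fine_dist cvJ If e0.
have JE : fine (J n) = \sum_(s \in S_of (Ls n)) W (Ls n) s / partZ (Ls n) * f s.
  by rewrite /J expect_fin//; case: (LsP n).
exists n; rewrite -JE distrC; exact: hn.
Qed.

(** Dominated convergence handles sequences; a failure along the net would yield a sequence of
    volumes exhausting the space, against [expect_cvg_seq]. *)
Lemma expect_cvg (f : pfun d -> R) (M e : R) : cont_on_S f ->
  (forall s, Sbij s -> `|f s| <= M) -> 0 < e ->
  exists L0, finite_set L0 /\ forall L, finite_set L -> L0 `<=` L ->
  `|\sum_(s \in S_of L) W L s / partZ L * f s - fine (\int[@unitP R]_u (f (zeta setT u))%:E)%E| < e.
Proof.
move=> cf bf e0; set I := fine _; apply: contrapT => no.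
have ex n : exists L, (finite_set L /\ box n `<=` L) /\
   e <= `|\sum_(s \in S_of L) W L s / partZ L * f s - I|.
  apply: contrapT => no'; apply: no; exists (box n); split; first exact: finite_box.
  by move=> L fL bL; rewrite ltNge; apply/negP => le; apply: no'; exists L.
have [Ls LsP] := choice ex.
have LsP1 n : finite_set (Ls n) /\ box n `<=` Ls n by case: (LsP n).
have [n] := expect_cvg_seq cf bf LsP1 e0.
by case: (LsP n) => _ /le_lt_trans h /h; rewrite ltxx.
Qed.

Lemma indic_cont A s : finite_set A -> cont_on_S (\1_(Cy A s) : pfun d -> R).
Proof.
move=> fA t bt e e0; exists A; split=> // t' bt' tt'.
have -> : \1_(Cy A s) t' = \1_(Cy A s) t :> R.
  rewrite !indicE; congr (_%:R); congr nat_of_bool; apply/idP/idP; rewrite !inE => h x Ax.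
    by rewrite -tt'// h.
  by rewrite tt'// h.
by rewrite subrr normr0.
Qed.

(** The indicator of a finite cylinder is continuous, and its expectation in a volume [L] containing
    [A] is [W A s * r p L A]. *)
Lemma zeta_Cy A s : finite_set A -> finite_cycle s -> inv_on A s ->
  unitP [set u : O | Cy A s (zeta setT u)] = (W A s * rlim p A)%:E.
Proof.
move=> fA fs inv.
have mE : measurable [set u : O | Cy A s (zeta setT u)].
  by rewrite -[X in measurable X]setTI; apply: (zeta_mfun setT) => //; exact: measurable_Cy.
have E : (\int[@unitP R]_u (\1_(Cy A s) (zeta setT u))%:E = unitP [set u : O | Cy A s (zeta setT u)])%E.
  rewrite -[in RHS](setIT [set u | _]) -(integral_indic _ measurableT)//.
rewrite -E; set I := (\int[_]_u _)%E.
have If : I \is a fin_num by rewrite /I E fin_num_measure.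
rewrite -(fineK If); congr (_%:E).
have b1 t : Sbij t -> `|\1_(Cy A s) t : R| <= 1.
  by move=> _; rewrite indicE; case: (_ \in _); rewrite ?normr1 ?normr0.
have c1 : (\sum_(t \in S_of L) W L t / partZ L * \1_(Cy A s) t) @[L --> @fin_net T] --> fine I.
  apply/cvgrPdist_lt => e e0; have [L0 [fL0 h]] := expect_cvg (indic_cont s fA) b1 e0.
  by exists L0; split=> // L fL LL; rewrite distrC; exact: h.
apply: (cvg_unique (@Rhausdorff _) c1).
have := r_cvg p_ge0 p0 b_lt1 Hb fA; move=> /(cvgMr (a := W A s)).
apply: cvg_trans; apply: near_eq_cvg.
have := near_fin_net fA; apply: filterS => L [fL AL].
rewrite r_in// mulrA; apply/EFin_inj.
rewrite [X in X%:E = _]mulrC EFinM -(esum_Cy p_ge0 fL AL fs inv) -esum_mulr ?invr_ge0 ?partZ_ge0//; last first.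
  by move=> t; rewrite lee_fin W_ge0.
rewrite esum_mkcondr esum_fset; last 2 first.
- exact: finite_S_of.
- by move=> t _; case: ifP => // _; rewrite lee_fin mulr_ge0 ?invr_ge0 ?partZ_ge0 ?W_ge0.
rewrite -fsumEFin; last exact: finite_S_of.
apply: eq_fsbigr => t _; rewrite indicE.
by case: ifP => _; rewrite ?mulr0 ?mulr1// -EFinM mulrC.
Qed.

End WeakLimit.

Lemma measure_esum (R : realType) (dO : measure_display) (O : measurableType dO)
    (mu : measure O R) (I : countType) (D : set I) (F : I -> set O) :
  (forall i, measurable (F i)) -> trivIset D F ->
  (mu (\bigcup_(i in D) F i) = \esum_(i in D) mu (F i))%E.
Proof.
move=> mF tF.
pose G k : set O := if pickle_inv k is Some i then (if i \in D then F i else set0) else set0.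
have mG k : measurable (G k).
  by rewrite /G; case: (@pickle_inv I k) => // i; case: ifP.
have GE i : D i -> G (pickle i) = F i.
  by move=> Di; rewrite /G pickleK_inv mem_set.
have GP k y : G k y -> exists i, [/\ D i, pickle i = k & F i y].
  rewrite /G; have := @pickle_invK I k; case: (@pickle_inv I k) => //= i e.
  by case: ifP => //; rewrite inE => Di Fy; exists i.
have -> : \bigcup_(i in D) F i = \bigcup_(k in (pickle : I -> nat) @` D) G k.
  apply/seteqP; split=> [y [i Di Fy]|y [k _ /GP [i [Di _ Fy]]]]; last by exists i.
  by exists (pickle i); [exists i|rewrite GE].
rewrite measure_bigcup//; last first.
  apply/trivIsetP => _ _ [i Di <-] [j Dj <-] ij; rewrite !GE//.
  by move/trivIsetP: tF; apply => //; apply: contra ij => /eqP ->.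
rewrite nneseries_esum//.
rewrite (_ : [set x | _] = (pickle : I -> nat) @` D); last by apply/seteqP; split=> k /=; rewrite inE.
rewrite esum_image; last by move=> i j _ _; exact: (pcan_inj pickleK).
by apply: eq_esum => i Di; rewrite GE.
Qed.

(** * Laws with given cycle weights *)

Section CycleLaw.
Variables (R : realType) (d : nat) (p : site d -> R).
Hypothesis p_ge0 : forall y, 0 <= p y.
Hypothesis p0 : p 0 = 1.
Local Notation T := (site d).
Local Notation PS := (PermSp d).
Local Notation w := (cyc_weight p).
Local Notation W := (weight p).
Local Notation FC := (@finite_cycle d).
Implicit Types (A B D L : set T) (x y : T) (o l : seq T) (s : pfun d).

(** The infinite-volume form of the cycle weights: on a finite stable set, the probability of [s]
    relative to that of the identity. *)
Definition cycle_law (nu : probability PS R) : Prop :=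
  nu FC = 1%E /\ forall A s, finite_set A -> finite_cycle s -> inv_on A s ->
    nu (Cy A s) = ((W A s)%:E * nu (Cy A id))%E.

Definition fixprob (nu : probability PS R) A : R := fine (nu (Cy A id)).

Implicit Types (nu : probability PS R).

Lemma fixprobE nu A : nu (Cy A id) = (fixprob nu A)%:E.
Proof. by rewrite /fixprob fineK// fin_num_measure//; exact: measurable_Cy. Qed.

Lemma prob_FC_null (nu : probability PS R) : nu FC = 1%E -> nu (~` FC) = 0%E.
Proof.
move=> n1; rewrite probability_setC; last exact: measurable_finite_cycle.
by rewrite n1 subee.
Qed.

Lemma prob_setI_FC (nu : probability PS R) (B : set PS) : nu FC = 1%E -> measurable B ->
  nu (B `&` FC) = nu B.
Proof.
move=> n1 mB; have mF := @measurable_finite_cycle d.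
have := measureDI nu mB mF; rewrite [X in (X + _)%E](_ : _ = 0%E); first by rewrite add0e => ->.
apply: (@subset_measure0 _ _ _ nu _ (~` FC)) => //.
- exact: measurableD.
- exact: measurableC.
- exact: prob_FC_null.
Qed.

Lemma fc_id : finite_cycle (id : pfun d).
Proof. by split; [exists id|move=> x; exists 1%N]. Qed.

Lemma fc_next o : uniq o -> finite_cycle (next o : pfun d).
Proof. by move=> u; apply: (S_of_finite_cycle (finite_seq o)); exact: next_S_of. Qed.

Lemma fixed_avoids A x o s : finite_cycle s -> Cyc x o -> follows o s -> ~ A x ->
  Cy A id s -> avoiding A o.
Proof.
move=> fs [u [t E]] fo nAx cs; subst o; rewrite /avoiding /= -subset0 => a [/= ao Aa].
have inv : inv_on A s by move=> y Ay; rewrite cs.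
have [E _] := follows_iter fo u; move: ao; rewrite E => /trajectP [k _ ak]; apply: nAx.
elim: k a ak Aa => [|k IH] a ak Aa; first by rewrite ak in Aa.
apply: (IH (iter k s x)) => //; apply: (inv_on_inv fs inv); by rewrite ak in Aa.
Qed.

(** The event is split according to the cycle through [x]. A cycle that avoids [A] makes [A]
    together with its own sites a stable set, of relative weight [w o]. *)
Lemma cycle_law_system nu : cycle_law nu -> fixpt_system p setT (fixprob nu).
Proof.
move=> [n1 nC]; split.
- rewrite /fixprob (_ : Cy set0 id = setT) ?probability_setT//.
  by apply/seteqP; split=> // s _ x [].
- by move=> A; rewrite fine_ge0.
- by move=> A [].
move=> A x fA _ _ nAx; rewrite -fixprobE.
have mA : measurable (Cy A id : set PS) by exact: measurable_Cy.
rewrite -(prob_setI_FC n1 mA).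
pose F o : set PS := Cy A id `&` FC `&` follows o.
have mF o : measurable (F o).
  apply: measurableI; first by apply: measurableI => //; exact: measurable_finite_cycle.
  rewrite (_ : follows o = Cy [set` o] (next o)); first exact: measurable_Cy.
  by apply/seteqP; split.
have -> : Cy A id `&` FC = \bigcup_(o in Cyc x) F o.
  apply/seteqP; split=> [s [cs fs]|s [ o _ [] ]//].
  by have [Co fo] := cycP x fs; exists (cyc s x).
rewrite measure_esum//; last first.
  move=> o o' Co Co' [s [[[_ fs] fo] [_ fo']]].
  exact: (cyc_uniq Co Co' fo fo').
rewrite esum_mkcondr; apply: eq_esum => o Co; case: ifPn.
  rewrite inE => av; rewrite EFinM -fixprobE.
  have fAo : finite_set (A `|` [set` o]) by rewrite finite_setU; split=> //; exact: finite_seq.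
  have uo := Cyc_uniq Co.
  have -> : w o = W (A `|` [set` o]) (next o).
    rewrite (@W_sub _ _ _ p0 [set` o])//.
    by move=> y _ /negP; exact: next_out.
  rewrite -nC//; last 2 first.
  - exact: fc_next.
  - move=> y [Ay|yo]; last by right; rewrite /= mem_next.
    left; rewrite next_out//; apply/negP => yo.
    by rewrite -[False]/(set0 y) -av.
  rewrite -(prob_setI_FC n1); last exact: measurable_Cy.
  congr (nu _); apply/seteqP; split=> s; last first.
    move=> [[cs fs] fo]; split=> // y [Ay|yo]; last exact: fo.
    rewrite cs//; apply/esym/next_out/negP => yo.
    by rewrite -[False]/(set0 y) -av.
  move=> [h fs]; split; [split=> //|]; last by move=> y yo; apply: h; right.
  move=> y Ay; rewrite h; last by left.
  apply/next_out/negP => yo.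
  by rewrite -[False]/(set0 y) -av.
rewrite notin_setE => nav; rewrite (_ : F o = set0) ?measure0//.
by rewrite -subset0 => s [[cs fs] fo]; apply: nav; exact: fixed_avoids fo nAx cs.
Qed.

Variable b : R.
Hypothesis b_lt1 : b < 1.
Hypothesis Hb : (\esum_(o in Cyc2 (d:=d)) ((size o)%:R * w o)%:E <= b%:E)%E.

Lemma cycle_law_unique nu nu' (B : set PS) : cycle_law nu -> cycle_law nu' -> measurable B ->
  nu B = nu' B.
Proof.
move=> C C'; have S := cycle_law_system C; have S' := cycle_law_system C'.
have [n1 nC] := C; have [n1' nC'] := C'.
apply: (@perm_measure_unique _ _ set0); try exact: prob_FC_null.
  exact: finite_set0.
  by apply: (@le_lt_trans _ _ 1%E); [exact: probability_le1|exact: ltry].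
move=> _ [A [s [fA _ fs inv ->]]]; have mC := @measurable_Cy d A s.
apply: (etrans (prob_setI_FC n1 mC)); apply: (etrans _ (esym (prob_setI_FC n1' mC))).
by rewrite nC// nC'// !fixprobE (system_unique p_ge0 p0 b_lt1 Hb S S').
Qed.

Lemma cycle_law_exists : exists nu : probability PS R, cycle_law nu /\
  forall B : set PS, nu B = unitP [set u : measurableTypeR R | B (zeta p setT u)].
Proof.
have [nu nuE] := law_exists (@unitP R) (zeta_mfun p_ge0 p0 b_lt1 Hb setT).
exists nu; split=> //; split.
  rewrite nuE (_ : _ @^-1` _ = setT) ?probability_setT//.
  apply/seteqP; split=> // u _; exact: (zeta_finite_cycle p_ge0 p0 b_lt1 Hb setT u).
have E A s : finite_set A -> finite_cycle s -> inv_on A s ->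
    nu (Cy A s) = (W A s * rlim p A)%:E.
  by move=> fA fs inv; rewrite nuE; exact: (zeta_Cy p_ge0 p0 b_lt1 Hb fA fs inv).
move=> A s fA fs inv; rewrite !E//; last exact: fc_id.
by rewrite EFinM; congr (_ * _)%E; rewrite W_fixed ?mul1r.
Qed.

Lemma shiftp_FC u s : finite_cycle s -> finite_cycle (shiftp u s).
Proof.
move=> [[t sK tK] fs]; split.
  exists (shiftp u t) => x; rewrite /shiftp addrK ?sK ?tK subrK//.
move=> x; have [n [n0 nx]] := fs (x - u); exists n; split=> //.
have E k : iter k (shiftp u s) x = iter k s (x - u) + u.
  by elim: k => [|k IH] /=; rewrite ?subrK// IH /shiftp addrK.
by rewrite E nx subrK.
Qed.

Lemma shiftpK u s : shiftp (- u) (shiftp u s) = s.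
Proof. by apply/funext => x; rewrite /shiftp opprK !addrK. Qed.

Lemma shiftp_FC_pre u : shiftp u @^-1` FC = FC.
Proof.
apply/seteqP; split=> s; last exact: shiftp_FC.
by move=> /(shiftp_FC (- u)); rewrite shiftpK.
Qed.

Definition shift_set u A : set T := [set x | A (x + u)].

Lemma finite_shift_set u A : finite_set A -> finite_set (shift_set u A).
Proof.
move=> fA; apply: (@sub_finite_set _ _ ((fun x => x - u) @` A)); last exact: finite_image.
by move=> x Ax; exists (x + u) => //; rewrite addrK.
Qed.

Lemma shift_setE u A : shift_set u A = (fun x => x - u) @` A.
Proof.
apply/seteqP; split=> x; first by move=> Ax; exists (x + u) => //; rewrite addrK.
by move=> [y Ay <-]; rewrite /shift_set /= subrK.
Qed.

Lemma shiftp_Cy u A s : shiftp u @^-1` Cy A s = Cy (shift_set u A) (shiftp (- u) s).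
Proof.
apply/seteqP; split=> t h x.
  move=> Ax; have := h _ Ax; rewrite /shiftp addrK opprK => <-.
  by rewrite addrK.
move=> Ax; have := h (x - u); rewrite /shift_set /= subrK => /(_ Ax).
by rewrite /shiftp opprK subrK => ->; rewrite subrK.
Qed.

Lemma W_shift u A s : W (shift_set u A) (shiftp (- u) s) = W A s.
Proof.
rewrite /weight shift_setE fsbig_image; last by move=> y z _ _; exact: addIr.
have E (y : T) : shiftp (- u) s (y - u) - (y - u) = s y - y.
  by rewrite /shiftp opprK subrK opprB addrA subrK.
by apply: eq_fsbigr => y _; rewrite E.
Qed.

Lemma random_shiftp u : random_map (shiftp u : PS -> pfun d).
Proof.
move=> x y; rewrite (_ : [set s | _] = [set s : PS | s (x - u) = y - u]).
  exact: measurable_coord.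
by apply/seteqP; split=> s /=; rewrite /shiftp => e; [rewrite -e addrK|rewrite e subrK].
Qed.

Lemma measurable_shiftp u : measurable_fun setT (shiftp u : PS -> PS).
Proof. exact: (perm_measurable (@random_shiftp u)). Qed.

(** The shifted law is again a cycle law, and there is only one. *)
Lemma cycle_law_shift nu u (B : set PS) : cycle_law nu -> measurable B ->
  nu (shiftp u @^-1` B) = nu B.
Proof.
move=> C mB; have [nu' nuE] := law_exists nu (measurable_shiftp u).
rewrite -nuE; apply: cycle_law_unique => //.
have [n1 nC] := C; split; first by rewrite nuE shiftp_FC_pre.
move=> A s fA fs inv; rewrite !nuE !shiftp_Cy nC; last 3 first.
- exact: finite_shift_set.
- exact: shiftp_FC.
- by move=> x /inv; rewrite /shift_set /shiftp /= opprK subrK.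
rewrite W_shift; congr (_ * nu (Cy _ _))%E.
by apply/funext => x; rewrite /shiftp opprK addrK.
Qed.

End CycleLaw.

(** * Gibbs specifications *)

Lemma esum_pickle (R : realType) (I : countType) (D : set I) (f : I -> \bar R) :
  (forall i, (0 <= f i)%E) ->
  (\esum_(i in D) f i = \sum_(k <oo)
     (if pickle_inv k is Some i then (if i \in D then f i else 0) else 0))%E.
Proof.
move=> f0; pose g k : \bar R :=
  if pickle_inv k is Some i then (if i \in D then f i else 0%E) else 0%E.
have g0 k : (0 <= g k)%E by rewrite /g; case: pickle_inv => // i; case: ifP.
rewrite -/g nneseries_esumT// [RHS](esumID ((pickle : I -> nat) @` D))//.
rewrite !setTI [X in (_ + X)%E]esum1 ?adde0.
  rewrite esum_image; last by move=> i j _ _; exact: (pcan_inj pickleK).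
  by apply: eq_esum => i Di; rewrite /g pickleK_inv mem_set.
  move=> k nk; rewrite /g; have := @pickle_invK I k; case: (@pickle_inv I k) => //= i e.
  by case: ifP => //; rewrite inE => Di; exfalso; apply: nk; exists i.
by move=> k _; exact: (g0 k).
Qed.

Lemma measurable_fun_esum (R : realType) (dO : measure_display) (O : measurableType dO)
    (I : countType) (D : set I) (f : I -> O -> \bar R) :
  (forall i, measurable_fun setT (f i)) -> (forall i x, (0 <= f i x)%E) ->
  measurable_fun setT (fun x => (\esum_(i in D) f i x)%E).
Proof.
move=> mf f0.
rewrite (_ : (fun x => _) = (fun x => (\sum_(k <oo | k \in predT)
    (if pickle_inv k is Some i then (if i \in D then f i x else 0) else 0))%E)); last first.
  by apply/funext => x; rewrite esum_pickle.
apply: ge0_emeasurable_sum => [k x _ _|k _]; case: pickle_inv => [i|] //.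
- by case: ifP.
- by case: (i \in D) => //; exact: measurable_cst.
Qed.

Lemma measurable_funV (R : realType) (dO : measure_display) (O : measurableType dO)
    (f : O -> R) : (forall x, 0 <= f x) -> measurable_fun setT f ->
  measurable_fun setT (fun x => (f x)^-1).
Proof.
move=> f0 mf; rewrite (_ : (fun x => _) = (fun y => y `^ (-1)) \o f).
  by apply: measurableT_comp => //; exact: measurable_powR.
by apply/funext => x /=; rewrite powR_inv1.
Qed.

Section Specification.
Variables (R : realType) (d : nat) (p : site d -> R).
Hypothesis p_ge0 : forall y, 0 <= p y.
Variables (U : site d -> \bar R) (a : R).
Local Notation T := (site d).
Local Notation PS := (PermSp d).
Local Notation W := (weight p).
Local Notation FC := (@finite_cycle d).
Implicit Types (A B D L : set T) (x y : T) (o l : seq T) (s xi : pfun d).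
Hypothesis boltzE : forall L s, finite_set L -> boltz U a L s = (W L s)%:E.

(** Unlike [partZ] this may vanish, as [p] takes the value 0 for forbidden jumps and [S_cond L xi]
    may be empty; its inverse is then 0. *)
Definition pf L xi : R := fine (\esum_(s in S_cond L xi) (W L s)%:E)%E.

Lemma pf_ge0 L xi : 0 <= pf L xi.
Proof. by rewrite fine_ge0// esum_ge0// => s _; rewrite lee_fin W_ge0. Qed.

Lemma pfE L xi : finite_set L -> (\esum_(s in S_cond L xi) (W L s)%:E = (pf L xi)%:E)%E.
Proof.
move=> fL; rewrite /pf fineK// esum_fset; last 2 first.
- exact: finite_S_cond.
- by move=> i _; rewrite lee_fin W_ge0.
by rewrite fsumEFin//; exact: finite_S_cond.
Qed.

Lemma specE L xi s : finite_set L ->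
  spec U a L xi s = if s \in S_cond L xi then W L s / pf L xi else 0.
Proof.
move=> fL; rewrite /spec boltzE//= /partfun /pf; case: ifP => // _.
by congr (_ / fine _); apply: eq_esum => t _; exact: boltzE.
Qed.

Lemma specAE L xi (C : set PS) : finite_set L ->
  specA U a L xi C = (((pf L xi)^-1)%:E * \esum_(s in S_cond L xi `&` C) (W L s)%:E)%E.
Proof.
move=> fL; rewrite -esum_mulr ?invr_ge0 ?pf_ge0//; last by move=> s; rewrite lee_fin W_ge0.
by apply: eq_esum => s [Ss _]; rewrite specE// mem_set// mulrC EFinM.
Qed.

Lemma specA_ge0 L xi (C : set PS) : finite_set L -> (0 <= specA U a L xi C)%E.
Proof.
move=> fL; rewrite specAE//; apply: mule_ge0; first by rewrite lee_fin invr_ge0 pf_ge0.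
by apply: esum_ge0 => s _; rewrite lee_fin W_ge0.
Qed.

(** Parametrises [S_cond] by the lists of values on [l], an index set that does not depend on [xi];
    measurability in [xi] follows. *)
Definition mod xi l (m : seq T) : pfun d :=
  fun x => if x \in l then nth 0 m (index x l) else xi x.

Lemma measurable_mod l m : measurable_fun setT ((fun xi => mod xi l m) : PS -> PS).
Proof.
apply: perm_measurable => x y; rewrite /mod.
have [xl|xl] := boolP (x \in l); first exact: measurable_prop.
exact: measurable_coord.
Qed.

Lemma W_mod xi l m : W [set` l] (mod xi l m) = W [set` l] (mod id l m).
Proof. by apply: eq_W => x /= xl; rewrite /mod xl. Qed.

Lemma mod_bij l xi (C : set (pfun d)) : uniq l ->
  set_bij [set m | size m = size l /\ (@Sbij d `&` C) (mod xi l m)]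
    (S_cond [set` l] xi `&` C) (mod xi l).
Proof.
move=> ul; split.
- move=> m [sm [bm Cm]]; split=> //; split=> // x /= xl.
  by rewrite /mod ifF//; apply/negP.
- move=> m m'; rewrite !inE => -[sm _] [sm' _] e; apply: (@eq_from_nth _ 0).
    by rewrite sm sm'.
  move=> i im; have il : (i < size l)%N by rewrite -sm.
  have := congr1 (fun f => f (nth 0 l i)) e.
  by rewrite /mod mem_nth// index_uniq.
- move=> s [[bs Ss] Cs].
  have E : mod xi l (map s l) = s.
    apply/funext => x; rewrite /mod; case: ifPn => [xl|xl].
      by rewrite (nth_map 0) ?index_mem// nth_index.
    by rewrite Ss//; apply/negP.
  by exists (map s l) => //; split; rewrite ?size_map// E.
Qed.

Lemma measurable_condsum L (C : set PS) : finite_set L -> measurable C ->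
  measurable_fun setT (fun xi : PS => (\esum_(s in S_cond L xi `&` C) (W L s)%:E)%E).
Proof.
move=> /finite_seqP [l0 L0] mC.
have -> : L = [set` undup l0] by rewrite L0; apply/seteqP; split=> x /=; rewrite mem_undup.
have ul := undup_uniq l0; move: (undup l0) ul => l ul {L0 l0}.
pose f (m : seq T) (xi : PS) : \bar R :=
  ((W [set` l] (mod id l m))%:E * (\1_((fun xi => mod xi l m) @^-1` (@Sbij d `&` C)) xi)%:E)%E.
have f0 m xi : (0 <= f m xi)%E.
  by rewrite /f mule_ge0// lee_fin ?W_ge0// indicE.
have mf m : measurable_fun setT (f m).
  apply: emeasurable_funM; first exact: measurable_cst.
  apply/measurable_EFinP; apply: measurable_indic.
  rewrite -[X in measurable X]setTI; apply: (measurable_mod l m) => //.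
  by apply: measurableI => //; exact: measurable_Sbij.
rewrite (_ : (fun xi => _) = (fun xi => (\esum_(m in [set m : seq T | size m = size l]) f m xi)%E)).
  exact: measurable_fun_esum.
apply/funext => xi; rewrite (reindex_esum _ _ _ _ (mod_bij xi C ul)).
rewrite (_ : [set m | _] = [set m | size m = size l] `&`
    [set m | (@Sbij d `&` C) (mod xi l m)]) ?esum_mkcondr//.
apply: eq_esum => m _; rewrite /f W_mod indicE.
case: ifPn => [|/negP h]; first by rewrite inE => h; rewrite mem_set// mule1.
by rewrite memNset ?mule0// => h'; apply: h; rewrite inE.
Qed.

Lemma measurable_specA L (C : set PS) : finite_set L -> measurable C ->
  measurable_fun setT (fun xi : PS => specA U a L xi C).
Proof.
move=> fL mC; under eq_fun do rewrite specAE//.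
apply: emeasurable_funM; last exact: measurable_condsum.
apply/measurable_EFinP; apply: measurable_funV; first by move=> xi; exact: pf_ge0.
rewrite (_ : pf L = fine \o (fun xi => (\esum_(s in S_cond L xi `&` setT) (W L s)%:E)%E)).
  by apply: measurableT_comp; [exact: fine_measurable|exact: measurable_condsum].
by apply/funext => xi /=; rewrite setIT.
Qed.

Lemma S_cond_refl L s : bijective s -> S_cond L s s. Proof. by []. Qed.

Lemma S_cond_eq L xi s : S_cond L xi s -> S_cond L s = S_cond L xi :> set (pfun d).
Proof.
move=> [_ h]; apply/seteqP; split=> t [bt ht]; split=> // x nL.
  by rewrite ht// h.
by rewrite ht// h.
Qed.

Lemma S_cond_sym L xi s : bijective xi -> S_cond L xi s -> S_cond L s xi.
Proof. by move=> bx Ss; rewrite (S_cond_eq Ss). Qed.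

(** On a finite set around [L] that is stable under [xi], [s] acts as a permutation of a finite set;
    off it, [s] and [xi] have the same orbits. *)
Lemma fc_S_cond L xi s : finite_set L -> finite_cycle xi -> S_cond L xi s -> finite_cycle s.
Proof.
move=> fL fx Ss; have bs : bijective s by case: Ss.
have [A' [LA inv]] := inv_hull fL fx; set A := [set` A'] in LA inv.
have fA : finite_set A by exact: finite_seq.
have bx : bijective xi by case: fx.
have := S_cond_refl L bx => Sx.
have := Ss; rewrite (S_condE Sx) => -[u Su us].
have SAu : S_of A u by exact: S_of_sub Su.
have Sr := restr_S_of fx inv.
have sA x : A x -> s x = (restr A xi \o u) x.
  by move=> Ax; rewrite -us /= restr_in//; exact: (S_of_stable SAu).
have invs : inv_on A s by move=> x Ax; rewrite -us /=; apply: inv; exact: (S_of_stable SAu).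
have [_ fr] := S_of_finite_cycle fA (S_of_comp Sr SAu).
have nA x : ~ A x -> s x = xi x.
  by move=> nA; rewrite -us /= (S_of_fix SAu nA).
split=> // x; have [Ax|nAx] := pselect (A x).
  have [n [n0 nx]] := fr x; exists n; split=> //; rewrite -[RHS]nx.
  have : forall k, iter k s x = iter k (restr A xi \o u) x /\ A (iter k s x).
    by elim=> [|k [IH Ak]] //; rewrite !iterS; split; [rewrite sA// IH|exact: invs].
  by move=> /(_ n) [].
have [_ /(_ x) [n [n0 nx]]] := fx; exists n; split=> //; rewrite -[RHS]nx.
have : forall k, iter k s x = iter k xi x /\ ~ A (iter k xi x).
  elim=> [|k [IH Ak]] //; rewrite !iterS IH; split; first exact: nA.
  by move=> /(inv_on_inv fx inv).
by move=> /(_ n) [].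
Qed.

Definition compat L D s : set PS := [set xi | exists2 t, S_cond L s t & Cy D t xi].

(* Given the values off [L] of a finite-cycle permutation [xi], there is at most one way to
   extend them to agree with [s] on [D]; it exists if and only if [xi] is in [compat L D s]. *)
Lemma specA_Cy L D s xi : finite_set L -> L `<=` D -> finite_cycle s -> finite_cycle xi ->
  specA U a L xi (Cy D s `&` FC) = (W L s / pf L s * \1_(compat L D s) xi)%:E.
Proof.
move=> fL LD fs fx; rewrite specAE//.
have bs : bijective s by case: fs.
have bx : bijective xi by case: fx.
rewrite indicE; have [|nc] := boolP (xi \in compat L D s); last first.
  rewrite (_ : S_cond L xi `&` _ = set0) ?esum_set0 ?mule0 ?mulr0//.
  rewrite -subset0 => t [St [ct ft]]; apply/(negP nc); rewrite inE.
  have := S_cond_sym bx St; rewrite (S_condE (S_cond_refl L _)); last by case: ft.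
  move=> [u Su uxi]; exists (s \o u).
    by apply: S_cond_comp Su; exact: S_cond_refl.
  move=> x Dx; rewrite -uxi /=; apply: ct.
  by apply: (S_of_stable (S_of_sub LD Su)).
rewrite inE => -[t St ct]; rewrite mulr1.
have bt : bijective t by case: St.
have := S_cond_sym bs St; rewrite (S_condE (S_cond_refl L bt)) => -[u Su us].
have Sxu : S_cond L xi (xi \o u) by apply: S_cond_comp Su; exact: S_cond_refl.
have cxu : Cy D s (xi \o u).
  by move=> x Dx; rewrite -us /= ct//; exact: (S_of_stable (S_of_sub LD Su)).
have -> : S_cond L xi `&` (Cy D s `&` FC) = [set xi \o u].
  apply/seteqP; split=> [v [Sv [cv fv]]|_ ->]; last first.
    by split=> //; split=> //; exact: fc_S_cond fx Sxu.
  apply/funext => x; have [Dx|nDx] := pselect (D x); first by rewrite cv// cxu.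
  by case: Sv => _ ->; [case: Sxu => _ ->//|]; move=> /LD.
rewrite esum_set1 ?lee_fin ?W_ge0//.
have -> : W L (xi \o u) = W L s by apply: eq_W => x /LD; exact: cxu.
suff -> : pf L xi = pf L s by rewrite -EFinM mulrC.
rewrite /pf; congr fine; rewrite -(S_cond_eq St).
rewrite (S_condE (S_cond_refl L bx)) (S_condE (S_cond_refl L bt)).
have inj (f : pfun d) (C : set (pfun d)) : bijective f -> set_inj C (fun t => f \o t).
  move=> bf v w _ _ e; apply/funext => x; apply: (bij_inj bf).
  by have := congr1 (fun g => g x) e.
rewrite !esum_image; try exact: inj.
apply: eq_esum => v Sv; congr EFin; apply: eq_W => x Lx /=.
by apply: ct; apply: LD; exact: (S_of_stable Sv).
Qed.

Lemma compat_bigcup L D s : compat L D s = \bigcup_(t in S_cond L s) Cy D t.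
Proof. by []. Qed.

Lemma measurable_compat L D s : finite_set L -> measurable (compat L D s).
Proof.
move=> fL; rewrite compat_bigcup.
apply: fin_bigcup_measurable => [|t _]; first exact: finite_S_cond.
exact: measurable_Cy.
Qed.

Lemma measure_compat (nu : probability PS R) L D s : finite_set L -> L `<=` D ->
  nu (compat L D s) = (\esum_(t in S_cond L s) nu (Cy D t))%E.
Proof.
move=> fL LD; rewrite compat_bigcup measure_fin_bigcup; last 3 first.
- exact: finite_S_cond.
- move=> t t' St St' [x [ct ct']]; apply/funext => y.
  have [Dy|nDy] := pselect (D y); first by rewrite -ct// ct'.
  by case: St => _ ->; [case: St' => _ ->//|]; move=> /LD.
- by move=> t _; exact: measurable_Cy.
by rewrite esum_fset//; exact: finite_S_cond.
Qed.

Lemma specA_bigcup L xi (F : (set PS)^nat) : finite_set L -> trivIset setT F ->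
  specA U a L xi (\bigcup_n F n) = (\sum_(n <oo) specA U a L xi (F n))%E.
Proof.
move=> fL tF; rewrite nneseries_esumT; last by move=> n; exact: specA_ge0.
rewrite /specA setI_bigcupr esum_bigcup//.
- by apply/trivIsetP => i j _ _ ij; move/trivIsetP: tF => /(_ i j Logic.I Logic.I ij) e;
    rewrite setIACA setIid e setI0.
- move=> s _; rewrite specE//; case: ifP => // _.
  by rewrite lee_fin divr_ge0 ?W_ge0 ?pf_ge0.
Qed.

(** The sets that contain both or neither of [s] and [t] form a sigma-algebra. *)
Lemma cyl_agree D (C : set PS) s t : <<s cyl D >> C -> (forall x, D x -> s x = t x) ->
  C s -> C t.
Proof.
move=> DC st; have : <<s cyl D >> `<=` [set C' : set (pfun d) | C' s <-> C' t].
  apply: smallest_sub.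
    split=> /=; first by [].
    - by move=> A h; split=> -[_ h']; split=> // /h.
    - by move=> F h; split=> -[n _ /h Fn]; exists n.
  by move=> _ [x [y [Dx ->]]] /=; rewrite st.
by move=> /(_ C DC) [].
Qed.

(** Properness of the specification: it leaves the configuration off [L] as it is. *)
Lemma specA_proper L xi (B C : set PS) : <<s cyl (~` L) >> B ->
  specA U a L xi (C `&` B) = (specA U a L xi C * (\1_B xi)%:E)%E.
Proof.
move=> mB; rewrite indicE; have [Bx|nBx] := boolP (xi \in B).
  rewrite mule1 /specA; congr (\esum_(s in _) _)%E.
  apply/seteqP; split=> s; first by move=> [Ss []].
  move=> [Ss Cs]; split=> //; split=> //.
  by apply: (cyl_agree mB (s := xi)); [case: Ss => _ h x nL; rewrite h|rewrite inE in Bx].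
rewrite mule0 /specA (_ : _ `&` _ = set0) ?esum_set0//.
rewrite -subset0 => s [Ss [_ Bs]]; apply/(negP nBx); rewrite inE.
by apply: (cyl_agree mB _ Bs); case: Ss.
Qed.

Section Resample.
Variables (nu : probability PS R) (L : set T).
Hypothesis fL : finite_set L.

(** The law after drawing the sites of [L] anew given the others. As it is a measure, its equality
    with [nu] can be tested on [elem L]. *)
Definition resample (C : set PS) : \bar R := (\int[nu]_xi specA U a L xi C)%E.

Lemma resample0 : resample set0 = 0%E.
Proof.
rewrite /resample; under eq_integral do rewrite /specA setI0 esum_set0.
by rewrite integral0.
Qed.

Lemma resample_ge0 C : (0 <= resample C)%E.
Proof. by apply: integral_ge0 => xi _; exact: specA_ge0. Qed.

Lemma resample_sigma : semi_sigma_additive resample.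
Proof.
move=> F mF tF mU; rewrite /resample.
under eq_integral do rewrite specA_bigcup//.
rewrite integral_nneseries//.
- by apply: is_cvg_nneseries => n _ _; exact: resample_ge0.
- by move=> n; exact: measurable_specA.
- by move=> n xi _; exact: specA_ge0.
Qed.

HB.instance Definition _ := isMeasure.Build _ _ _ resample resample0 resample_ge0 resample_sigma.

Lemma resample_Cy D s : nu FC = 1%E -> L `<=` D -> finite_cycle s ->
  resample (Cy D s `&` FC) = ((W L s / pf L s)%:E * nu (compat L D s))%E.
Proof.
move=> n1 LD fs; rewrite /resample.
have mc := measurable_compat D s fL.
rewrite (@ae_eq_integral _ _ _ nu setT (fun xi => ((W L s / pf L s)%:E * (\1_(compat L D s) xi)%:E)%E))//.
- rewrite ge0_integralZl//; last 2 first.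
  + exact/measurable_EFinP.
  + by rewrite lee_fin divr_ge0 ?W_ge0 ?pf_ge0.
  by rewrite integral_indic// setIT.
- apply: measurable_specA => //; apply: measurableI; first exact: measurable_Cy.
  exact: measurable_finite_cycle.
- by apply: emeasurable_funM; [exact: measurable_cst|apply/measurable_EFinP; exact: measurable_indic].
- exists (~` FC); split; first by apply: measurableC; exact: measurable_finite_cycle.
  + exact: prob_FC_null.
  + move=> xi /= h; apply: contrapT => /contrapT fx; apply: h => _.
    by rewrite specA_Cy// EFinM.
Qed.

Lemma resample_FC : nu FC = 1%E -> resample (~` FC) = 0%E.
Proof.
move=> n1; rewrite /resample (@ae_eq_integral _ _ _ nu setT (cst 0%E))//.
- by rewrite integral_cst// mul0e.
- by apply: measurable_specA => //; apply: measurableC; exact: measurable_finite_cycle.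
- exists (~` FC); split; first by apply: measurableC; exact: measurable_finite_cycle.
  + exact: prob_FC_null.
  + move=> xi /= h; apply: contrapT => /contrapT fx; apply: h => _.
    rewrite /specA (_ : _ `&` _ = set0) ?esum_set0//.
    by rewrite -subset0 => s [/(fc_S_cond fL fx)].
Qed.

End Resample.

Hypothesis p0 : p 0 = 1.

(** On an event of [elem L], all permutations that agree with [s] off [L] share the weight of the
    sites in [D] minus [L], so their relative probabilities are those of the specification. *)
Lemma cycle_law_resample (nu : probability PS R) L (C : set PS) : finite_set L ->
  cycle_law p nu -> measurable C -> nu C = resample nu L C.
Proof.
move=> fL [n1 nC]; apply: (@perm_measure_unique _ _ L) => //.
- exact: prob_FC_null.
- exact: resample_FC.
- by apply: (@le_lt_trans _ _ 1%E); [exact: probability_le1|exact: ltry].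
move=> _ [D [s [fD LD fs inv ->]]].
apply: (etrans (prob_setI_FC n1 (measurable_Cy D s))).
apply: (etrans _ (esym (resample_Cy fL n1 LD fs))).
rewrite measure_compat//.
have bs : bijective s by case: fs.
have E t : S_cond L s t -> nu (Cy D t) =
    ((W (D `\` L) s)%:E * ((W L t)%:E * nu (Cy D id)))%E.
  move=> St; have fLD : finite_set (D `\` L) by exact: finite_setD.
  rewrite nC//; last 2 first.
  - exact: fc_S_cond fs St.
  - move=> x Dx; have := St; rewrite (S_condE (S_cond_refl L bs)) => -[u Su <-] /=.
    by apply: inv; exact: (S_of_stable (S_of_sub LD Su)).
  rewrite muleA -EFinM; congr (_%:E * _)%E.
  rewrite -{1}(setDUK LD) W_setU ?setDIK//.
  rewrite mulrC; congr (_ * _); apply: eq_W => x [_ nL].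
  by case: St => _ ->.
rewrite (eq_esum E) fixprobE.
have -> : (\esum_(t in S_cond L s) ((W (D `\` L) s)%:E * ((W L t)%:E * (fixprob nu D)%:E)) =
    (W (D `\` L) s * fixprob nu D * pf L s)%:E)%E.
  rewrite EFinM -pfE// -esum_mulr; last 2 first.
  - by rewrite mulr_ge0 ?W_ge0// fine_ge0.
  - by move=> t; rewrite lee_fin W_ge0.
  by apply: eq_esum => t _; rewrite -!EFinM [W L t * _]mulrC mulrA.
rewrite nC// fixprobE -!EFinM; congr EFin.
have fDL : finite_set (D `\` L) by exact: finite_setD.
rewrite -[in W D s](setDUK LD) W_setU ?setDIK//.
(* When the partition function vanishes, so does the weight of [s], which is one of its terms. *)
have [e|pf0] := eqVneq (pf L s) 0; last first.
  by rewrite [X in _ = _ * X]mulrC mulrA divfK// mulrA.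
have -> : W L s = 0; last by rewrite !mul0r.
apply/eqP; rewrite eq_le W_ge0// andbT -lee_fin -e -pfE//.
apply: esum_ge; exists [set s]; last by rewrite fsbig_set1.
by split; [exact: finite_set1|move=> _ ->; exact: S_cond_refl].
Qed.

Lemma cycle_law_gibbs (nu : probability PS R) : cycle_law p nu -> gibbs U a nu.
Proof.
move=> C; have [n1 _] := C; split.
  apply/eqP; rewrite eq_le probability_le1/=; last exact: measurable_Sbij.
  rewrite -n1; apply: le_measure; rewrite ?inE; first exact: measurable_finite_cycle.
    exact: measurable_Sbij.
  by move=> s [].
move=> L fL A mA B mB.
have mB' : measurable (B : set PS).
  move: mB; apply: sub_smallest2r; first exact: smallest_sigma_algebra.
  by move=> _ [x [y [_ ->]]]; exists x, y.
rewrite (cycle_law_resample fL C); last exact: measurableI.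
rewrite /resample [RHS]integral_mkcond; apply: eq_integral => xi _.
rewrite specA_proper// /patch indicE; case: ifP => _; first by rewrite mule1.
by rewrite mule0.
Qed.

(** The DLR equation is used for the stable set [A] itself: there [s] and the identity have the same
    boundary condition, hence the same [compat] and [pf], and only the weights differ. *)
Lemma gibbs_cycle_law (nu : probability PS R) : gibbs U a nu -> nu FC = 1%E -> cycle_law p nu.
Proof.
move=> [_ G] n1; split=> // A s fA fs inv.
have E t : finite_cycle t -> nu (Cy A t `&` FC) = ((W A t / pf A t)%:E * nu (compat A A t))%E.
  move=> ft; have mC : measurable (Cy A t `&` FC : set PS).
    by apply: measurableI; [exact: measurable_Cy|exact: measurable_finite_cycle].
  have := G A fA _ mC setT; rewrite setIT => ->; last first.
    exact: (@measurableT _ (g_sigma_algebraType (cyl (~` A)))).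
  exact: resample_Cy.
have Sr := restr_S_of fs inv; have fr := S_of_finite_cycle fA Sr.
rewrite -(Cy_restr A s).
rewrite -(prob_setI_FC n1 (measurable_Cy A (restr A s))) -(prob_setI_FC n1 (measurable_Cy A id)).
rewrite (E _ fr) (E _ (@fc_id d)).
have -> : W A (restr A s) = W A s by apply: eq_W => x Ax; rewrite restr_in.
have SE : S_cond A (restr A s) = S_cond A id by rewrite (S_cond_eq Sr).
rewrite /compat /pf SE (@W_fixed _ _ _ p0 A id)// muleA -EFinM mul1r.
by [].
Qed.


End Specification.

(** * Ergodicity *)

Section Ergodic.
Variables (R : realType) (d : nat) (p : site d -> R).
Hypothesis p_ge0 : forall y, 0 <= p y.
Hypothesis p0 : p 0 = 1.
Local Notation T := (site d).
Local Notation PS := (PermSp d).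
Local Notation w := (cyc_weight p).
Local Notation W := (weight p).
Local Notation FC := (@finite_cycle d).
Implicit Types (A B D L : set T) (x y : T) (o l : seq T) (s : pfun d).
Variable b : R.
Hypothesis b_lt1 : b < 1.
Hypothesis Hb : (\esum_(o in Cyc2 (d:=d)) ((size o)%:R * w o)%:E <= b%:E)%E.
Variable nu : probability PS R.
Hypothesis C : cycle_law p nu.

Local Notation Pr := (fun X : set PS => fine (nu X)).

Lemma prE (X : set PS) : measurable X -> nu X = (Pr X)%:E.
Proof. by move=> mX; rewrite fineK// fin_num_measure. Qed.

Lemma shiftp_pre_measurable u (X : set PS) : measurable X -> measurable (shiftp u @^-1` X : set PS).
Proof. by move=> mX; rewrite -[X in measurable X]setTI; exact: measurable_shiftp. Qed.

Lemma Cy_setI A A' s s' : finite_cycle s -> inv_on A s -> finite_cycle s' -> inv_on A' s' ->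
  finite_set A -> finite_set A' -> A `&` A' = set0 ->
  exists2 t, [/\ finite_cycle t, inv_on (A `|` A') t & Cy A s t /\ Cy A' s' t] &
    Cy A s `&` Cy A' s' = Cy (A `|` A') t.
Proof.
move=> fs inv fs' inv' fA fA' AA'.
have Sr := restr_S_of fs inv; have Sr' := restr_S_of fs' inv'.
have d1 x : A x -> ~ A' x by move=> Ax A'x; rewrite -[False]/(set0 x) -AA'.
pose t := restr A s \o restr A' s'.
have tA x : A x -> t x = s x.
  by move=> Ax; rewrite /t /= (restr_out _ (d1 x Ax)) restr_in.
have tA' x : A' x -> t x = s' x.
  move=> A'x; rewrite /t /= (restr_in _ A'x) restr_out// => /d1; apply; exact: inv'.
exists t.
  split; last by split.
  - have fU : finite_set (A `|` A') by rewrite finite_setU.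
    apply: (S_of_finite_cycle fU); apply: S_of_comp; [apply: S_of_sub Sr|apply: S_of_sub Sr'].
      by move=> x; left.
    by move=> x; right.
  - by move=> x [Ax|A'x]; [left; rewrite tA//; exact: inv|right; rewrite tA'//; exact: inv'].
apply/seteqP; split=> v.
  by move=> [c c'] x [Ax|A'x]; [rewrite c// tA|rewrite c'// tA'].
move=> h; split=> x Ax; first by rewrite h ?tA//; left.
by rewrite h ?tA'//; right.
Qed.

(** One sequence of translations that leaves every finite set is enough for ergodicity; this one
    does when [d] is positive. *)
Definition far (n : nat) : T := const_mx n%:Z.

Lemma far_out B : (0 < d)%N -> finite_set B -> \forall n \near \oo, ~ B (- far n).
Proof.
move=> d0 /finite_seqP [l ->]; pose i0 := Ordinal d0.
exists (\max_(x <- l) `|x ord0 i0|%N).+1 => // n /= nl /= nB.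
move: nl; rewrite ltnNge => /negP; apply.
have := @leq_bigmax_seq _ l xpredT (fun x : T => `|x ord0 i0|%N) _ nB isT.
by rewrite !mxE abszN absz_nat.
Qed.

Lemma shift_set_seq u l : shift_set u [set` l] = [set` tr (- u) l].
Proof. by rewrite shift_setE tr_set. Qed.

Lemma mixing_Cy A A' s s' (e : R) : (0 < d)%N -> finite_set A -> finite_set A' ->
  finite_cycle s -> inv_on A s -> finite_cycle s' -> inv_on A' s' -> 0 < e ->
  \forall n \near \oo,
    `|Pr (Cy A s) * Pr (Cy A' s') - Pr (Cy A s `&` shiftp (far n) @^-1` Cy A' s')| < e.
Proof.
move=> d0 fA fA' fs inv fs' inv' e0; have SR := cycle_law_system p0 C.
have [n1 nC] := C.
have /finite_seqP [l0 El0] := fA'; pose l := undup l0.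
have El : A' = [set` l] by rewrite El0; apply/seteqP; split=> x /=; rewrite mem_undup.
have ul : uniq l by exact: undup_uniq.
have /finite_seqP [a Ea] := fA.
set K := W A s * W A' s'; have K0 : 0 <= K by rewrite mulr_ge0 ?W_ge0.
(* The weights multiply the error by [K]; [K + 1] avoids a division by 0. *)
have e1 : 0 < e / (K + 1) by rewrite divr_gt0// ltr_wpDl.
have [B [fB BH]] := system_mixing p_ge0 p0 b_lt1 Hb a SR ul e1.
have fD : finite_set [set x | exists y z, [/\ A y, A' z & x = y - z]].
  apply: (@sub_finite_set _ _ ((fun yz => yz.1 - yz.2) @` (A `*` A'))).
    by move=> x [y [z [Ay A'z ->]]]; exists (y, z).
  by apply: finite_image; exact: finite_setX.
near=> n.
have nB : ~ B (- far n) by near: n; exact: far_out.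
have dis : A `&` shift_set (far n) A' = set0.
  rewrite -subset0 => x [Ax A'x].
  have : ~ [set x | exists y z, [/\ A y, A' z & x = y - z]] (- far n).
    by near: n; exact: far_out.
  by apply; exists x, (x + far n); split=> //; rewrite opprD addrA subrr add0r.
rewrite shiftp_Cy.
have fs2 := shiftp_FC (- far n) fs'.
have inv2 : inv_on (shift_set (far n) A') (shiftp (- far n) s').
  by move=> x /inv'; rewrite /shift_set /shiftp /= opprK subrK.
have fA2 := finite_shift_set (far n) fA'.
have [t [ft it [tA tA']] ->] := Cy_setI fs inv fs2 inv2 fA fA2 dis.
have fU : finite_set (A `|` shift_set (far n) A') by rewrite finite_setU.
rewrite (nC _ _ fU ft it) (nC _ _ fA fs inv) (nC _ _ fA' fs' inv').
rewrite !fixprobE -!EFinM /=.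
rewrite (W_setU p t fA fA2 dis) (eq_W p tA) (eq_W p tA') W_shift -/K.
have -> : fixprob nu A' = fixprob nu (shift_set (far n) A').
  rewrite /fixprob -[in LHS](cycle_law_shift p_ge0 p0 b_lt1 Hb (far n) C); last exact: measurable_Cy.
  rewrite shiftp_Cy; congr (fine (nu (Cy _ _))).
  by apply/funext => x; rewrite /shiftp opprK addrK.
rewrite mulrACA -/K -mulrBr normrM ger0_norm// distrC.
have := BH _ nB; rewrite -shift_set_seq -El -Ea => h.
apply: (@le_lt_trans _ _ (K * (e / (K + 1)))); first by rewrite ler_wpM2l.
by rewrite mulrCA gtr_pMr// ltr_pdivrMr ?mul1r ?ltrDl ?ltr01// ltr_wpDl.
Unshelve. all: by end_near. Qed.

Definition mixes (E X : set PS) : Prop :=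
  Pr (X `&` shiftp (far n) @^-1` E) @[n --> \oo] --> Pr X * Pr E.

(** For a fixed elementary [E], the events that mix with [E] contain the elementary ones and form a
    Dynkin class. *)
Lemma mixes_elem (E X : set PS) : (0 < d)%N -> elem set0 E -> measurable X -> mixes E X.
Proof.
move=> d0 eE; have mE := elem_measurable eE.
have [n1 nC] := C; have mT n := shiftp_pre_measurable (far n) mE.
have PrT n : Pr (shiftp (far n) @^-1` E) = Pr E.
  by rewrite (cycle_law_shift p_ge0 p0 b_lt1 Hb (far n) C).
have nu0 (Y : set PS) : measurable Y -> Y `&` FC = set0 -> nu Y = 0%E.
  move=> mY Y0; rewrite -(prob_setI_FC n1 mY) Y0 measure0//.
have mono (Y Z : set PS) : measurable Y -> measurable Z -> Y `<=` Z -> Pr Y <= Pr Z.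
  move=> mY mZ YZ; rewrite -lee_fin -!prE//; apply: le_measure; rewrite ?inE//.
have add (Y Z : set PS) : measurable Y -> measurable Z -> Y `&` Z = set0 ->
    Pr (Y `|` Z) = Pr Y + Pr Z.
  move=> mY mZ YZ; apply/EFin_inj; rewrite EFinD -!prE//; last exact: measurableU.
  exact: measureU.
have ge0 (Y : set PS) : 0 <= Pr Y by rewrite fine_ge0.
apply: (@gen_ind _ set0) => //.
- move=> Y mY Y0; rewrite /mixes nu0//= mul0r.
  apply: cvg_near_cst; apply: nearW => n.
  rewrite nu0//; first exact: measurableI.
  by rewrite setIAC Y0 set0I.
- rewrite /mixes probability_setT mul1r; apply: cvg_near_cst; apply: nearW => n.
  by rewrite setTI PrT.
- move=> Y [A [s [fA _ fs inv ->]]]; have [A' [s' [fA' _ fs' inv' E']]] := eE.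
  rewrite /mixes E'; apply/cvgrPdist_lt => e e0.
  have := mixing_Cy d0 fA fA' fs inv fs' inv' e0; apply: filterS => n.
  have mA := @measurable_Cy d A s; have mA' := @measurable_Cy d A' s'.
  have mU : measurable (Cy A s `&` shiftp (far n) @^-1` Cy A' s' : set PS).
    by apply: measurableI => //; exact: shiftp_pre_measurable.
  rewrite preimage_setI shiftp_FC_pre setIACA setIid !prob_setI_FC//.
- move=> Y mY mixY; rewrite /mixes.
  have -> : (fun n => Pr (~` Y `&` shiftp (far n) @^-1` E)) =
      (fun n => Pr E - Pr (Y `&` shiftp (far n) @^-1` E)).
    apply/funext => n; rewrite -(PrT n) -{2}(setTI (shiftp (far n) @^-1` E)) -(setUv Y) setIUl add.
    + by rewrite addrC addKr.
    + exact: measurableI.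
    + by apply: measurableI => //; exact: measurableC.
    + by rewrite setIACA setICr set0I.
  have -> : Pr (~` Y) * Pr E = Pr E - Pr Y * Pr E.
    have : Pr Y + Pr (~` Y) = 1.
      by rewrite -add ?setUv ?probability_setT ?setICr//; exact: measurableC.
    by move=> /(canRL (addKr _)) ->; rewrite mulrDl mul1r mulNr addrC.
  by apply: cvgB => //; exact: cvg_cst.
- move=> F mF tF mixF; rewrite /mixes; set G := \bigcup_k F k.
  have mG : measurable G by exact: bigcupT_measurable.
  pose H N := \big[setU/set0]_(k < N) F k.
  have mH N : measurable (H N) by exact: bigsetU_measurable.
  have HG N : H N `<=` G by move=> s; rewrite /H -bigcup_mkord => -[k _ Fk]; exists k.
  have mixH N : Pr (H N `&` shiftp (far n) @^-1` E) @[n --> \oo] --> Pr (H N) * Pr E.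
    elim: N => [|N IH].
      rewrite /H big_ord0 measure0 /= mul0r; apply: cvg_near_cst; apply: nearW => n.
      by rewrite set0I measure0.
    have HF : H N `&` F N = set0.
      rewrite -subset0 => s [+ FN]; rewrite /H -bigcup_mkord => -[k /= kN Fk].
      have e : k = N by apply: (tF k N) => //; exists s.
      by rewrite e ltnn in kN.
    rewrite /H big_ord_recr/= -/(H N) add// mulrDl.
    rewrite (_ : (fun n => _) = (fun n => Pr (H N `&` shiftp (far n) @^-1` E) +
       Pr (F N `&` shiftp (far n) @^-1` E))).
      by apply: cvgD => //; exact: mixF.
    apply/funext => n; rewrite setIUl add//; try exact: measurableI.
    by rewrite setIACA HF set0I.
  have cvH : Pr (H N) @[N --> \oo] --> Pr G.
    have := @nondecreasing_cvg_mu _ _ _ nu H mH _ _.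
    have -> : \bigcup_n H n = G.
      apply/seteqP; split=> [s [n _ /HG]//|s [k _ Fk]]; exists k.+1 => //.
      by rewrite /H -bigcup_mkord; exists k => /=.
    move=> /(_ mG) h.
    have /fine_cvgP [_ //] : nu (H N) @[N --> \oo] --> (Pr G)%:E.
      rewrite -prE//; apply: h => n m nm; rewrite subsetEset /H -!bigcup_mkord => s [k /= kn Fk].
      by exists k => //=; exact: leq_trans kn nm.
  apply/cvgrPdist_lt => e e0; have e4 : 0 < e / 4 by rewrite divr_gt0.
  move/cvgrPdist_lt: cvH => /(_ _ e4) [N _ /(_ N (leqnn N)) /= hN].
  have /cvgrPdist_lt/(_ _ e4) := mixH N.
  apply: filterS => n /= hn.
  (* The remainder of the union beyond [H N] changes either side by at most its own probability. *)
  set r := G `\` H N; have mr : measurable r by exact: measurableD.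
  have GE : G = H N `|` r by rewrite /r setDUK.
  have GH Z : measurable Z -> Pr (G `&` Z) = Pr (H N `&` Z) + Pr (r `&` Z).
    move=> mZ; rewrite [in LHS]GE setIUl; apply: add.
    - exact: measurableI.
    - exact: measurableI.
    - by rewrite setIACA /r setDIK set0I.
  have := GH setT measurableT; rewrite !setIT => GHT.
  have := GH _ (mT n) => ->.
  have := mono (r `&` shiftp (far n) @^-1` E) r (measurableI _ _ mr (mT n)) mr (@subIsetl _ _ _).
  have := ge0 (r `&` shiftp (far n) @^-1` E); have := ge0 r; have := ge0 E.
  have : Pr E <= 1 by rewrite -lee_fin -prE// probability_le1.
  move: hN hn; rewrite GHT [_ + _ - _]addrC addKr mulrDl !ltr_norml.
  move: (Pr _ ) (Pr r) (Pr (H N)) (Pr E) (Pr _) => *; nra.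
Qed.

Lemma site0_eq (x y : T) : ~ (0 < d)%N -> x = y.
Proof.
move=> /negP; rewrite -eqn0Ngt => /eqP d0.
by apply/rowP => i; have := ltn_ord i; rewrite {2}d0.
Qed.

(** Mixing makes an invariant [X] independent of every elementary event, hence of every event, in
    particular of itself. *)
Lemma cycle_law_ergodic : ergodic nu.
Proof.
split=> [u X mX|X mX inv]; first exact: (cycle_law_shift p_ge0 p0 b_lt1 Hb u C).
(* In dimension 0 there is a single map, so each event is empty or full. *)
have [d0|nd0] := pselect (0 < d)%N; last first.
  have e (s t : PS) : s = t by apply/funext => x; exact: site0_eq.
  have [->|/set0P [s Xs]] := eqVneq X set0; first by left.
  right; rewrite (_ : X = setT) ?probability_setT//.
  by apply/seteqP; split=> // t _; rewrite (e t s).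
have [n1 nC] := C.
have ind (E : set PS) : elem set0 E -> Pr (E `&` X) = Pr X * Pr E.
  move=> eE; have mE := elem_measurable eE.
  have := mixes_elem d0 eE mX; rewrite /mixes.
  have -> : (fun n => Pr (X `&` shiftp (far n) @^-1` E)) = fun=> Pr (X `&` E).
    apply/funext => n; rewrite -{1}(inv (far n)) -preimage_setI.
    by rewrite (cycle_law_shift p_ge0 p0 b_lt1 Hb (far n) C)//; exact: measurableI.
  move=> h; rewrite setIC; apply: (@cvg_unique _ (@Rhausdorff R) _ _ _ _ _ h).
  exact: cvg_cst.
have k0 : 0 <= Pr X by rewrite fine_ge0.
pose m2 := mscale (NngNum k0) nu.
have E : mrestr nu mX X = m2 X.
  apply: (@perm_measure_unique _ _ set0) => //.
  - have mN : measurable (~` FC : set PS) by apply: measurableC; exact: measurable_finite_cycle.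
    apply/eqP; rewrite eq_le measure_ge0 andbT; apply: (@le_trans _ _ (nu (~` FC))).
      exact: (measureIl nu mN mX).
    by rewrite (prob_FC_null n1).
  - have E : ((fine (nu X))%:E * nu (~` FC))%E = 0%E by rewrite (prob_FC_null n1) mule0.
    exact: E.
  - have E : (nu (setT `&` X) < +oo)%E.
      by rewrite setTI; apply: (@le_lt_trans _ _ 1%E); [exact: probability_le1|exact: ltry].
    exact: E.
  - move=> Y eY; have mY := elem_measurable eY.
    have E : nu (Y `&` X) = ((fine (nu X))%:E * nu Y)%E.
      by rewrite [X in (_ * X)%E](prE mY) -EFinM -(ind _ eY) -prE//; exact: measurableI.
    exact: E.
have {E} : nu (X `&` X) = ((fine (nu X))%:E * nu X)%E by exact: E.
rewrite setIid => E; have e := congr1 fine E.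
rewrite fineM ?fin_num_measure//= in e; rewrite (prE mX).
have [->|h0] := eqVneq (fine (nu X)) 0; [by left|right; congr EFin].
by apply: (mulfI h0); rewrite mulr1 -e.
Qed.

End Ergodic.

(** * The mean jump *)

Section Preserved.
Context {dO : measure_display} {O : measurableType dO} {R : realType}.
Variables (nu : probability O R) (Th : O -> O).
Hypothesis mTh : measurable_fun setT Th.
Hypothesis inv : forall A, measurable A -> nu (Th @^-1` A) = nu A.

Lemma preserved_integrable (h : O -> \bar R) : nu.-integrable setT h ->
  nu.-integrable setT (h \o Th).
Proof.
move=> /integrableP [mh ih]; apply/integrableP; split; first exact: measurableT_comp.
apply: le_lt_trans ih; rewrite -[X in (_ <= X)%E](@eq_measure_integral _ _ _ setT _ (pushforward nu Th)).
  rewrite ge0_integral_pushforward ?preimage_setT//.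
  by apply: measurableT_comp.
by move=> A mA _; exact: inv.
Qed.

Lemma preserved_integral (h : O -> \bar R) : nu.-integrable setT h ->
  (\int[nu]_x h (Th x) = \int[nu]_x h x)%E.
Proof.
move=> ih; rewrite -[RHS](@eq_measure_integral _ _ _ setT _ (pushforward nu Th)); last first.
  by move=> A mA _; exact: inv.
rewrite integral_pushforward ?preimage_setT//.
- by case/integrableP : ih.
- exact: preserved_integrable.
Qed.

Lemma preserved_iter (h : O -> \bar R) k : nu.-integrable setT h ->
  nu.-integrable setT (fun x => h (iter k Th x)) /\
  (\int[nu]_x h (iter k Th x) = \int[nu]_x h x)%E.
Proof.
elim: k h => [|k IH] h ih //.
have ih' := preserved_integrable ih.
have [i1 e1] := IH _ ih'; split; first exact: i1.
by rewrite -[RHS]preserved_integral// -e1.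
Qed.

End Preserved.

Lemma sum_eq0 (R : realType) (n : nat) (x : \bar R) : (0 < n)%N -> x \is a fin_num ->
  (\sum_(k < n) x = 0 -> x = 0)%E.
Proof.
case: x => // x n0 _; rewrite sumEFin sumr_const card_ord => -[/eqP].
by rewrite -mulr_natr mulf_eq0 pnatr_eq0 (gtn_eqF n0) orbF => /eqP ->.
Qed.

Section MeanJump.
Variables (R : realType) (d : nat) (p : site d -> R).
Hypothesis p_ge0 : forall y, 0 <= p y.
Hypothesis p0 : p 0 = 1.
Local Notation T := (site d).
Local Notation PS := (PermSp d).
Local Notation w := (cyc_weight p).
Local Notation FC := (@finite_cycle d).
Implicit Types (x y : T) (o l : seq T) (s : pfun d).
Variable b : R.
Hypothesis b_lt1 : b < 1.
Hypothesis Hb : (\esum_(o in Cyc2 (d:=d)) ((size o)%:R * w o)%:E <= b%:E)%E.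
Variable nu : probability PS R.
Hypothesis C : cycle_law p nu.

(* The permutation as seen from the image of the origin. It has the same law, by translation
   invariance and because every site has exactly one preimage. *)
Definition walk (s : PS) : PS := shiftp (- s 0) s.

Lemma shiftp_shiftp u u' s : shiftp u (shiftp u' s) = shiftp (u + u') s.
Proof. apply/funext => x; have E : x - (u + u') = x - u - u' by rewrite opprD addrA.
by rewrite /shiftp E -addrA [u' + u]addrC. Qed.

Lemma iter_shiftp k u s x : iter k (shiftp u s) x = iter k s (x - u) + u.
Proof. by elim: k => [|k IH] /=; rewrite ?subrK// IH /shiftp addrK. Qed.

Lemma iter_walk k s : iter k walk s = shiftp (- iter k s 0) s.
Proof.
elim: k => [|k IH]; first by apply/funext => x; rewrite /= /shiftp oppr0 subr0 addr0.
rewrite iterS IH /walk shiftp_shiftp; congr (shiftp _ _).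
by rewrite {1}/shiftp sub0r opprK iterS opprD opprK addrK.
Qed.

Lemma measurable_walk : measurable_fun setT walk.
Proof.
apply: perm_measurable => x y.
rewrite (_ : [set s | _] = [set s | exists z : T, ([set s : PS | s 0 = z] `&`
   [set s | s (x + z) = y + z]) s]).
  by apply: measurable_exists => z; apply: measurableI; exact: measurable_coord.
apply/seteqP; split=> s /=; rewrite /walk /shiftp opprK.
  by move=> <-; exists (s 0); split=> //; rewrite subrK.
by move=> [z [-> ->]]; rewrite addrK.
Qed.

Lemma walk_preserves (B : set PS) : measurable B -> nu (walk @^-1` B) = nu B.
Proof.
move=> mB; have [n1 nC] := C.
have mW : measurable (walk @^-1` B) by rewrite -[X in measurable X]setTI; exact: measurable_walk.
have mF := @measurable_finite_cycle d.
(* Mass transport: translation by [- z] takes the event s 0 = z to the event t (- z) = 0, and these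
   last events split the permutations according to the preimage of 0. *)
pose G (z : T) : set PS := [set t | t (- z) = 0] `&` B.
have mG z : measurable (G z) by apply: measurableI => //; exact: measurable_coord.
have GE z : shiftp (- z) @^-1` G z = [set s | s 0 = z] `&` walk @^-1` B.
  apply/seteqP; split=> s; rewrite /G /= /shiftp /walk opprK addNr.
    move=> [e Bs]; have -> : s 0 = z by apply/eqP; rewrite -subr_eq0 e.
    by rewrite /shiftp opprK; split.
  by move=> [e]; rewrite e subrr /shiftp opprK.
pose H (z : T) : set PS := shiftp (- z) @^-1` G z.
have mH z : measurable (H z) by exact: shiftp_pre_measurable.
rewrite (_ : walk @^-1` B = \bigcup_(z in [set: T]) H z); last first.
  apply/seteqP; split=> [s Bs|s [z _]]; last by rewrite /H GE => -[].
  by exists (s 0) => //; rewrite /H GE.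
rewrite measure_esum//; last first.
  by move=> z z' _ _ [s []]; rewrite /H !GE => -[<- _] [<-].
have nH z : nu (H z) = nu (G z `&` FC).
  by rewrite (prob_setI_FC n1 (mG _)) (cycle_law_shift p_ge0 p0 b_lt1 Hb _ C (mG _)).
rewrite (eq_esum (fun z _ => nH z)).
rewrite -measure_esum; last 2 first.
- by move=> z; exact: measurableI.
- move=> z z' _ _ [s [[[/= e _] [bs _]] [[/= e' _] _]]].
  by apply: oppr_inj; apply: (bij_inj bs); rewrite e e'.
rewrite -(prob_setI_FC n1 mB); congr (nu _); apply/seteqP; split=> s.
  by move=> [z _ [[_ ?] ?]].
move=> [Bs fs]; have [[t sK tK] _] := fs.
by exists (- t 0) => //; split=> //; split=> //=; rewrite opprK tK.
Qed.

Variable i : 'I_d.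

Definition jump (s : PS) : R := ((s 0) ord0 i)%:~R.

Definition loop n : set PS := [set s | iter n s 0 = 0].

Lemma measurable_loop n : measurable (loop n).
Proof. exact: measurable_iter. Qed.

Lemma iter_inj s k : bijective s -> injective (iter k s).
Proof. by move=> bs; elim: k => // k IH x y /= /(bij_inj bs) /IH. Qed.

Lemma loop_walk n k (s : PS) : bijective s -> loop n (iter k walk s) <-> loop n s.
Proof.
move=> bs; rewrite /loop /= iter_walk iter_shiftp sub0r opprK -iterD addnC iterD.
split=> [/eqP|->]; last by rewrite subrr.
by rewrite subr_eq0 => /eqP /(iter_inj bs).
Qed.

(** The event [loop n] is stable along the walk, and on it the jumps telescope around the cycle
    through 0. *)
Lemma sum_jump n (s : PS) : bijective s ->
  \sum_(k < n) jump (iter k walk s) * \1_(loop n) (iter k walk s) = 0.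
Proof.
move=> bs; have [ls|nls] := pselect (loop n s); last first.
  rewrite big1// => k _; rewrite indicE memNset ?mulr0//.
  by move=> /(loop_walk _ _ bs).
have E (k : 'I_n) : jump (iter k walk s) * \1_(loop n) (iter k walk s) =
    ((iter k.+1 s 0) ord0 i)%:~R - ((iter k s 0) ord0 i)%:~R.
  rewrite indicE mem_set ?mulr1; last exact/(loop_walk _ _ bs).
  by rewrite /jump iter_walk /shiftp sub0r opprK !mxE rmorphB.
rewrite (eq_bigr _ (fun k _ => E k)) -(big_mkord xpredT (fun k : nat => ((iter k.+1 s 0) ord0 i)%:~R -
   ((iter k s 0) ord0 i)%:~R)) telescope_sumr// ls.
by rewrite subrr.
Qed.

Hypothesis iJ : nu.-integrable setT (EFin \o jump).

Lemma integral_jump_loop n : (0 < n)%N ->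
  (\int[nu]_s (jump s * \1_(loop n) s)%:E = 0)%E.
Proof.
move=> n0; have [n1 _] := C.
pose h (s : PS) : \bar R := (jump s * \1_(loop n) s)%:E.
have mh : measurable_fun setT h.
  apply/measurable_EFinP; apply: measurable_funM.
    by apply/measurable_EFinP; case/integrableP : iJ.
  by apply: measurable_indic; exact: measurable_loop.
have ih : nu.-integrable setT h.
  apply: (le_integrable measurableT mh _ iJ) => s _ /=.
  rewrite lee_fin normrM indicE; case: (_ \in _); rewrite ?normr1 ?normr0 ?mulr1//.
  by rewrite mulr0.
have H k := preserved_iter measurable_walk walk_preserves k ih.
have : (\int[nu]_s (\sum_(k < n) h (iter k walk s)) = \sum_(k < n) \int[nu]_s h s)%E.
  rewrite integral_sum//; last by move=> k; case: (H k).
  by apply: eq_bigr => k _; case: (H k).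
rewrite [LHS](_ : _ = 0%E); last first.
  rewrite (@ae_eq_integral _ _ _ nu setT (cst 0%E))//.
  - by rewrite integral_cst// mul0e.
  - by apply: emeasurable_sum => k; case: (H k) => /integrableP[].
  - exists (~` FC); split; first by apply: measurableC; exact: measurable_finite_cycle.
    + exact: prob_FC_null.
    + move=> s /= hs; apply: contrapT => /contrapT fs; apply: hs => _.
      by rewrite /h sumEFin sum_jump//; case: fs.
have := integrable_fin_num measurableT ih.
move=> fI /esym; exact: sum_eq0.
Qed.

Lemma integral_jump : (\int[nu]_s (jump s)%:E = 0)%E.
Proof.
have [n1 _] := C.
have mJ : measurable_fun setT (EFin \o jump) by case/integrableP : iJ.
(* Factorials are eventually multiples of every cycle length, so these functions tend to [jump] at
   each finite-cycle permutation. *)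
pose f_ m (s : PS) : \bar R := (jump s * \1_(loop m`!) s)%:E.
have mf m : measurable_fun setT (f_ m).
  apply/measurable_EFinP; apply: measurable_funM; first exact/measurable_EFinP.
  by apply: measurable_indic; exact: measurable_loop.
have cvf : {ae nu, forall s : PS, setT s -> f_ ^~ s @ \oo --> (EFin \o jump) s}.
  exists (~` FC); split; first by apply: measurableC; exact: measurable_finite_cycle.
    exact: prob_FC_null.
  move=> s /= hs; apply: contrapT => /contrapT [bs fs]; apply: hs => _.
  have [n [n0 nx]] := fs 0; apply: cvg_near_cst; exists n => // m /= nm.
  rewrite /f_ indicE mem_set ?mulr1// /loop /=.
  have /dvdnP [q ->] : (n %| m`!)%N by rewrite dvdn_fact// n0.
  by elim: q => //= q IH; rewrite mulSn iterD IH nx.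
have dom : {ae nu, forall s : PS, forall m : nat, setT s -> (`|f_ m s| <= abse ((EFin \o jump) s))%E}.
  apply: aeW => s m _; rewrite /f_ /= lee_fin normrM indicE.
  by case: (_ \in _); rewrite ?normr1 ?normr0 ?mulr1// mulr0.
have ia : nu.-integrable setT (fun s => abse ((EFin \o jump) s)) by exact: integrable_abse.
have [_ _] := dominated_convergence measurableT mf mJ cvf ia dom.
rewrite (_ : [sequence _]_n = fun=> 0%E); last first.
  by apply/funext => m; exact: (integral_jump_loop (fact_gt0 m)).
by move=> /cvg_lim <- //; rewrite lim_cst.
Qed.

End MeanJump.

(** * A linear bound on jumps *)

Lemma int_half (a : int) : odd `|a|%N = false -> (a %/ 2)%Z + (a %/ 2)%Z = a.
Proof. lia. Qed.

Lemma int_parityD (a c : int) : odd `|a|%N = odd `|c|%N -> odd `|(a + c)%R|%N = false.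
Proof. lia. Qed.

Lemma int_double_inj (a c : int) : a + a = c + c -> a = c.
Proof. lia. Qed.

Section LinearBound.
Variables (R : realType) (d : nat).
Local Notation T := (site d).
Implicit Types (x y z : T) (o l : seq T).
Variables (D : set T) (h : T -> R).

Definition stepsum l : T := \sum_(z <- l) z.
Definition cost l : R := \sum_(z <- l) h z.
Definition inD l : Prop := forall z, z \in l -> D z.
Definition closed_list l : Prop := inD l /\ stepsum l = 0.
Definition steps o : seq T := [seq next o x - x | x <- o].

Lemma cost_cat l l' : cost (l ++ l') = cost l + cost l'.
Proof. exact: big_cat. Qed.
Lemma stepsum_cat l l' : stepsum (l ++ l') = stepsum l + stepsum l'.
Proof. exact: big_cat. Qed.
Lemma cost_cons z l : cost (z :: l) = h z + cost l.
Proof. exact: big_cons. Qed.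
Lemma stepsum_cons z l : stepsum (z :: l) = z + stepsum l.
Proof. exact: big_cons. Qed.
Lemma inD_cat l l' : inD (l ++ l') <-> inD l /\ inD l'.
Proof.
split=> [H|[H H'] z]; last by rewrite mem_cat => /orP[/H|/H'].
by split=> z zl; apply: H; rewrite mem_cat zl ?orbT.
Qed.

(* The endpoint of the walk with steps [l] is left out. *)
Definition positions l : seq T := [seq stepsum (take k l) | k <- iota 0 (size l)].

Lemma size_positions l : size (positions l) = size l.
Proof. by rewrite size_map size_iota. Qed.

Lemma nth_positions l k : (k < size l)%N -> nth 0 (positions l) k = stepsum (take k l).
Proof. by move=> kl; rewrite (nth_map 0%N) ?size_iota// nth_iota. Qed.

Lemma not_uniq_positions l : ~~ uniq (positions l) ->
  exists l1 l2 l3, [/\ l = l1 ++ l2 ++ l3, l2 != [::], l3 != [::] & stepsum l2 = 0].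
Proof.
move=> /(uniqPn 0) [i [j [ij]]]; rewrite size_positions => jl.
rewrite !nth_positions//; last exact: ltn_trans jl.
move=> e; exists (take i l), (take (j - i) (drop i l)), (drop j l); split.
- have E : drop i l = take (j - i) (drop i l) ++ drop j l.
    by rewrite -{1}(cat_take_drop (j - i) (drop i l)) drop_drop subnK// ltnW.
  by rewrite -E cat_take_drop.
- by rewrite -size_eq0 -lt0n size_take size_drop ltn_sub2r ?(ltn_trans ij jl)// subn_gt0.
- by rewrite -size_eq0 -lt0n size_drop subn_gt0.
- have : stepsum (take j l) = stepsum (take i l) + stepsum (take (j - i) (drop i l)).
    by rewrite -stepsum_cat take_drop subnK ?(ltnW ij)// -(take_takel l (ltnW ij)) cat_take_drop.
  by rewrite -e => /eqP; rewrite addrC -subr_eq subrr => /eqP <-.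
Qed.

Hypothesis h0 : h 0 = 0.
Hypothesis cycle_ge0 : forall o, Cyc2 o -> inD (steps o) -> 0 <= cost (steps o).

Lemma steps_positions l : uniq (positions l) -> stepsum l = 0 -> (0 < size l)%N ->
  steps (positions l) = l.
Proof.
move=> u s0 l0; apply: (@eq_from_nth _ 0); first by rewrite size_map size_positions.
move=> k; rewrite size_map size_positions => kl.
rewrite (nth_map 0) ?size_positions// next_nth mem_nth ?size_positions//.
have [y0 [t E]] : exists y0 t, positions l = y0 :: t.
  by case E : (positions l) => [|y0 t]; [move: (size_positions l) l0; rewrite E => <-|exists y0, t].
have st : size l = (size t).+1 by rewrite -(size_positions l) E.
have ik : index (nth 0 (positions l) k) (positions l) = k by rewrite index_uniq ?size_positions.
rewrite ik {1}E.
have -> : nth y0 t k = stepsum (take k.+1 l).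
  have [kl'|] := ltnP k.+1 (size l).
    rewrite -nth_positions// E /=; apply: set_nth_default.
    by lia.
  (* At the last index [next] wraps around to 0, which is the sum of the whole list. *)
  move=> lk; rewrite take_oversize// s0 nth_default.
    have := @nth_positions l 0 l0; rewrite E /= take0 /stepsum big_nil => ->//.
  by lia.
rewrite nth_positions// (take_nth 0)// -cats1 stepsum_cat addrC addKr.
by rewrite /stepsum big_seq1.
Qed.

Lemma positions_Cyc l : uniq (positions l) -> (0 < size l)%N -> Cyc 0 (positions l).
Proof.
move=> u l0; split=> //; exists (behead (positions l)).
have := @nth_positions l 0 l0; case E : (positions l) => [|y0 t] /=.
  by move: (size_positions l) l0; rewrite E => <-.
by rewrite take0 /stepsum big_nil => ->.
Qed.

(** Closed pieces are cut out until the partial sums are distinct and the list comes from a cycle.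
    Every piece has nonnegative cost, so the one that keeps the first step costs no more than [l]. A
    zero step alone is closed without being a cycle, hence [y != 0]. *)
Lemma loop_erasure l : closed_list l -> 0 <= cost l /\
  forall y l', l = y :: l' -> y != 0 ->
  exists o, [/\ Cyc2 o, inD (steps o), next o 0 = y & cost (steps o) <= cost l].
Proof.
have [n] := ubnP (size l); elim: n l => // n IH l ln [Dl s0].
have [u|nu] := boolP (uniq (positions l)).
  have [l1|] := leqP (size l) 1.
    case: l l1 {ln u} Dl s0 => [|y [|]]//= _ _; first by rewrite /cost big_nil.
    rewrite /stepsum /cost !big_seq1 => ->; rewrite h0; split=> //.
    by move=> y' l' [<- _]; rewrite eqxx.
  move=> l2; have l0 : (0 < size l)%N by exact: ltnW.
  have C2 : Cyc2 (positions l) by split; [exact: positions_Cyc|rewrite /= size_positions].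
  have E := steps_positions u s0 l0.
  split; first by rewrite -E; apply: cycle_ge0 => //; rewrite E.
  move=> y l' El y0; exists (positions l); rewrite E; split=> //.
  have [_ [t Ct]] := positions_Cyc u l0.
  have : head 0 (steps (positions l)) = next (positions l) 0 - 0 by rewrite /steps {2}Ct.
  by rewrite E subr0 {1}El.
have [l1 [l2 [l3 [El l2n l3n s2]]]] := not_uniq_positions nu.
move: Dl; rewrite {1}El !inD_cat => -[D1 [D2 D3]].
have c2 : closed_list l2 by [].
have c13 : closed_list (l1 ++ l3).
  split; first by rewrite inD_cat.
  by move: s0; rewrite El !stepsum_cat s2 add0r.
have sz : (size l = size l1 + size l2 + size l3)%N by rewrite El !size_cat addnA.
have z2 : (0 < size l2)%N by case: (l2) l2n.
have z3 : (0 < size l3)%N by case: (l3) l3n.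
have [g2 H2] : _ := IH l2 (ltac:(lia)) c2.
have [g13 H13] : _ := IH (l1 ++ l3) (ltac:(rewrite size_cat; lia)) c13.
have EG : cost l = cost l2 + cost (l1 ++ l3) by rewrite El !cost_cat addrCA.
split; first by rewrite EG addr_ge0.
(* The first step lies in the piece cut out if [l1] is empty, and in what is left otherwise. *)
move=> y l' Ely y0; case: l1 El H13 g13 EG {D1 c13 sz} => [|y1 l1] El H13 g13 EG.
  have [y2 [l2' El2]] : exists y2 l2', l2 = y2 :: l2' by case: (l2) l2n => // y2 l2'; exists y2, l2'.
  have ey : y2 = y by move: El; rewrite Ely El2 => -[].
  have [ o [C Do no co]] := H2 _ _ El2 (ltac:(by rewrite ey)).
  by exists o; split=> //; [rewrite no|rewrite EG ler_wpDr].
have ey : y1 = y by move: El; rewrite Ely => -[].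
have [ o [C Do no co]] := H13 _ _ erefl (ltac:(by rewrite ey)).
by exists o; split=> //; [rewrite no|rewrite EG ler_wpDl].
Qed.

Definition parity z : {ffun 'I_d -> bool} := [ffun i => odd `|z ord0 i|%N].
Definition half z : T := \row_i (z ord0 i %/ 2)%Z.

Lemma half_double z : parity z = [ffun=> false] -> half z + half z = z.
Proof.
move=> e; apply/rowP => i; rewrite !mxE.
by move/ffunP: e => /(_ i); rewrite !ffunE => /int_half.
Qed.

Lemma parityD x y : parity x = parity y -> parity (x + y) = [ffun=> false].
Proof.
by move=> /ffunP e; apply/ffunP => i; move: (e i); rewrite !ffunE !mxE => /int_parityD.
Qed.

Lemma double_inj x y : x + x = y + y -> x = y.
Proof.
by move=> e; apply/rowP => i; have := congr1 (fun z : T => z ord0 i) e; rewrite !mxE => /int_double_inj.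
Qed.

Definition mid x y : T := half (x + y).

Lemma mid_double x y : parity x = parity y -> mid x y + mid x y = x + y.
Proof. by move=> e; apply/half_double/parityD. Qed.

Hypothesis D_mid : forall x y z, D x -> D y -> z + z = x + y -> D z /\ h z + h z <= h x + h y.

(* Midpoints of lattice points are lattice points only within a parity class, so up to one
   step per class is left alone. *)
Lemma pairing l : inD l -> exists m r,
  [/\ inD m, inD r, {subset r <= l} /\ uniq (map parity r),
      stepsum l = stepsum m + stepsum m + stepsum r &
      cost m + cost m + cost r <= cost l].
Proof.
elim: l => [|x l IH] Dl.
  exists [::], [::]; split=> //; first by rewrite /stepsum big_nil !addr0.
  by rewrite /cost big_nil !addr0.
have Dx : D x by apply: Dl; rewrite mem_head.
have Dl' : inD l by move=> z zl; apply: Dl; rewrite inE zl orbT.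
have [m [r [Dm Dr [rl ur] sE cE]]] := IH Dl'.
have [/mapP [z zr xz]|nx] := boolP (parity x \in map parity r).
  have pr := perm_to_rem zr.
  have [DM hM] := D_mid Dx (Dr z zr) (mid_double xz).
  exists (mid x z :: m), (rem z r); split.
  - by move=> y; rewrite inE => /orP [/eqP ->//|/Dm].
  - by move=> y /mem_rem /Dr.
  - split; first by move=> y /mem_rem /rl yl; rewrite inE yl orbT.
    have : uniq (map parity (z :: rem z r)) by rewrite -(perm_uniq (perm_map parity pr)).
    by move=> /andP [].
  - have er : stepsum r = z + stepsum (rem z r) by rewrite /stepsum (perm_big _ pr) big_cons.
    rewrite !stepsum_cons sE er (addrACA (mid x z)) (mid_double xz).
    by rewrite [stepsum m + stepsum m + (z + _)]addrCA !addrA.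
  - have : cost r = h z + cost (rem z r) by rewrite /cost (perm_big _ pr) big_cons.
    by rewrite !cost_cons => ?; lra.
exists m, (x :: r); split=> //.
- by move=> y; rewrite inE => /orP [/eqP ->//|/Dr].
- split; last by rewrite /= nx.
  by move=> y; rewrite !inE => /orP [->//|/rl ->]; rewrite orbT.
- by rewrite !stepsum_cons sE addrCA.
- by rewrite !cost_cons; lra.
Qed.

(** One step per parity class, among those that occur in closed lists. Being chosen once for all, it
    leaves finitely many possible remainders. *)
Definition rep (q : {ffun 'I_d -> bool}) : T :=
  xget 0 [set z | parity z = q /\ exists l, closed_list (z :: l)].

Lemma closed_rot z l : closed_list l -> z \in l -> closed_list (z :: rem z l).
Proof.
move=> [Dl s0] zl; have pr := perm_to_rem zl; split; last first.
  by rewrite -s0 /stepsum [RHS](perm_big _ pr).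
by move=> y; rewrite -(perm_mem pr) => /Dl.
Qed.

Lemma repP z l : closed_list l -> z \in l ->
  [/\ parity (rep (parity z)) = parity z, D (rep (parity z)) &
      exists2 c, inD c & stepsum c = - rep (parity z)].
Proof.
move=> cl zl; rewrite /rep; case: xgetP => [y -> [ey [c [Dc sc]]]|no]; last first.
  by case: (no z); split=> //; exists (rem z l); exact: closed_rot.
split=> //; first by apply: Dc; rewrite mem_head.
exists c; first by move=> x xc; apply: Dc; rewrite inE xc orbT.
by apply/eqP; rewrite -addr_eq0 addrC -stepsum_cons sc.
Qed.

(** A way back from [s], chosen once for all so that its cost depends on [s] alone. *)
Definition back (s : T) : seq T := xget [::] [set c | inD c /\ stepsum c = - s].

Definition nrm z : R := \sum_i `|(z ord0 i)%:~R|.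

Lemma nrm_ge0 z : 0 <= nrm z.
Proof. by apply: sumr_ge0 => i _; exact: normr_ge0. Qed.

Lemma nrm_mid x y : parity x = parity y -> nrm x <= nrm (mid x y) + nrm (mid x y) + nrm y.
Proof.
move=> e; rewrite /nrm -!big_split; apply: ler_sum => i _ /=.
have := congr1 (fun z : T => z ord0 i) (mid_double e); rewrite !mxE.
move: (x ord0 i) (y ord0 i) => c f; move: ((c + f) %/ 2)%Z => a E.
have -> : c = a + a - f by rewrite E addrK.
rewrite rmorphB rmorphD /=; apply: le_trans (ler_normB _ _) _; rewrite lerD2r.
exact: ler_normD.
Qed.

(* Replace the steps by midpoints: of pairs of the same class, or of a step and the
   representative of its class. The sum is then one of finitely many values, which a
   list of bounded cost brings back to 0. *)
Lemma halve : exists2 K, 0 <= K & forall y l, closed_list (y :: l) ->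
  exists y' l', [/\ closed_list (y' :: l'), cost (y' :: l') + cost (y' :: l') <= cost (y :: l) + K &
    nrm y <= nrm y' + nrm y' + K].
Proof.
pose P : finType := {ffun 'I_d -> bool}.
(* The index records the class of [y] and the set of classes left unpaired. [A] is twice the sum of
   the halved list, [H] the cost of the representatives and [B] the cost of the way back; summing
   over all indices bounds each of them. *)
pose A (qQ : P * {set P}) : T := rep qQ.1 + \sum_(q in qQ.2) rep q.
pose H (qQ : P * {set P}) : R := h (rep qQ.1) + \sum_(q in qQ.2) h (rep q).
pose B (qQ : P * {set P}) : R := cost (back (half (A qQ))).
exists (\sum_qQ (`|H qQ| + (`|B qQ| + `|B qQ|) + nrm (rep qQ.1))).
  by apply: sumr_ge0 => qQ _; rewrite !addr_ge0// nrm_ge0.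
move=> y l cyl; have [Dyl s0] := cyl.
have yyl : y \in y :: l by rewrite mem_head.
have Dl : inD l by move=> z zl; apply: Dyl; rewrite inE zl orbT.
have [m [r [Dm Dr [rl ur] sE cE]]] := pairing Dl.
have rP z : z \in r -> [/\ parity (rep (parity z)) = parity z, D (rep (parity z)) &
      exists2 c, inD c & stepsum c = - rep (parity z)].
  by move=> zr; apply: (repP cyl); rewrite inE rl ?orbT.
have [ey Dy [cy Dcy scy]] := repP cyl yyl.
pose qQ : P * {set P} := (parity y, [set q in map parity r]).
have sumQ (V : nmodType) (f : P -> V) : \sum_(q in qQ.2) f q = \sum_(z <- r) f (parity z).
  rewrite -(big_map parity xpredT f) big_uniq//=.
  by apply: eq_bigl => q; rewrite inE.
pose a z := rep (parity z).
pose m2 := [seq mid z (a z) | z <- r].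
pose y' := mid y (a y).
have [Dy' hy'] := D_mid (Dyl y yyl) Dy (mid_double (esym ey)).
have s2 : stepsum m2 + stepsum m2 = stepsum r + \sum_(q in qQ.2) rep q.
  rewrite sumQ /stepsum big_map -!big_split; rewrite big_seq [RHS]big_seq.
  apply: eq_bigr => z zr /=; apply: mid_double; by have [-> _ _] := rP z zr.
have c2 : cost m2 + cost m2 <= cost r + \sum_(q in qQ.2) h (rep q).
  rewrite sumQ /cost big_map -!big_split; rewrite big_seq [leRHS]big_seq.
  apply: ler_sum => z zr /=; have [ez Dz _] := rP z zr.
  by have [] := D_mid (Dr z zr) Dz (mid_double (esym ez)).
have Dm2 : inD m2.
  move=> _ /mapP [z zr ->]; have [ez Dz _] := rP z zr.
  by have [] := D_mid (Dr z zr) Dz (mid_double (esym ez)).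
set S := stepsum (y' :: m ++ m2).
have SS : S + S = A qQ.
  have e2 : (stepsum m + stepsum m2) + (stepsum m + stepsum m2) = stepsum l + \sum_(q in qQ.2) rep q.
    by rewrite addrACA s2 addrA -sE.
  rewrite /S stepsum_cons stepsum_cat addrACA e2 (mid_double (esym ey)).
  by rewrite addrACA -stepsum_cons s0 add0r.
have SA : half (A qQ) = S.
  apply: double_inj; rewrite half_double// -SS parityD//.
have [c0 Dc0 sc0] : exists2 c, inD c & stepsum c = - A qQ.
  have : exists2 c, inD c & stepsum c = - \sum_(z <- r) rep (parity z).
    elim: (r) rP => [|z r' IH] rP'.
      by exists [::] => //; rewrite big_nil oppr0 /stepsum big_nil.
    have [_ _ [c Dc sc]] := rP' z (mem_head _ _).
    have [c' Dc' sc'] := IH (fun x xr => rP' x (ltac:(by rewrite inE xr orbT))).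
    exists (c ++ c'); first by rewrite inD_cat.
    by rewrite stepsum_cat sc sc' big_cons opprD.
  move=> [c Dc sc]; exists (cy ++ c); first by rewrite inD_cat.
  by rewrite stepsum_cat scy sc /A sumQ opprD.
have [Db sb] : inD (back (half (A qQ))) /\ stepsum (back (half (A qQ))) = - S.
  rewrite SA /back; case: xgetP => [c -> //|no]; exfalso.
  (* Its sum is - 2 S + S, which shows that a way back from [S] exists. *)
  apply: (no (c0 ++ y' :: m ++ m2)); split.
    rewrite inD_cat; split=> // z; rewrite inE => /orP [/eqP ->//|].
    by rewrite mem_cat => /orP [/Dm|/Dm2].
  by rewrite stepsum_cat sc0 -SS -/S opprD addrNK.
exists y', ((m ++ m2) ++ back (half (A qQ))); split.
- split; last by rewrite -cat_cons stepsum_cat sb -/S subrr.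
  move=> z; rewrite inE => /orP [/eqP ->//|]; rewrite !mem_cat => /orP [/orP [/Dm|/Dm2]|/Db] //.
- apply: (@le_trans _ _ (cost (y :: l) + (`|H qQ| + (`|B qQ| + `|B qQ|)))).
    rewrite !cost_cons !cost_cat -/(B qQ).
    have := ler_norm (H qQ); have := ler_norm (B qQ); rewrite {1}/H /= -/(a y); lra.
  rewrite lerD2l (bigD1 qQ)//= -addrA lerDl addr_ge0 ?nrm_ge0//.
  by apply: sumr_ge0 => q _; rewrite !addr_ge0// nrm_ge0.
- apply: (le_trans (nrm_mid (esym ey))); rewrite lerD2l (bigD1 qQ)//=.
  rewrite -addrA addrC -addrA lerDl addr_ge0//.
  by apply: sumr_ge0 => q _; rewrite !addr_ge0// nrm_ge0.
Qed.

(** The shift by [K] absorbs the errors: one halving gives 2 (c' - K) <= c - K for the costs, and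
    [nrm y + K <= 2 * (nrm y' + K)]. *)
Lemma halve_iter : exists2 K, 0 <= K & forall k y l, closed_list (y :: l) ->
  exists y' l', [/\ closed_list (y' :: l'), 2 ^+ k * (cost (y' :: l') - K) <= cost (y :: l) &
    nrm y <= 2 ^+ k * (nrm y' + K)].
Proof.
have [K K0 HK] := halve; exists K => // k; elim: k => [|k IH] y l c.
  by exists y, l; split=> //; rewrite expr0 mul1r; lra.
have [y1 [l1 [c1 h1 n1]]] := IH y l c; have [y2 [l2 [c2 h2 n2]]] := HK _ _ c1.
have k0 : 0 < 2 ^+ k :> R by rewrite exprn_gt0.
exists y2, l2; split=> //; rewrite exprS; move: (2 ^+ k) k0 h1 n1 => t; nra.
Qed.

Lemma pow2_approx (g : R) : 0 <= g -> exists k, g <= 2 ^+ k <= g + g + 1.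
Proof.
move=> g0; have exP : exists k, g <= 2 ^+ k.
  exists (Num.bound g); apply: (le_trans (ltW (archi_boundP g0))).
  by rewrite -natrX ler_nat ltnW// ltn_expl.
case: (ex_minnP exP) => k gk mk; exists k; rewrite gk /=.
case: k gk mk => [|k] gk mk; first by rewrite expr0; lra.
have : ~~ (g <= 2 ^+ k) by apply/negP => /mk; rewrite ltnn.
by rewrite -ltNge exprS; lra.
Qed.

Hypothesis finite_level : forall c : R,
  finite_set [set o | Cyc2 o /\ inD (steps o) /\ cost (steps o) <= c].

(** With 2 ^ k at least the cost g and at most 2 g + 1, k halvings leave a cost of at most [K + 1].
    Loop erasure puts the first step of the halved list on one of the finitely many cycles in [F],
    so [M] bounds it. *)
Lemma linear_bound : exists2 K, 0 <= K & forall o, Cyc2 o -> inD (steps o) ->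
  nrm (next o 0) <= K * (cost (steps o) + 1).
Proof.
have [K K0 HK] := halve_iter.
have /finite_seqP [F EF] := finite_level (K + 1).
pose M : R := \sum_(o <- F) nrm (next o 0).
have M0 : 0 <= M by apply: sumr_ge0 => o _; exact: nrm_ge0.
exists (2 * (M + K)); first by lra.
move=> o Co Do; have c0 := cycle_ge0 Co Do.
have [y [l [El Ey]]] : exists y l, steps o = y :: l /\ y = next o 0.
  have [[_ [t Et]] _] := Co; exists (next o 0), [seq next o x - x | x <- t].
  by rewrite /steps [X in map _ X]Et /= subr0.
have cl : closed_list (y :: l).
  rewrite -El; split=> //; have [[u _] _] := Co.
  rewrite /stepsum /steps big_map sumrB -(big_map (next o) xpredT id).
  rewrite (perm_big o) ?subrr//; apply: uniq_perm => //.
    by rewrite map_inj_uniq//; exact: (can_inj (prev_next u)).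
  move=> x; apply/mapP/idP => [[z zo ->]|xo]; first by rewrite mem_next.
  by exists (prev o x); rewrite ?mem_prev// next_prev.
have [k /andP [gk kg]] := pow2_approx c0.
have [y' [l' [cl' hl' nl']]] := HK k y l cl.
have k0 : 0 < 2 ^+ k :> R by rewrite exprn_gt0.
have cK : cost (y' :: l') <= K + 1.
  rewrite -El in hl'; rewrite -lerBlDl -(ler_pM2l k0) mulr1.
  exact: le_trans gk.
have ny' : nrm y' <= M.
  have [->|y'0] := eqVneq y' 0.
    by rewrite /nrm big1// => i _; rewrite mxE normr0.
  have [_ /(_ _ _ erefl y'0) [ o' [Co' Do' no' co']]] := loop_erasure cl'.
  have : o' \in F.
    have : [set` F] o' by rewrite -EF; split=> //; split=> //; exact: le_trans cK.
    by [].
  move=> o'F; rewrite -no' /M (perm_big _ (perm_to_rem o'F)) big_cons lerDl.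
  by apply: sumr_ge0 => *; exact: nrm_ge0.
rewrite -Ey; apply: (le_trans nl').
apply: (@le_trans _ _ (2 ^+ k * (M + K))); first by rewrite ler_pM2l// lerD2r.
rewrite mulrC [2 * _]mulrC -mulrA ler_wpM2l//; lra.
Qed.

End LinearBound.

(** * Weights from a convex potential *)

Section Potential.
Variables (R : realType) (d : nat) (v : site d) (V : site d -> \bar R).
Local Notation T := (site d).
Implicit Types (x y z : T) (o l : seq T) (a : R).
Hypotheses (V_ge0 : forall z, (0 <= V z)%E) (V_sconv : strictly_convex V).
Hypothesis Vv_fin : V v \is a fin_num.

Definition stepD : set T := [set y | V (y + v) \is a fin_num].
Definition stepE y : R := fine (V (y + v)) - fine (V v).

Lemma VvE y : stepD y -> Vv V v y = (stepE y)%:E.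
Proof. by move=> Dy; rewrite /Vv /stepE EFinB !fineK. Qed.

Lemma Vvy y : ~ stepD y -> Vv V v y = +oo%E.
Proof.
rewrite /stepD /Vv /=; case E : (V (y + v)) => [r||] nf; last 2 first.
- by case: (V v) Vv_fin.
- by have := V_ge0 (y + v); rewrite E.
by case: nf.
Qed.

Lemma stepD0 : stepD 0.
Proof. by rewrite /stepD /= add0r. Qed.

Lemma stepE0 : stepE 0 = 0.
Proof. by rewrite /stepE add0r subrr. Qed.

(* Only points of the lattice are compared: off the lattice, the convex extension of [V] could
   take the value -oo. *)
Lemma V_mid x y z : V x \is a fin_num -> V y \is a fin_num -> z + z = x + y ->
  V z \is a fin_num /\ fine (V z) + fine (V z) <= fine (V x) + fine (V y).
Proof.
move=> fx fy e; have [exy|nxy] := eqVneq x y.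
  have -> : z = x by apply: double_inj; rewrite e -exy.
  by rewrite exy.
have [U [VU cU]] := V_sconv.
pose m (z : T) : 'rV[R]_d := map_mx (fun k : int => k%:~R) z.
have mz : m z = (2^-1 : R) *: m x + (1 - 2^-1 : R) *: m y.
  have h2 : (1 - 2^-1 : R) = 2^-1 by rewrite [X in X - _](splitr 1) mul1r addrK.
  have -> : 2^-1 *: m x + (1 - 2^-1) *: m y = 2^-1 *: (m z + m z).
    rewrite h2 -scalerDr; congr (_ *: _); apply/rowP => i.
    have := congr1 (fun t : T => t ord0 i) e; rewrite !mxE !ord1 => e'.
    by rewrite -!rmorphD /= e'.
  have E2 : m z + m z = (2 : R) *: m z by rewrite scaler_nat mulr2n.
  by rewrite E2 scalerA mulVf ?scale1r ?pnatr_eq0.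
have mxy : m x != m y.
  apply: contra nxy => /eqP E; apply/eqP/rowP => i.
  have := congr1 (fun t : 'rV[R]_d => t ord0 i) E; rewrite !mxE => /intr_inj.
  by rewrite !ord1.
have t01 : 0 < (2^-1 : R) < 1 by rewrite invr_gt0 ltr0n invf_lt1 ?ltr0n// ltr1n.
have := cU (m x) (m y) _ mxy t01; rewrite -mz -!VU => /(_ fx fy).
rewrite -[in X in X -> _](fineK fx) -[in X in X -> _](fineK fy).
have h2 : (1 - 2^-1 : R) = 2^-1 by rewrite [X in X - _](splitr 1) mul1r addrK.
rewrite h2 -!EFinM -EFinD; have := V_ge0 z.
case: (V z) => [r||]//= _; rewrite lte_fin => lt; split=> //; lra.
Qed.

Lemma step_mid x y z : stepD x -> stepD y -> z + z = x + y ->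
  stepD z /\ stepE z + stepE z <= stepE x + stepE y.
Proof.
move=> Dx Dy e; have e' : (z + v) + (z + v) = (x + v) + (y + v).
  by rewrite addrACA e addrACA.
have [fz le] := V_mid Dx Dy e'; split=> //.
by rewrite /stepE; move: le; lra.
Qed.

Definition jump_weight a y : R := fine (expeR (- (a%:E * Vv V v y))%E).

Lemma jump_weight_ge0 a y : 0 <= jump_weight a y.
Proof. by rewrite fine_ge0// expeR_ge0. Qed.

Lemma jump_weight0 a : jump_weight a 0 = 1.
Proof. by rewrite /jump_weight (VvE stepD0) stepE0 mule0 oppe0 expeR0. Qed.

Lemma jump_weight_in a y : stepD y -> jump_weight a y = expR (- (a * stepE y)).
Proof. by move=> Dy; rewrite /jump_weight VvE. Qed.

Lemma jump_weight_out a y : 0 < a -> ~ stepD y -> jump_weight a y = 0.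
Proof. by move=> a0 nD; rewrite /jump_weight Vvy// gt0_muley ?lte_fin. Qed.

(* In dimension 0 the temperature may be negative; the potential [Vv] then vanishes. *)
Lemma stepD_dim0 y : ~ (0 < d)%N -> stepD y.
Proof. by move=> nd; rewrite (site0_eq y 0 nd); exact: stepD0. Qed.

(** If one energy is infinite, both sides vanish because [a] is positive. *)
Lemma expe_add a (e S : \bar R) : e != -oo%E -> S != -oo%E ->
  (e = +oo%E \/ S = +oo%E -> 0 < a) ->
  (expeR (- (a%:E * (e + S))) = expeR (- (a%:E * e)) * expeR (- (a%:E * S)))%E.
Proof.
case: e => [e||]// _; case: S => [S||]// _ a0.
- by rewrite -EFinD /= -EFinM mulrDr opprD expRD.
- have a1 : 0 < a by apply: a0; right.
  by rewrite addey// gt0_muley ?lte_fin//= mule0.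
- have a1 : 0 < a by apply: a0; left.
  by rewrite addye// gt0_muley ?lte_fin//= mul0e.
- have a1 : 0 < a by apply: a0; left.
  by rewrite addye// gt0_muley ?lte_fin//= mul0e.
Qed.

Lemma Vv_neqNy y : Vv V v y != -oo%E.
Proof. by have [Dy|nD] := pselect (stepD y); [rewrite VvE|rewrite Vvy]. Qed.

Lemma expe_sum a (e : T -> \bar R) (l : seq T) (f : T -> T) :
  (forall y, e y != -oo%E) -> (forall y, e y = +oo%E -> 0 < a) ->
  (expeR (- (a%:E * \sum_(x <- l) e (f x))) =
   (\prod_(x <- l) fine (expeR (- (a%:E * e (f x)))))%:E)%E.
Proof.
move=> e1 hy.
have fin y : (expeR (- (a%:E * e y)) = (fine (expeR (- (a%:E * e y))))%:E)%E.
  have := hy y; case: (e y) (e1 y) => [r||]//= _ /(_ erefl) a0.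
  by rewrite gt0_muley ?lte_fin.
(* The induction also carries what [expe_add] asks of the remaining sum. *)
have H : ((\sum_(x <- l) e (f x))%E != -oo%E) /\
    ((\sum_(x <- l) e (f x))%E = +oo%E -> 0 < a) /\
    (expeR (- (a%:E * \sum_(x <- l) e (f x))) =
      (\prod_(x <- l) fine (expeR (- (a%:E * e (f x)))))%:E)%E.
  elim: l => [|x l [IH1 [IH2 IH3]]]; first by rewrite !big_nil mule0 oppe0 expeR0.
  rewrite !big_cons; split.
    by have := e1 (f x); case: (e _) IH1 {IH2 IH3} => [?||]; case: (\sum_(_ <- _) _)%E.
  have h : e (f x) = +oo%E \/ (\sum_(x <- l) e (f x))%E = +oo%E -> 0 < a.
    by move=> [/hy|/IH2].
  split; last by rewrite expe_add// fin IH3 EFinM.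
  move=> ey; apply: h; move: ey; case: (e _) => [?||]//=; last by left.
    by case: (\sum_(_ <- _) _)%E => //=; right.
by case: H => _ [].
Qed.

Lemma Vv_y_gt0 a y : ((0 < d)%N -> 0 < a) -> Vv V v y = +oo%E -> 0 < a.
Proof.
move=> ha e; apply: ha; apply: contrapT => nd.
by move: e; rewrite (VvE (stepD_dim0 y nd)).
Qed.

Lemma boltz_Vv a L s : ((0 < d)%N -> 0 < a) -> finite_set L ->
  boltz (Vv V v) a L s = (weight (jump_weight a) L s)%:E.
Proof.
move=> ha fL; rewrite /boltz /energy /weight !fsbig_finite//=.
exact: (expe_sum _ (fun x => s x - x) Vv_neqNy (fun y => Vv_y_gt0 ha)).
Qed.

(** The energies for [V] and [Vv V v] differ by [V v] per site; this constant factor cancels in the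
    specifications. *)
Definition base_weight a (L : set T) : R := \big[*%R/1]_(x \in L) expR (- (a * fine (V v))).

Lemma base_weight_gt0 a L : 0 < base_weight a L.
Proof.
by rewrite /base_weight; elim/big_ind: _ => // [x y|x _]; [exact: mulr_gt0|exact: expR_gt0].
Qed.

Lemma boltz_tau a L s : ((0 < d)%N -> 0 < a) -> finite_set L ->
  boltz V a L (tau v \o s) = (weight (jump_weight a) L s * base_weight a L)%:E.
Proof.
move=> ha fL; rewrite /boltz /energy /weight /base_weight !fsbig_finite//=.
pose e y := V (y + v).
have e1 y : e y != -oo%E by rewrite /e; have := V_ge0 (y + v); case: (V _).
have ey y : e y = +oo%E -> 0 < a.
  move=> h; apply: (Vv_y_gt0 (y := y) ha); apply: Vvy.
  by rewrite /stepD /= -/(e y) h.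
rewrite -big_split /=.
have -> : (\sum_(x <- finmap.enum_fset (fset_set L)) V (tau v (s x) - x)%R)%E =
    (\sum_(x <- finmap.enum_fset (fset_set L)) e (s x - x)%R)%E.
  by apply: eq_bigr => x _; rewrite /e /tau addrAC.
rewrite (expe_sum _ _ e1 ey); congr EFin; apply: eq_bigr => x _.
have [Dy|nDy] := pselect (stepD (s x - x)).
  rewrite jump_weight_in// -expRD; move: (Dy); rewrite /stepD /= /e => f1.
  rewrite -(fineK f1) /= /stepE; congr expR; lra.
have h : e (s x - x) = +oo%E.
  by move: nDy (e1 (s x - x)); rewrite /stepD /e /=; case: (V _).
by rewrite h gt0_muley ?lte_fin ?(ey _ h)// jump_weight_out ?(ey _ h)// mul0r.
Qed.

Lemma next_neq o x : uniq o -> (2 <= size o)%N -> x \in o -> next o x != x.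
Proof.
move=> u o2 xo; have [i t Et] := rot_to xo.
have u' : uniq (x :: t) by rewrite -Et rot_uniq.
rewrite -(next_rot i u) Et; case: t Et u' => [|y t] Et /=.
  by have := size_rot i o; rewrite Et /= => e; rewrite -e in o2.
by rewrite inE negb_or => /andP [/andP [xy _] _]; rewrite eqxx eq_sym.
Qed.

Lemma supp_next o : uniq o -> (2 <= size o)%N -> supp (next o) = [set` o].
Proof.
move=> u o2; apply/seteqP; split=> x; rewrite /supp /=; last exact: next_neq.
by apply: contraLR => /next_out ->; rewrite negbK.
Qed.

Lemma next_bij : set_bij (@Cyc2 d) (@Gamma d `&` [set g | g 0 != 0]) (fun o => next o).
Proof.
split.
- move=> o [[u [t E]] o2]; split; first by exists o.
  by apply: next_neq => //; rewrite E mem_head.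
- move=> o o'; rewrite !inE => -[Co _] [Co' _] e.
  apply: (cyc_uniq Co Co' (s := next o)) => //.
  by move=> y yo; rewrite e.
- move=> g [[c [u c2 ->]] /= g0]; have c0 : 0 \in c.
    by apply: contraNT g0 => /next_out ->.
  have [i t Et] := rot_to c0; exists (0 :: t); last by rewrite -Et; apply/funext => x; rewrite next_rot.
  by split; [split; [rewrite -Et rot_uniq|exists t]|change (is_true (2 <= size ((0%R : T) :: t))%N); rewrite -Et size_rot].
Qed.

Lemma wv_next a o : ((0 < d)%N -> 0 < a) -> uniq o -> (2 <= size o)%N ->
  wv V v a (next o) = (cyc_weight (jump_weight a) o)%:E.
Proof.
move=> ha u o2; rewrite /wv supp_next// /cyc_weight /weight -!fsbig_seq//.
rewrite -(expe_sum _ (fun x => next o x - x) Vv_neqNy (fun y => Vv_y_gt0 ha)); congr (expeR (- (_ * _)))%E.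
by apply: eq_bigr => x _; rewrite /Vv addrAC.
Qed.

Lemma cyc_len_next o : uniq o -> (2 <= size o)%N -> cyc_len (next o) = size o.
Proof. by move=> u o2; rewrite /cyc_len supp_next// -fsbig_seq// sum1_size. Qed.

Lemma betaE a : ((0 < d)%N -> 0 < a) ->
  beta V v a = (\esum_(o in Cyc2 (d:=d)) ((size o)%:R * cyc_weight (jump_weight a) o)%:E)%E.
Proof.
move=> ha; rewrite /beta (reindex_esum _ _ _ _ next_bij).
apply: eq_esum => o [[u _] o2]; rewrite wv_next// cyc_len_next//.
Qed.

Definition unit_site (d0 : (0 < d)%N) : T := \row_i (i == Ordinal d0)%:R.

(** The transposition of 0 and a unit vector has nonnegative energy, by convexity at the midpoint
    [v]. For a <= 0 its weight is at least 1, and so is [beta]. *)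
Lemma beta_lt1_gt0 a : (0 < d)%N -> (beta V v a < 1)%E -> 0 < a.
Proof.
move=> d0; rewrite ltNge => b1; rewrite ltNge; apply/negP => a0; move/negP: b1; apply.
pose e := unit_site d0; have e0 : e != 0.
  apply/eqP => /rowP /(_ (Ordinal d0)); rewrite !mxE eqxx => h.
  by have : (1 : int) == 0 by rewrite -h.
pose o := [:: 0; e]; have uo : uniq o by rewrite /= inE eq_sym e0.
have Go : (@Gamma d `&` [set g | g 0 != 0]) (next o).
  split; first by exists o.
  by apply: next_neq => //; rewrite mem_head.
have n0 : next o 0 = e by rewrite /o /= eqxx.
have ne : next o e = 0 by rewrite /o /= ?[0 == e]eq_sym (negPf e0) ?eqxx.
have S0 : (0 <= \sum_(x \in supp (next o)) (V (next o x + v - x)%R - V v))%E.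
  have -> : (\sum_(x \in supp (next o)) (V (next o x + v - x)%R - V v))%E =
      (\sum_(x <- o) (V (next o x + v - x)%R - V v))%E.
    by rewrite supp_next// -fsbig_seq.
  rewrite {2}/o big_cons big_seq1 n0 ne subr0 add0r [v - e]addrC.
  rewrite -/(Vv V v e) -/(Vv V v (- e)).
  have [De|nDe] := pselect (stepD e); last by rewrite (Vvy nDe) addye ?leey// Vv_neqNy.
  have [De'|nDe'] := pselect (stepD (- e)); last by rewrite (Vvy nDe') addey ?leey// Vv_neqNy.
  rewrite !VvE// -EFinD lee_fin.
  have ee : 0 + 0 = e - e by rewrite subrr addr0.
  have [_] := step_mid De De' ee; rewrite stepE0; lra.
have wv1 : (1 <= wv V v a (next o))%E.
  rewrite /wv -expeR0 lee_expeR; move: S0; case: (\sum_(_ \in _) _)%E => [r||]//= S0.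
    by rewrite lee_fin -mulNr mulr_ge0// oppr_ge0.
  have [->|an0] := eqVneq a 0; first by rewrite mul0e oppe0.
  by rewrite lt0_muley ?lte_fin ?lt_neqAle ?an0//= leey.
apply: (@le_trans _ _ ((cyc_len (next o))%:R%:E * wv V v a (next o))%E).
  rewrite cyc_len_next//= -[X in (X <= _)%E]mul1e; apply: lee_pmul => //.
  by rewrite lee_fin ler1n.
rewrite -[X in (X <= _)%E](@esum_set1 _ _ (next o) (fun g => ((cyc_len g)%:R%:E * wv V v a g)%E)).
  apply: esum_subset; first by move=> _ ->.
  by move=> g; rewrite mule_ge0 ?lee_fin ?expeR_ge0.
by rewrite mule_ge0 ?lee_fin ?expeR_ge0.
Qed.

End Potential.

Lemma ge0_integral_esum (R : realType) (dO : measure_display) (O : measurableType dO)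
    (mu : measure O R) (I : countType) (D : set I) (f : I -> O -> \bar R) :
  (forall i, measurable_fun setT (f i)) -> (forall i x, (0 <= f i x)%E) ->
  (\int[mu]_x (\esum_(i in D) f i x) = \esum_(i in D) (\int[mu]_x f i x))%E.
Proof.
move=> mf f0; rewrite esum_pickle; last by move=> i; apply: integral_ge0 => x _.
under eq_integral do rewrite esum_pickle//.
rewrite integral_nneseries//.
- apply: eq_eseriesr => k _; case: pickle_inv => [i|]; last by rewrite integral0.
  by case: ifP => // _; rewrite integral0.
- move=> k; case: pickle_inv => [i|]; last exact: measurable_cst.
  by case: (i \in D) => //; exact: measurable_cst.
- by move=> k x _; case: pickle_inv => // i; case: ifP.
Qed.

(** * Integrability of the jump *)

Section Integrability.
Variables (R : realType) (d : nat) (v : site d) (V : site d -> \bar R).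
Local Notation T := (site d).
Local Notation PS := (PermSp d).
Local Notation FC := (@finite_cycle d).
Implicit Types (x y z : T) (o l : seq T) (a : R).
Hypotheses (V_ge0 : forall z, (0 <= V z)%E) (V_sconv : strictly_convex V).
Hypothesis Vv_fin : V v \is a fin_num.
Local Notation q := (jump_weight v V).
Local Notation D := (stepD v V).
Local Notation h := (stepE v V).
Variables (a1 a : R).
Hypotheses (d_gt0 : (0 < d)%N) (a1_a : a1 < a) (beta1 : (beta V v a1 < 1)%E).

Let a1_gt0 : 0 < a1. Proof. exact: (beta_lt1_gt0 V_ge0 V_sconv Vv_fin d_gt0 beta1). Qed.
Let a_gt0 : 0 < a. Proof. exact: lt_trans a1_a. Qed.

Lemma w_prod c o : uniq o -> cyc_weight (q c) o = \prod_(z <- steps o) q c z.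
Proof. by move=> u; rewrite /cyc_weight /weight -fsbig_seq// /steps big_map. Qed.

Lemma w_in c o : uniq o -> inD D (steps o) -> cyc_weight (q c) o = expR (- (c * cost h (steps o))).
Proof.
move=> u Do; rewrite w_prod// /cost mulr_sumr -sumrN expR_sum big_seq [RHS]big_seq.
by apply: eq_bigr => z zo; rewrite jump_weight_in//; exact: Do.
Qed.

Lemma w_out c o : 0 < c -> uniq o -> ~ inD D (steps o) -> cyc_weight (q c) o = 0.
Proof.
move=> c0 u nDo; have [z zo nDz] : exists2 z, z \in steps o & ~ D z.
  by apply: contrapT => no; apply: nDo => z zo; apply: contrapT => nDz; apply: no; exists z.
rewrite w_prod// (perm_big _ (perm_to_rem zo)) big_cons jump_weight_out// ?mul0r//.
exact: mul0r.
Qed.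

Let sum1 : (\esum_(o in Cyc2 (d:=d)) ((size o)%:R * cyc_weight (q a1) o)%:E < 1)%E.
Proof. by rewrite -(betaE V_ge0 Vv_fin). Qed.

Let term_ge0 c o : (0 <= ((size o)%:R * cyc_weight (q c) o)%:E)%E.
Proof. by rewrite lee_fin mulr_ge0// w_ge0//; exact: jump_weight_ge0. Qed.

Lemma size_w_lt1 o : Cyc2 o -> (size o)%:R * cyc_weight (q a1) o < 1.
Proof.
move=> Co; rewrite -lte_fin; apply: le_lt_trans sum1; apply: esum_ge; exists [set o].
  by split; [exact: finite_set1|move=> _ ->].
by rewrite fsbig_set1.
Qed.

(** A negative cost would give this cycle alone a weight above 1, more than the whole sum at
    [a1]. *)
Lemma cycle_cost_ge0 o : Cyc2 o -> inD D (steps o) -> 0 <= cost h (steps o).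
Proof.
move=> Co Do; have := size_w_lt1 Co; have [[u _] o2] := Co; rewrite w_in// => lt1.
have : expR (- (a1 * cost h (steps o))) < 1.
  apply: le_lt_trans lt1; rewrite ler_peMl ?expR_ge0// ler1n.
  exact: leq_trans o2.
by rewrite expR_lt1 oppr_lt0 pmulr_rgt0// => /ltW.
Qed.

Lemma w_mono o : Cyc2 o -> cyc_weight (q a) o <= cyc_weight (q a1) o.
Proof.
move=> Co; have [[u _] o2] := Co; have [Do|nDo] := pselect (inD D (steps o)).
  rewrite !w_in// ler_expR lerN2 ler_wpM2r//; first exact: cycle_cost_ge0.
  exact: ltW.
by rewrite !w_out.
Qed.

Lemma sum_size_w : exists2 b : R, b < 1 &
  (\esum_(o in Cyc2 (d:=d)) ((size o)%:R * cyc_weight (q a) o)%:E <= b%:E)%E.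
Proof.
set S := (\esum_(o in Cyc2 (d:=d)) ((size o)%:R * cyc_weight (q a1) o)%:E)%E.
have S0 : (0 <= S)%E by exact: esum_ge0.
have Sf : S \is a fin_num by rewrite ge0_fin_numE// (lt_trans sum1)// ltry.
exists (fine S); first by rewrite -lte_fin fineK.
rewrite fineK//; apply: le_esum => o Co; rewrite lee_fin ler_wpM2l//; exact: w_mono.
Qed.

(** Each of these cycles contributes at least [2 * expR (- (a1 * c))] to a convergent sum, so none
    is left in a tail of at most [expR (- (a1 * c))]. *)
Lemma finite_cost_level c :
  finite_set [set o | Cyc2 o /\ inD D (steps o) /\ cost h (steps o) <= c].
Proof.
have t0 := term_ge0 a1.
have S0 : (0 <= \esum_(o in Cyc2 (d:=d)) ((size o)%:R * cyc_weight (q a1) o)%:E)%E by exact: esum_ge0.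
have Sf : (\esum_(o in Cyc2 (d:=d)) ((size o)%:R * cyc_weight (q a1) o)%:E)%E \is a fin_num.
  by rewrite ge0_fin_numE// (lt_trans sum1)// ltry.
have e0 : 0 < expR (- (a1 * c)) by exact: expR_gt0.
have [F [fF FC tail]] := esum_tail t0 Sf e0.
apply: (sub_finite_set _ fF) => o [Co [Do co]]; apply: contrapT => nFo.
have [[u _] o2] := Co.
have : (((size o)%:R * cyc_weight (q a1) o)%:E <= (expR (- (a1 * c)))%:E)%E.
  apply: le_trans tail; apply: esum_ge; exists [set o]; last by rewrite fsbig_set1.
  by split; [exact: finite_set1|move=> _ ->].
rewrite lee_fin w_in// leNgt => /negP; apply.
apply: (@lt_le_trans _ _ (2 * expR (- (a1 * cost h (steps o))))); last first.
  by rewrite ler_wpM2r ?expR_ge0// ler_nat.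
apply: (@le_lt_trans _ _ (expR (- (a1 * cost h (steps o))))).
  by rewrite ler_expR lerN2 ler_wpM2l// (ltW a1_gt0).
by have := expR_gt0 (- (a1 * cost h (steps o))); lra.
Qed.

(** The weights at [a] and [a1] differ by the factor exp (- k), k being [a - a1] times the cost c.
    It absorbs the linear bound, since c + 1 <= (1 / (a - a1) + 1) (1 + k) and 1 + k <= exp k. *)
Lemma next_weight_bound : exists2 K : R, 0 <= K &
  forall o, Cyc2 o -> nrm R (next o 0) * cyc_weight (q a) o <= K * cyc_weight (q a1) o.
Proof.
have [K K0 HK] := linear_bound (stepE0 v V) cycle_cost_ge0 (step_mid V_ge0 V_sconv)
  finite_cost_level.
have e0 : 0 < a - a1 by rewrite subr_gt0.
exists (K * ((a - a1)^-1 + 1)); first by rewrite mulr_ge0// addr_ge0// invr_ge0 ltW.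
move=> o Co; have [[u _] o2] := Co; have [Do|nDo] := pselect (inD D (steps o)); last first.
  by rewrite !w_out// !mulr0.
rewrite !w_in//; have c0 := cycle_cost_ge0 Co Do; move: (cost h (steps o)) c0 (HK _ Co Do) => c c0 Hc.
have -> : expR (- (a * c)) = expR (- ((a - a1) * c)) * expR (- (a1 * c)).
  by rewrite -expRD; congr expR; lra.
rewrite mulrA; apply: ler_wpM2r; first exact: expR_ge0.
apply: (@le_trans _ _ (K * (c + 1) * expR (- ((a - a1) * c)))).
  by rewrite ler_wpM2r ?expR_ge0.
rewrite -mulrA ler_wpM2l// expRN ler_pdivrMr ?expR_gt0//.
have := expR_ge1Dx ((a - a1) * c); set E := expR _ => hE.
have i0 : 0 < (a - a1)^-1 by rewrite invr_gt0.
have -> : c + 1 = (a - a1)^-1 * ((a - a1) * c) + 1 by rewrite mulrA mulVf ?mul1r// gt_eqF.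
have ec : 0 <= (a - a1) * c by rewrite mulr_ge0// ltW.
move: ((a - a1)^-1) ((a - a1) * c) i0 ec hE => r k i0 ec hE; nra.
Qed.

Let sumw1 : (\esum_(o in Cyc2 (d:=d)) (cyc_weight (q a1) o)%:E <= 1)%E.
Proof.
apply: le_trans (ltW sum1); apply: le_esum => o [_ o2].
rewrite lee_fin ler_peMl ?ler1n ?w_ge0//; last exact: ltnW.
exact: jump_weight_ge0.
Qed.

Variable nu : probability PS R.
Hypothesis C : cycle_law (q a) nu.

Lemma follows_Cy o : follows o = Cy [set` o] (next o) :> set (pfun d).
Proof. by apply/seteqP; split. Qed.

Lemma measurable_follows o : measurable (follows o : set PS).
Proof. by rewrite follows_Cy; exact: measurable_Cy. Qed.

Lemma nu_follows o : uniq o -> (nu (follows o) <= (cyc_weight (q a) o)%:E)%E.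
Proof.
move=> u; have [_ nC] := C; rewrite follows_Cy nC//; last 2 first.
- exact: fc_next.
- by move=> x xo; rewrite /= mem_next.
rewrite -/(cyc_weight (q a) o) -[X in (_ <= X)%E]mule1; apply: lee_pmul => //.
  by rewrite lee_fin w_ge0//; exact: jump_weight_ge0.
by apply: probability_le1; exact: measurable_Cy.
Qed.

Lemma measurable_site_fun (x : T) (f : T -> R) : measurable_fun setT ((fun s => f (s x)) : PS -> R).
Proof.
move=> _ Y mY; rewrite setTI.
rewrite (_ : _ @^-1` _ = [set s | exists z : T, ([set _ | Y (f z)] `&` [set s : PS | s x = z]) s]).
  apply: measurable_exists => z; apply: measurableI; first exact: measurable_prop.
  exact: measurable_coord.
by apply/seteqP; split=> s /=; [exists (s x)|move=> [z [Yz e]]; rewrite e].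
Qed.

(** The jump is split according to the cycle through 0, whose probability is at most its weight; it
    vanishes when 0 is fixed. *)
Lemma jump_integrable i : nu.-integrable setT (EFin \o jump R i).
Proof.
have [n1 nC] := C; have mF := @measurable_finite_cycle d.
have mJ : measurable_fun setT (EFin \o jump R i : PS -> \bar R).
  by apply/measurable_EFinP; exact: (measurable_site_fun 0 (fun z => (z ord0 i)%:~R)).
apply/integrableP; split=> //.
pose f o (s : PS) : \bar R := ((nrm R (next o 0))%:E * (\1_(follows o : set PS) s)%:E)%E.
have f0 o s : (0 <= f o s)%E.
  by rewrite /f mule_ge0// lee_fin ?nrm_ge0// indicE.
have mf o : measurable_fun setT (f o).
  apply: emeasurable_funM; first exact: measurable_cst.
  by apply/measurable_EFinP; apply: measurable_indic; exact: measurable_follows.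
have -> : (\int[nu]_s `|(EFin \o jump R i) s| =
    \int[nu]_s (`|(EFin \o jump R i) s| * (\1_FC s)%:E))%E.
  apply: ae_eq_integral => //; first exact: measurableT_comp.
    apply: emeasurable_funM; first exact: measurableT_comp.
    by apply/measurable_EFinP; exact: measurable_indic.
  exists (~` FC); split; [exact: measurableC|exact: prob_FC_null|].
  move=> s /= hs; apply: contrapT => /contrapT fs; apply: hs => _.
  by rewrite indicE mem_set// mule1.
apply: (@le_lt_trans _ _ (\int[nu]_s \esum_(o in Cyc2 (d:=d)) f o s)%E).
  apply: ge0_le_integral => //.
  - apply: emeasurable_funM; first exact: measurableT_comp.
    by apply/measurable_EFinP; exact: measurable_indic.
  - exact: measurable_fun_esum.
  - move=> s _; rewrite indicE; have [fs|nfs] := pselect (FC s); last first.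
      by rewrite memNset// mule0; exact: esum_ge0.
    rewrite mem_set// mule1; have [Co fo] := cycP 0 fs.
    have s0 : s 0 = next (cyc s 0) 0 by apply: fo; exact: Cyc_head Co.
    have [ o2|no2] := pselect (Cyc2 (cyc s 0)); last first.
      have : (Cyc 0 `&` ~` [set o | (2 <= size o)%N]) (cyc s 0) by split=> // o2; apply: no2.
      rewrite Cyc1 => e; rewrite /= /jump s0 e /= eqxx mxE normr0.
      exact: esum_ge0.
    apply: esum_ge; exists [set cyc s 0]; first by split; [exact: finite_set1|move=> _ ->].
    rewrite fsbig_set1 /f indicE mem_set// mule1 /= lee_fin /jump s0 /nrm (bigD1 i)//= lerDl.
    by apply: sumr_ge0.
rewrite ge0_integral_esum//; have [K K0 HK] := next_weight_bound.
apply: (@le_lt_trans _ _ (\esum_(o in Cyc2 (d:=d)) (K%:E * (cyc_weight (q a1) o)%:E))%E).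
  apply: le_esum => o Co; have [[u _] _] := Co.
  rewrite ge0_integralZl//; last 2 first.
  - by apply/measurable_EFinP; apply: measurable_indic; exact: measurable_follows.
  - by rewrite lee_fin nrm_ge0.
  rewrite integral_indic ?setIT//; last exact: measurable_follows.
  apply: (@le_trans _ _ ((nrm R (next o 0))%:E * (cyc_weight (q a) o)%:E)%E).
    by apply: lee_wpmul2l; [rewrite lee_fin nrm_ge0|exact: nu_follows].
  by rewrite -!EFinM lee_fin; exact: HK.
rewrite esum_mulr//; last by move=> o; rewrite lee_fin w_ge0//; exact: jump_weight_ge0.
apply: (@le_lt_trans _ _ (K%:E * 1)%E); first by apply: lee_wpmul2l; rewrite ?lee_fin.
by rewrite mule1 ltry.
Qed.

End Integrability.

(** * Conjugation by a translation *)

Section IntegralLaw.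
Context {dO dY : measure_display} {O : measurableType dO} {Y : measurableType dY}.
Context {R : realType}.
Variables (nu : measure O R) (mu : measure Y R) (X : O -> Y).
Hypothesis mX : measurable_fun setT X.
Hypothesis muE : forall A, measurable A -> mu A = nu (X @^-1` A).

Let lawE B (f : Y -> \bar R) :
  (\int[mu]_(y in B) f y = \int[pushforward nu X]_(y in B) f y)%E.
Proof. by apply: eq_measure_integral => C mC _; exact: muE. Qed.

Lemma ge0_integral_law B (f : Y -> \bar R) : measurable B -> measurable_fun B f ->
  (forall y, 0 <= f y)%E -> (\int[mu]_(y in B) f y = \int[nu]_(x in X @^-1` B) f (X x))%E.
Proof. by move=> mB mf f0; rewrite lawE ge0_integral_pushforward. Qed.

Lemma integrable_law B (f : Y -> \bar R) : measurable B -> measurable_fun B f ->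
  nu.-integrable (X @^-1` B) (f \o X) -> mu.-integrable B f.
Proof.
move=> mB mf /integrableP [_ fi]; apply/integrableP; split=> //.
have -> : (\int[mu]_(y in B) `|f y| = \int[nu]_(x in X @^-1` B) `|f (X x)|)%E; last exact: fi.
by apply: ge0_integral_law => //; exact: measurableT_comp.
Qed.

Lemma integral_law B (f : Y -> \bar R) : measurable B -> measurable_fun setT f ->
  nu.-integrable (X @^-1` B) (f \o X) ->
  (\int[mu]_(y in B) f y = \int[nu]_(x in X @^-1` B) f (X x))%E.
Proof. by move=> mB mf fi; rewrite lawE integral_pushforward. Qed.

End IntegralLaw.

Section Transfer.
Variables (R : realType) (d : nat) (v : site d) (V : site d -> \bar R).
Local Notation T := (site d).
Local Notation PS := (PermSp d).
Local Notation FC := (@finite_cycle d).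
Implicit Types (x y z u : T) (L : set T) (s xi : pfun d).
Hypotheses (V_ge0 : forall z, (0 <= V z)%E) (V_sconv : strictly_convex V).
Hypothesis Vv_fin : V v \is a fin_num.
Variable a : R.
Hypothesis ha : (0 < d)%N -> 0 < a.
Local Notation p := (jump_weight v V a).

Definition tauc u : pfun d -> pfun d := fun s => tau u \o s.

Lemma taucK u : cancel (tauc u) (tauc (- u)).
Proof. by move=> s; apply/funext => x; rewrite /tauc /tau /= addrK. Qed.

Lemma taucNK u : cancel (tauc (- u)) (tauc u).
Proof. by move=> s; apply/funext => x; rewrite /tauc /tau /= subrK. Qed.

Lemma bijective_tau u : bijective (tau u : pfun d).
Proof. by exists (tau (- u)) => x; rewrite /tau ?addrK ?subrK. Qed.

Lemma bijective_tauc u s : bijective s -> bijective (tauc u s).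
Proof. by move=> bs; apply: bij_comp bs; exact: bijective_tau. Qed.

Lemma Sbij_tauc u : tauc u @^-1` @Sbij d = @Sbij d.
Proof.
apply/seteqP; split=> s; last exact: bijective_tauc.
by move=> /(bijective_tauc (- u)); rewrite taucK.
Qed.

Lemma S_cond_tauc u L xi s : S_cond L (tauc u xi) (tauc u s) <-> S_cond L xi s.
Proof.
split=> -[bs h]; split.
- by have := bijective_tauc (- u) bs; rewrite taucK.
- by move=> x nL; have := h x nL; rewrite /tauc /tau /= => /addIr.
- exact: bijective_tauc.
- by move=> x nL; rewrite /tauc /= h.
Qed.

Lemma tauc_bij u L xi (A : set (pfun d)) :
  set_bij (S_cond L xi `&` tauc u @^-1` A) (S_cond L (tauc u xi) `&` A) (tauc u).
Proof.
split.
- by move=> s [Ss As]; split=> //; exact/S_cond_tauc.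
- by move=> s t _ _; exact: (can_inj (taucK u)).
- move=> s [Ss As]; exists (tauc (- u) s); last exact: taucNK.
  by split; [apply/(S_cond_tauc u); rewrite taucNK|rewrite /= taucNK].
Qed.

Lemma partfun_tau L xi : finite_set L ->
  partfun V a L (tauc v xi) = (pf p L xi * base_weight v V a L)%:E.
Proof.
move=> fL; rewrite /partfun -[S_cond L (tauc v xi)]setIT.
rewrite (reindex_esum _ _ _ _ (tauc_bij v L xi setT)) setIT.
rewrite mulrC EFinM -(pfE (jump_weight_ge0 v V a) xi fL) -esum_mulr; last 2 first.
- exact/ltW/base_weight_gt0.
- by move=> s; rewrite lee_fin W_ge0//; exact: jump_weight_ge0.
by apply: eq_esum => s _; rewrite (boltz_tau V_ge0 Vv_fin)// mulrC EFinM.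
Qed.

Lemma spec_tau L xi s : finite_set L ->
  spec V a L (tauc v xi) (tauc v s) = spec (Vv V v) a L xi s.
Proof.
move=> fL; rewrite [RHS](specE (fun L s => boltz_Vv V_ge0 Vv_fin s ha))//.
rewrite /spec partfun_tau// (boltz_tau V_ge0 Vv_fin)//=.
have -> : (tauc v s \in S_cond L (tauc v xi)) = (s \in S_cond L xi).
  by apply/idP/idP; rewrite !inE => /S_cond_tauc.
have k0 := gt_eqF (base_weight_gt0 v V a L).
by case: ifP => // _; rewrite invfM mulrACA divff ?mulr1// k0.
Qed.

Lemma specA_tau L xi (A : set PS) : finite_set L ->
  specA V a L (tauc v xi) A = specA (Vv V v) a L xi (tauc v @^-1` A).
Proof.
move=> fL; rewrite /specA (reindex_esum _ _ _ _ (tauc_bij v L xi A)).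
by apply: eq_esum => s _; rewrite spec_tau.
Qed.

Lemma measurable_tauc u : measurable_fun setT (tauc u : PS -> PS).
Proof.
apply: perm_measurable => x y; rewrite (_ : [set s | _] = [set s : PS | s x = y - u]).
  exact: measurable_coord.
apply/seteqP; split=> s /=; rewrite /tauc /tau /= => h; first by rewrite -h addrK.
by rewrite h subrK.
Qed.

Lemma tauc_pre_measurable u (A : set PS) : measurable A -> measurable (tauc u @^-1` A : set PS).
Proof. by move=> mA; rewrite -[X in measurable X]setTI; exact: measurable_tauc. Qed.

(** Left composition changes values and not sites, so dependence on the sites of [L] is
    preserved. *)
Lemma tauc_cyl u L (B : set PS) : <<s cyl L >> B -> <<s cyl L >> (tauc u @^-1` B : set PS).
Proof.
suff : <<s cyl L >> `<=` [set B : set PS | <<s cyl L >> (tauc u @^-1` B : set PS)] by exact.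
apply: smallest_sub.
  split=> /=.
  - by rewrite preimage_set0; exact: sigma_algebra0.
  - by move=> A mA; rewrite setTD preimage_setC -setTD; exact: sigma_algebraCD.
  - by move=> F mF; rewrite preimage_bigcup; exact: sigma_algebra_bigcup.
move=> _ [x [y [Lx ->]]] /=; apply: sub_gen_smallest; exists x, (y - u); split=> //.
apply/seteqP; split=> s /=; rewrite /tauc /tau /= => h; first by rewrite -h addrK.
by rewrite h subrK.
Qed.

Variables (nu0 mu : probability PS R).
Hypothesis muE : forall A : set PS, mu A = nu0 (tauc v @^-1` A).

Lemma gibbs_tau : gibbs (Vv V v) a nu0 -> gibbs V a mu.
Proof.
move=> [n1 G]; split; first by rewrite muE Sbij_tauc.
move=> L fL A mA B mB.
have mB' : measurable (B : set PS).
  move: mB; apply: sub_smallest2r; first exact: smallest_sigma_algebra.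
  by move=> _ [x [y [_ ->]]]; exists x, y.
have mSv (C : set PS) : measurable C -> measurable_fun setT (fun xi : PS => specA (Vv V v) a L xi C).
  move=> mC; apply: (measurable_specA (jump_weight_ge0 v V a)) => // L' s fL'.
  exact: (boltz_Vv V_ge0 Vv_fin).
have mS : measurable_fun setT (fun xi : PS => specA V a L xi A).
  rewrite (_ : (fun xi => _) = (fun xi => specA (Vv V v) a L xi (tauc v @^-1` A)) \o tauc (- v)).
    exact: (@measurableT_comp _ _ _ _ _ _ (fun xi : PS => specA (Vv V v) a L xi (tauc v @^-1` A)) setT
      (tauc (- v) : PS -> PS) (mSv _ (tauc_pre_measurable v mA)) (measurable_tauc (- v))).
  by apply/funext => xi /=; rewrite -specA_tau// taucNK.
rewrite muE preimage_setI (G L fL _ (tauc_pre_measurable v mA) _ (tauc_cyl v mB)).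
have S0 xi : (0 <= specA V a L xi A)%E.
  apply: esum_ge0 => s _; rewrite lee_fin /spec; case: ifP => // _.
  by rewrite divr_ge0// fine_ge0 ?expeR_ge0// esum_ge0// => t _; exact: expeR_ge0.
apply: (etrans _ (esym (ge0_integral_law (measurable_tauc v) (fun A _ => muE A) mB' (measurable_funTS mS) S0))).
by apply: eq_integral => xi _; rewrite specA_tau.
Qed.

Lemma tauc_shiftp u u' s : tauc u (shiftp u' s) = shiftp u' (tauc u s).
Proof. by apply/funext => x; rewrite /tauc /tau /shiftp /= addrAC. Qed.

Lemma ergodic_tau : ergodic nu0 -> ergodic mu.
Proof.
move=> [inv erg]; split=> [u A mA|A mA invA].
  rewrite !muE -(inv u _ (tauc_pre_measurable v mA)).
  by congr (nu0 _); apply/seteqP; split=> s; rewrite /preimage /= tauc_shiftp.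
rewrite muE; apply: erg; first exact: tauc_pre_measurable.
move=> u; rewrite -[in RHS](invA u).
by apply/seteqP; split=> s; rewrite /preimage /= tauc_shiftp.
Qed.

Lemma mean_jump_tau : (forall i, nu0.-integrable setT (EFin \o jump R i)) ->
  (forall i, \int[nu0]_s (jump R i s)%:E = 0)%E -> mean_jump mu v.
Proof.
move=> iJ J0 i.
pose f (s : PS) : \bar R := (((s 0 - 0) ord0 i)%:~R : R)%:E.
have mf : measurable_fun setT f.
  apply/measurable_EFinP.
  exact: (measurable_site_fun 0 (fun z => ((z - 0) ord0 i)%:~R)).
have E s : f (tauc v s) = ((EFin \o jump R i) s + (EFin \o cst ((v ord0 i)%:~R)) s)%E.
  by rewrite /f /tauc /tau /= subr0 -EFinD mxE rmorphD.
have iv : nu0.-integrable setT (EFin \o cst ((v ord0 i)%:~R : R)).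
  exact: finite_measure_integrable_cst.
have ifv : nu0.-integrable setT (f \o tauc v).
  rewrite (_ : f \o tauc v = (EFin \o jump R i) \+ (EFin \o cst ((v ord0 i)%:~R)))%E.
    exact: integrableD.
  by apply/funext => s; exact: E.
have muE' (A : set PS) : measurable A -> mu A = nu0 (tauc v @^-1` A) by move=> _; exact: muE.
have mt := measurable_tauc v.
split; first exact: (integrable_law mt muE' measurableT mf ifv).
apply: (etrans (integral_law mt muE' measurableT mf ifv)); rewrite preimage_setT.
have -> : (\int[nu0]_s f (tauc v s) = \int[nu0]_s ((jump R i s)%:E + (cst ((v ord0 i)%:~R) s)%:E))%E.
  by apply: eq_integral => s _; exact: E.
have J0' : (\int[nu0]_s (EFin \o jump R i) s = 0)%E by exact: J0.
have c1 : (\int[nu0]_s (EFin \o cst ((v ord0 i)%:~R : R)) s = ((v ord0 i)%:~R)%:E)%E.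
  apply: (etrans (integral_cst nu0 measurableT ((v ord0 i)%:~R : R)%:E)).
  exact: (etrans (congr1 (mule _) (probability_setT nu0)) (mule1 _)).
by apply: (etrans (integralD measurableT (iJ i) iv)); rewrite J0' c1 add0e.
Qed.

End Transfer.

(** * The translated family and its limit law *)

Section Assembly.
Variables (R : realType) (d : nat) (v : site d) (V : site d -> \bar R).
Local Notation T := (site d).
Local Notation PS := (PermSp d).
Local Notation FC := (@finite_cycle d).
Implicit Types (x : T) (L : set T) (s : pfun d) (u : R).
Hypotheses (V_ge0 : forall z, (0 <= V z)%E) (V_sconv : strictly_convex V).
Hypothesis Vv_fin : V v \is a fin_num.
Variable a : R.
Hypothesis ha : (0 < d)%N -> 0 < a.
Local Notation p := (jump_weight v V a).
Let p_ge0 := jump_weight_ge0 v V a.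
Let p0 := jump_weight0 Vv_fin a.
Variable b : R.
Hypothesis b_lt1 : b < 1.
Hypothesis Hb : (\esum_(o in Cyc2 (d:=d)) ((size o)%:R * cyc_weight p o)%:E <= b%:E)%E.
Local Notation O := (measurableTypeR R).
Local Notation zeta := (zeta p).
Let zFC L u : finite_cycle (zeta L u) := zeta_finite_cycle p_ge0 p0 b_lt1 Hb L u.

Lemma spec_id L s : finite_set L ->
  spec V a L (tau v) (tauc v s) = if s \in S_of L then weight p L s / partZ p L else 0.
Proof.
move=> fL; rewrite -[tau v]/(tauc v id) (spec_tau V_ge0 Vv_fin ha)//.
by rewrite (specE (fun L s => boltz_Vv V_ge0 Vv_fin s ha)).
Qed.

Lemma law_tau_zeta L s : finite_set L ->
  unitP [set u : O | tau v \o zeta L u = s] = (spec V a L (tau v) s)%:E.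
Proof.
move=> fL; rewrite -(taucNK v s) spec_id//.
have -> : [set u : O | tau v \o zeta L u = tauc v (tauc (- v) s)] =
    [set u : O | zeta L u = tauc (- v) s].
  apply/seteqP; split=> u /=; first by move=> /(can_inj (taucK v)).
  by move=> ->.
case: ifPn => [|/negP nS]; first by rewrite inE => Ss; exact: (zeta_law p_ge0 p0 b_lt1 Hb fL Ss).
rewrite (_ : [set u : O | _] = set0) ?measure0//.
rewrite -subset0 => u /= e; apply: nS; rewrite inE -e.
exact: (zeta_S_of p_ge0 p0 b_lt1 Hb).
Qed.

Variable mu : probability PS R.
Hypothesis muE : forall A : set PS, mu A = unitP [set u : O | A (tau v \o zeta setT u)].

Lemma weak_conv_mu : weak_conv V a (tau v) mu.
Proof.
move=> f [M bM] cf e e0.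
have cg : cont_on_S (f \o tauc v).
  move=> s bs h h0; have [F [fF FH]] := cf _ (bijective_tauc v bs) h h0.
  exists F; split=> // s' bs' ss'; apply: FH; first exact: bijective_tauc.
  by move=> x Fx; rewrite /tauc /= ss'.
have bg s : Sbij s -> `|(f \o tauc v) s| <= M by move=> bs; apply: bM; exact: bijective_tauc.
have [L0 [fL0 H]] := expect_cvg p_ge0 p0 b_lt1 Hb cg bg e0.
exists L0; split=> // L fL LL.
have -> : \sum_(s \in S_cond L (tau v)) spec V a L (tau v) s * f s =
    \sum_(s \in S_of L) weight p L s / partZ p L * (f \o tauc v) s.
  have := tauc_bij v L id setT; rewrite !setIT => bij.
  rewrite (reindex_fsbig _ _ _ _ bij); apply: eq_fsbigr => s sS.
  by rewrite spec_id// sS.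
have -> : (\int[mu]_(s in (@Sbij d : set PS)) (f s)%:E =
    \int[@unitP R]_u ((f \o tauc v) (zeta setT u))%:E)%E; last exact: H.
pose X (u : O) : PS := tauc v (zeta setT u).
have mX : measurable_fun setT X.
  exact: (@measurableT_comp _ _ _ _ _ _ (tauc v : PS -> PS) setT _ (measurable_tauc v)
    (zeta_mfun p_ge0 p0 b_lt1 Hb setT)).
have XS u : Sbij (X u) by apply: bijective_tauc; case: (zFC setT u).
(* [f] is controlled on bijections only, so it is replaced by 0 elsewhere. *)
rewrite integral_mkcond; set g := _ \_ _.
have mg : measurable_fun setT g.
  have m1 : measurable_fun (@Sbij d : set PS) (fun s : PS => (f s)%:E).
    by apply/measurable_EFinP; exact: cont_measurable.
  exact: ((measurable_restrictT _ (@measurable_Sbij d)).1 m1).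
have gX u : g (X u) = ((f \o tauc v) (zeta setT u))%:E by rewrite /g /patch mem_set.
have mu' (A : set PS) : measurable A -> mu A = unitP (X @^-1` A) by move=> _; exact: muE.
have ig : (@unitP R).-integrable (X @^-1` setT) (g \o X).
  rewrite preimage_setT; apply: (le_integrable measurableT _ _ (g := EFin \o cst M)).
  - exact: measurableT_comp.
  - move=> u _ /=; rewrite gX lee_fin.
    by apply: le_trans (ler_norm _); apply: bM; exact: XS.
  - exact: finite_measure_integrable_cst.
apply: (etrans (integral_law mX mu' measurableT mg ig)); rewrite preimage_setT.
by apply: eq_integral => u _; exact: gX.
Qed.

End Assembly.

Theorem theorem2p3 (R : realType) (d : nat) (v : site d) (V : site d -> \bar R)
  (V_ge0 : forall z, (0 <= V z)%E) (V_sconv : strictly_convex V) (V_00 : V 0 = 0%E)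
  (Vv_fin : V v \is a fin_num)
  (hstar : (alpha_star V v < +oo)%E)
  (alpha : R) (halpha : (alpha_star V v < alpha%:E)%E) :
  exists (dO : measure_display) (O : measurableType dO) (P : probability O R)
         (zeta : set (site d) -> O -> pfun d),
    (* zeta_{Lambda,v} is a random element of S_Lambda, for every Lambda
       (zeta setT = zeta_{Z^d,v} is a random element of S) *)
    (forall L, random_map (zeta L)) /\
    (forall L w, S_of L (zeta L w)) /\
    (* (i) *)
    (forall L, finite_set L -> forall s : pfun d,
       P [set w | tau v \o zeta L w = s] = (spec V alpha L (tau v) s)%:E) /\
    (* (ii) almost sure convergence along the net of finite sets *)
    (forall x : site d, {ae P, forall w, exists L0 : set (site d), finite_set L0 /\
        forall L, finite_set L -> L0 `<=` L ->
          (tau v \o zeta L w) x = (tau v \o zeta setT w) x}) /\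
    exists mu_v : probability (PermSp d) R,
      (* mu_v is the law of tau_v zeta_{Z^d,v} *)
      (forall A : set (PermSp d), measurable A ->
         mu_v A = P [set w | A (tau v \o zeta setT w)]) /\
      weak_conv V alpha (tau v) mu_v /\
      (* (iii) *)
      gibbs V alpha mu_v /\ ergodic mu_v /\ mean_jump mu_v v /\
      (* (iv) mu_v tau_{-v} is the unique Gibbs measure with cycle weights w_v
         supported on finite-cycle permutations *)
      exists nu0 : probability (PermSp d) R,
        (forall A : set (PermSp d), measurable A ->
           nu0 A = mu_v [set s : PermSp d | A (tau (- v) \o s)]) /\
        gibbs (Vv V v) alpha nu0 /\ nu0 (@finite_cycle d) = 1%E /\
        (forall nu : probability (PermSp d) R,
           gibbs (Vv V v) alpha nu -> nu (@finite_cycle d) = 1%E ->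
           forall A : set (PermSp d), measurable A -> nu A = nu0 A).
Proof.
(* An [a1] strictly below [alpha] with [beta] less than 1: the gap serves for integrability, and
   monotonicity of the weights brings the bound to [alpha]. *)
have [_ [a1 b1 <-] lt1] := ereal_inf_lt halpha; rewrite lte_fin in lt1.
have ha : (0 < d)%N -> 0 < alpha.
  by move=> d0; apply: lt_trans lt1; exact: (beta_lt1_gt0 V_ge0 V_sconv Vv_fin d0 b1).
pose p := jump_weight v V alpha.
have p_ge0 := jump_weight_ge0 v V alpha; have p0 := jump_weight0 Vv_fin alpha.
have [b b_lt1 Hb] : exists2 b : R, b < 1 &
    (\esum_(o in Cyc2 (d:=d)) ((size o)%:R * cyc_weight p o)%:E <= b%:E)%E.
  have [d0|nd0] := pselect (0 < d)%N; first exact: (sum_size_w V_ge0 V_sconv Vv_fin d0 lt1 b1).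
  (* In dimension 0 there is one site, hence no cycle of length at least 2. *)
  exists 0; rewrite ?ltr01// (_ : Cyc2 (d:=d) = set0) ?esum_set0//.
  rewrite -subset0 => o [[u _] /=]; case: o u => [|x [|y o]]//= + _.
  by rewrite inE (site0_eq x y nd0) eqxx.
have boltzE (L : set (site d)) (s : pfun d) : finite_set L ->
    boltz (Vv V v) alpha L s = (weight p L s)%:E by exact: (boltz_Vv V_ge0 Vv_fin).
have [nu0 [C nu0E]] := cycle_law_exists p_ge0 p0 b_lt1 Hb.
have [mu muE] := law_exists nu0 (measurable_tauc v).
have muE' (A : set (PermSp d)) : mu A = unitP [set u : measurableTypeR R | A (tau v \o zeta p setT u)].
  by rewrite muE nu0E.
exists _, (measurableTypeR R), (@unitP R), (zeta p); split.
  exact: (zeta_measurable p_ge0 p0 b_lt1 Hb).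
split; first exact: (zeta_S_of p_ge0 p0 b_lt1 Hb).
split; first by move=> L fL s; exact: (law_tau_zeta V_ge0 Vv_fin ha b_lt1 Hb).
split.
  move=> x; have := ae_zeta p_ge0 p0 b_lt1 Hb.
  apply: (@filterS _ _ (ae_filter_ringOfSetsType (@unitP R))) => u /(_ x) [L0 [fL0 h]].
  exists L0; split; first exact: fL0.
  by move=> L fL LL; exact: (congr1 (tau v) (h L fL LL)).
exists mu; split; first by move=> A _; exact: muE'.
split; first exact: (weak_conv_mu V_ge0 Vv_fin ha b_lt1 Hb muE').
have G0 : gibbs (Vv V v) alpha nu0 by exact: (cycle_law_gibbs p_ge0 boltzE C).
split; first exact: (gibbs_tau V_ge0 Vv_fin ha muE G0).
split; first by apply: (ergodic_tau muE); exact: (cycle_law_ergodic p_ge0 p0 b_lt1 Hb C).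
split.
  have iJ i : nu0.-integrable setT (EFin \o jump R i).
    have d0 : (0 < d)%N := leq_ltn_trans (leq0n i) (ltn_ord i).
    exact: (jump_integrable V_ge0 V_sconv Vv_fin d0 lt1 b1 C).
  apply: (mean_jump_tau muE iJ) => i.
  exact: (integral_jump p_ge0 p0 b_lt1 Hb C (iJ i)).
exists nu0; split.
  move=> A mA; rewrite muE; congr (nu0 _); apply/seteqP; split=> s /=.
    by rewrite -{1}(taucK v s).
  by rewrite -{2}(taucK v s).
split=> //; split; first by case: C.
move=> nu G n1 A mA.
have C' := gibbs_cycle_law p_ge0 boltzE p0 G n1.
exact: (cycle_law_unique p_ge0 p0 b_lt1 Hb C' C mA).
Qed.
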